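(* Let $\theta>0$ and $\alpha=\sqrt\theta$. For $f\in\mathcal S(\mathbb R)$ and $t\in\mathbb R$ set $$(fU)(t)=f(t-\alpha),\qquad (fV)(t)=e(-\alpha t)f(t),\qquad (fW)(t)=i^{1/6}\int_{-\infty}^{\infty} f(x)\,e(tx-\tfrac12x^2)\,dx,$$ so that the action of $W^2$ is $$(fW^2)(t)=i^{-1/6}\,e(\tfrac12t^2)\int_{-\infty}^{\infty} f(x)\,e(tx)\,dx.$$ Then: (1) Under the action of $U,V,W$, the Schwartz space $\mathcal S(\mathbb R)$ is a finitely generated projective right module $\mathcal M_6$ over $6_\theta^\infty$ (thus giving rise to a class $[\mathcal M_6]$ in $K_0(6_\theta^\infty)$). (2) Under the action of $U,V$ and the order three unitary $W^2$, the Schwartz space $\mathcal S(\mathbb R)$ is a finitely generated projective right module $\mathcal M_3$ over $3_\theta^\infty$ (thus giving rise to a class $[\mathcal M_3]$ in $K_0(3_\theta^\infty)$). (3) One has $$\tau_*[\mathcal M_6]=\frac{\theta}{6},\qquad \tau_*[\mathcal M_3]=\frac{\theta}{3},$$ where $\tau_*$ is the map induced on $K_0$ by the canonical trace $\tau$.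
   Context: Notation: $e(t):=e^{2\pi i t}$; $i^{1/6}=e^{\pi i/12}$; $\mathcal S(\mathbb R)$ is the space of complex-valued Schwartz functions on $\mathbb R$. For $\theta>0$ put $\lambda=e(\theta)$ and $\lambda^{1/2}=e(\theta/2)$. The rotation C*-algebra $A_\theta$ is the universal C*-algebra generated by unitaries $U,V$ with $VU=\lambda UV$; $A_\theta^\infty$ is its canonical smooth dense *-subalgebra, consisting of the sums $\sum_{m,n}a_{mn}U^mV^n$ with $(a_{mn})$ rapidly decreasing on $\mathbb Z^2$. Let $\rho$ be the canonical order six automorphism of $A_\theta$ given by $\rho(U)=V$, $\rho(V)=\lambda^{-1/2}U^{-1}V$; then $\rho^2$ has order three. The crossed product $6_\theta:=A_\theta\rtimes_\rho\mathbb Z_6$ is the universal C*-algebra generated by unitaries $U,V,W$ satisfying $$VU=\lambda UV,\quad WUW^{-1}=V,\quad WVW^{-1}=\lambda^{-1/2}U^{-1}V,\quad W^6=I.$$ The crossed product $3_\theta:=A_\theta\rtimes_{\rho^2}\mathbb Z_3$ is viewed as the C*-subalgebra of $6_\theta$ generated by $U,V,W^2$. Their canonical smooth dense *-subalgebras are $$6_\theta^\infty=\Big\{\sum_{j=0}^5a_jW^j: a_j\in A_\theta^\infty\Big\},\qquad 3_\theta^\infty=\Big\{\sum_{j=0}^2a_jW^{2j}: a_j\in A_\theta^\infty\Big\}.$$ There are natural isomorphisms $K_0(6_\theta^\infty)=K_0(6_\theta)$ and $K_0(3_\theta^\infty)=K_0(3_\theta)$. The canonical trace on $A_\theta$ is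 the tracial state with $\tau\big(\sum a_{mn}U^mV^n\big)=a_{00}$ for elements of $A_\theta^\infty$; the canonical trace $\tau$ on $6_\theta$ (respectively $3_\theta$) is the tracial state with $\tau\big(\sum_j a_jW^j\big)=\tau(a_0)$ (respectively $\tau\big(\sum_j a_jW^{2j}\big)=\tau(a_0)$). The induced map $\tau_*$ on $K_0$ sends the class of a projection (or idempotent) in a matrix algebra to its unnormalized matrix trace (the sum of $\tau$ of its diagonal entries). Right-module convention: $f(ab)=(fa)b$, and an element $\sum a_{mn}U^mV^n\in A_\theta^\infty$ acts on $\mathcal S(\mathbb R)$ by the corresponding series. *)

(* Defs.v *)
(* Mathematical Components and MathComp-Analysis, over R : realType; the complex
   numbers are R[i] from mathcomp-real-closed. *)
From HB Require Import structures.
From mathcomp Require Import all_boot all_order all_algebra finmap.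
From mathcomp Require Import all_classical all_reals all_analysis.
From mathcomp Require Import complex generic_quotient.
From mathcomp Require summability.

Set Implicit Arguments.
Unset Strict Implicit.
Unset Printing Implicit Defensive.

Import Order.TTheory GRing.Theory Num.Theory numFieldNormedType.Exports.
Local Open Scope classical_set_scope.
Local Open Scope ring_scope.

(* A ring that is also a normedModType would have to be a numDomainType in the
   MathComp hierarchy, so the norm is a plain field with values in R. *)
HB.mixin Record Algebra_isCStarAlgebra (R : realType) A
    of GRing.Algebra R[i] A := {
  star : A -> A;
  starK : involutive star;
  starD : {morph star : x y / x + y};
  starZ : forall (c : R[i]) x, star (c *: x) = Num.conj c *: star x;
  starM : forall x y, star (x * y) = star y * star x;
  cnorm : A -> R;
  cnorm0_eq0 : forall x, cnorm x = 0 -> x = 0;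
  cnormD : forall x y, cnorm (x + y) <= cnorm x + cnorm y;
  cnormZ : forall (c : R[i]) x, cnorm (c *: x) = complex.Re `|c| * cnorm x;
  cnormM : forall x y, cnorm (x * y) <= cnorm x * cnorm y;
  cnorm_cstar : forall x, cnorm (star x * x) = cnorm x ^+ 2;
  cnorm_complete : forall u : nat -> A,
    (forall e : R, 0 < e -> exists N : nat,
       forall m n : nat, (N <= m)%N -> (N <= n)%N -> cnorm (u m - u n) < e) ->
    exists l : A, cnorm (u n - l) @[n --> \oo] --> (0 : R)
}.

#[short(type="cstarAlgType")]
HB.structure Definition CStarAlgebra (R : realType) :=
  {A of GRing.Algebra R[i] A & Algebra_isCStarAlgebra R A}.

Section RotationAlgebra.
Variable R : realType.
Local Notation C := R[i].

(* e(t) = exp(2 pi i t) *)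
Definition e_ (t : R) : C :=
  Complex (cos (2 * trigo.pi * t)) (sin (2 * trigo.pi * t)).

Section InCStarAlgebra.
Variable B : cstarAlgType R.
Implicit Types U V W x : B.

Definition unitary x := star x * x = 1 /\ x * star x = 1.

Definition rel6 (theta : R) U V W :=
  [/\ [/\ unitary U, unitary V & unitary W],
      V * U = e_ theta *: (U * V),
      W * U * star W = V,
      W * V * star W = e_ (- (theta / 2)) *: (star U * V) &
      W ^+ 6 = 1].

(* integer powers of a unitary *)
Definition upow x (m : int) : B :=
  match m with Posz n => x ^+ n | Negz n => star x ^+ n.+1 end.

Definition mono U V (p : int * int) : B := upow U p.1 * upow V p.2.

(* unconditional norm convergence of a series indexed by Z^2 *)
Definition has_sum (u : int * int -> B) x :=
  cnorm (summability.partial_sum u F - x) @[F --> summability.totally]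
    --> (0 : R).

Definition rapid (a : int * int -> C) :=
  forall k : nat, exists K : R, forall p,
    `|a p| * ((1 + `|p.1|%N + `|p.2|%N) ^ k)%:R <= (K%:C)%C.

(* x = \sum_(m, n) a_mn U^m V^n *)
Definition is_series U V (a : int * int -> C) x :=
  rapid a /\ has_sum (fun p => a p *: mono U V p) x.

Definition smoothA U V : set B := [set x | exists a, is_series U V a x].

Definition smooth6 U V W : set B :=
  [set x | exists2 y : 'I_6 -> B, forall j, smoothA U V (y j) &
             x = \sum_j y j * W ^+ j].

Definition smooth3 U V W : set B :=
  [set x | exists2 y : 'I_3 -> B, forall j, smoothA U V (y j) &
             x = \sum_j y j * W ^+ (2 * j)].

Definition tracial_state (tau : B -> C) :=
  [/\ forall (c : C) x y, tau (c *: x + y) = c * tau x + tau y,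
      forall x, 0 <= tau (star x * x),
      forall x, `|tau x| <= ((cnorm x)%:C)%C,
      tau 1 = 1 &
      forall x y, tau (x * y) = tau (y * x)].

(* The restriction of tau to the C*-subalgebra generated by U, V, W^2 is the
   canonical trace of that subalgebra. *)
Definition canonical_trace U V W (tau : B -> C) :=
  tracial_state tau /\
  forall (y : 'I_6 -> B) (a : int * int -> C),
    (forall j, smoothA U V (y j)) -> is_series U V a (y ord0) ->
    tau (\sum_j y j * W ^+ j) = a (0, 0).

End InCStarAlgebra.

Definition star_morphism (B D : cstarAlgType R) (f : {lrmorphism B -> D}) :=
  forall x, f (star x) = star (f x).

(* B, with U, V, W, is the universal C*-algebra 6_theta; that B is generated by
   U, V, W is part of the uniqueness clause. *)
Definition universal6 (theta : R) (B : cstarAlgType R) (U V W : B) :=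
  rel6 theta U V W /\
  forall (D : cstarAlgType R) (U' V' W' : D), rel6 theta U' V' W' ->
    (exists2 f : {lrmorphism B -> D}, star_morphism f &
       [/\ f U = U', f V = V' & f W = W']) /\
    (forall f g : {lrmorphism B -> D}, star_morphism f -> star_morphism g ->
       f U = g U -> f V = g V -> f W = g W -> f =1 g).

(* (A, iota) is the subset S of B as a ring *)
Definition is_subring (B : cstarAlgType R) (S : set B)
    (A : nzRingType) (iota : {rmorphism A -> B}) :=
  injective iota /\ range iota = S.

End RotationAlgebra.

(* right A-modules are left modules over the converse ring A^c *)
Definition ract (A : nzRingType) (M : lmodType A^c) (m : M) (a : A) : M :=
  (a : A^c) *: m.

Section Modules.
Variable A : nzRingType.

Definition finitely_generated (M : lmodType A^c) :=
  exists (n : nat) (g : 'I_n -> M), forall m : M, exists c : 'I_n -> A,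
    m = \sum_i ract (g i) (c i).

Definition projective (M : lmodType A^c) :=
  forall (N P : lmodType A^c) (g : {linear N -> P}) (h : {linear M -> P}),
    (forall p, exists n, g n = p) ->
    exists k : {linear M -> N}, forall m, g (k m) = h m.

Record idmx := IdMx {
  idim : nat;
  imx :> 'M[A]_idim;
  imxP : imx *m imx = imx
}.

HB.instance Definition _ := gen_eqMixin idmx.
HB.instance Definition _ := gen_choiceMixin idmx.

Lemma idsum_subproof (e f : idmx) :
  block_mx (imx e) 0 0 (imx f) *m block_mx (imx e) 0 0 (imx f) =
  block_mx (imx e) 0 0 (imx f).
Proof.
by rewrite mulmx_block !mulmx0 !mul0mx !addr0 !add0r !imxP.
Qed.
Definition idsum (e f : idmx) : idmx := IdMx (idsum_subproof e f).

Lemma id0_subproof : (0 : 'M[A]_0) *m 0 = 0 :> 'M[A]_0.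
Proof. by rewrite mul0mx. Qed.
Definition id0 : idmx := IdMx id0_subproof.

(* algebraic Murray-von Neumann equivalence, i.e. e A^n ~= f A^m *)
Definition mvn (e f : idmx) :=
  exists (x : 'M[A]_(idim e, idim f)) (y : 'M[A]_(idim f, idim e)),
    x *m y = e /\ y *m x = f.

Lemma mvn_refl e : mvn e e.
Proof. by exists e, e; rewrite imxP. Qed.

Lemma mvn_sym e f : mvn e f -> mvn f e.
Proof. by case=> x [y [exy fyx]]; exists y, x. Qed.

Lemma mvn_trans f e g : mvn e f -> mvn f g -> mvn e g.
Proof.
case=> x [y [exy fyx]] [z [w [fzw gwz]]]; exists (x *m z), (w *m y); split.
- by rewrite mulmxA -(mulmxA x) fzw -fyx !mulmxA exy -mulmxA exy imxP.
- by rewrite mulmxA -(mulmxA w) fyx -fzw !mulmxA gwz -mulmxA gwz imxP.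
Qed.

Lemma mvn_sum e e' f f' :
  mvn e e' -> mvn f f' -> mvn (idsum e f) (idsum e' f').
Proof.
case=> x [y [exy eyx]] [z [w [fzw fwz]]].
exists (block_mx x 0 0 z), (block_mx y 0 0 w).
by rewrite !mulmx_block !mulmx0 !mul0mx !addr0 !add0r exy eyx fzw fwz.
Qed.

Lemma mvn_sumC e f : mvn (idsum e f) (idsum f e).
Proof.
exists (block_mx 0 (imx e) (imx f) 0), (block_mx 0 (imx f) (imx e) 0).
by rewrite !mulmx_block !mulmx0 !mul0mx !addr0 !add0r !imxP.
Qed.

Lemma mvn_cast m n (eq_mn : m = n) (e : 'M[A]_m) (f : 'M[A]_n)
    (eP : e *m e = e) (fP : f *m f = f) :
  castmx (eq_mn, eq_mn) e = f -> mvn (IdMx eP) (IdMx fP).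
Proof.
move: f fP; case: n / eq_mn => f fP /=; rewrite castmx_id => ef.
by subst f; exists e, e; rewrite eP.
Qed.

Lemma mvn_sumA e f g :
  mvn (idsum e (idsum f g)) (idsum (idsum e f) g).
Proof.
apply: (@mvn_cast _ _ (addnA _ _ _)).
have := @block_mxA A _ _ _ _ _ _ (imx e) 0 0 0 (imx f) 0 0 0 (imx g).
rewrite !row_mx0 !col_mx0 => ->.
by rewrite castmx_comp castmx_id.
Qed.

Lemma mvn_sum0 e : mvn (idsum id0 e) e.
Proof.
exists (col_mx 0 (imx e)), (row_mx 0 (imx e)); split.
  by rewrite mul_col_row !mulmx0 !mul0mx imxP.
by rewrite mul_row_col mulmx0 add0r imxP.
Qed.

Definition mvnb e f := `[< mvn e f >].

Lemma mvnb_equiv : equiv_class_of mvnb.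
Proof.
split=> [e|e f|f e g]; first exact/asboolP/mvn_refl.
  by apply/asboolP/asboolP => /mvn_sym.
by move=> /asboolP ef /asboolP fg; apply/asboolP/(mvn_trans ef fg).
Qed.
Canonical mvnb_equiv_rel := EquivRelPack mvnb_equiv.

(* Equivalence classes of idempotent matrices under block sum: the monoid of
   isomorphism classes of finitely generated projective right A-modules. *)
Definition Vmon := {eq_quot mvnb_equiv_rel}%qT.
HB.instance Definition _ := Choice.on Vmon.
HB.instance Definition _ := EqQuotient.on Vmon.

Definition Vclass (e : idmx) : Vmon := (\pi_(Vmon)%qT e).

Lemma VclassP e f : Vclass e = Vclass f <-> mvn e f.
Proof.
split=> [/eqP|ef]; first by rewrite /Vclass piE => /asboolP.
by apply/eqP; rewrite /Vclass piE; apply/asboolP.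
Qed.

Lemma reprVK x : Vclass (repr x) = x.
Proof. exact: reprK. Qed.

Definition Vadd (x y : Vmon) : Vmon := Vclass (idsum (repr x) (repr y)).

Lemma VaddE e f : Vadd (Vclass e) (Vclass f) = Vclass (idsum e f).
Proof. by apply/VclassP/mvn_sum; apply/VclassP; rewrite reprVK. Qed.

Lemma VaddA : associative Vadd.
Proof.
move=> x y z; rewrite -(reprVK x) -(reprVK y) -(reprVK z) !VaddE.
exact/VclassP/mvn_sumA.
Qed.

Lemma VaddC : commutative Vadd.
Proof.
by move=> x y; rewrite -(reprVK x) -(reprVK y) !VaddE; apply/VclassP/mvn_sumC.
Qed.

Lemma Vadd0 : left_id (Vclass id0) Vadd.
Proof. by move=> x; rewrite -(reprVK x) VaddE; apply/VclassP/mvn_sum0. Qed.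

HB.instance Definition _ := GRing.isNmodule.Build Vmon VaddA VaddC Vadd0.

(* the Grothendieck group of Vmon *)
Definition groth (p q : Vmon * Vmon) :=
  `[< exists z, p.1 + q.2 + z = q.1 + p.2 + z >].

Lemma groth_equiv : equiv_class_of groth.
Proof.
split=> [p|p q|q p r]; first by apply/asboolP; exists 0.
  by apply/asboolP/asboolP => -[z E]; exists z.
move=> /asboolP[z E] /asboolP[w F]; apply/asboolP.
exists (q.1 + q.2 + z + w).
transitivity ((p.1 + q.2 + z) + (q.1 + r.2 + w)).
  by rewrite [LHS](AC (2*4) ((1*4*5)*(3*2*6))).
by rewrite E F [LHS](AC (3*3) ((4*2)*(1*5*3*6))).
Qed.
Canonical groth_equiv_rel := EquivRelPack groth_equiv.

Definition K0 := {eq_quot groth_equiv_rel}%qT.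
HB.instance Definition _ := Choice.on K0.
HB.instance Definition _ := EqQuotient.on K0.

(* the formal difference p.1 - p.2 *)
Definition K0diff (p : Vmon * Vmon) : K0 := (\pi_(K0)%qT p).

Lemma K0diffP p q :
  K0diff p = K0diff q <-> exists z, p.1 + q.2 + z = q.1 + p.2 + z.
Proof.
split=> [/eqP|pq]; first by rewrite /K0diff piE => /asboolP.
by apply/eqP; rewrite /K0diff piE; apply/asboolP.
Qed.

Lemma reprKK x : K0diff (repr x) = x.
Proof. exact: reprK. Qed.

Definition K0add (x y : K0) : K0 :=
  K0diff ((repr x).1 + (repr y).1, (repr x).2 + (repr y).2).
Definition K0opp (x : K0) : K0 := K0diff ((repr x).2, (repr x).1).

Lemma K0addE p q :
  K0add (K0diff p) (K0diff q) = K0diff (p.1 + q.1, p.2 + q.2).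
Proof.
have /K0diffP[z E] := reprKK (K0diff p); have /K0diffP[w F] := reprKK (K0diff q).
apply/K0diffP; exists (z + w) => /=.
move: (repr (K0diff p)) (repr (K0diff q)) E F => p' q' E F.
transitivity ((p'.1 + p.2 + z) + (q'.1 + q.2 + w)).
  by rewrite [LHS](AC (2*2*2) ((1*3*5)*(2*4*6))).
by rewrite E F [LHS](AC (3*3) ((1*4)*(2*5)*(3*6))).
Qed.

Lemma K0oppE p : K0opp (K0diff p) = K0diff (p.2, p.1).
Proof.
have /K0diffP[z E] := reprKK (K0diff p).
apply/K0diffP; exists z => /=.
by rewrite [X in X + z]addrC -E [X in _ = X + z]addrC.
Qed.

Lemma K0addA : associative K0add.
Proof.
move=> x y z; rewrite -(reprKK x) -(reprKK y) -(reprKK z) !K0addE /=.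
by rewrite !addrA.
Qed.

Lemma K0addC : commutative K0add.
Proof.
move=> x y; rewrite -(reprKK x) -(reprKK y) !K0addE.
by rewrite addrC [X in (_, X)]addrC.
Qed.

Lemma K0add0 : left_id (K0diff (0, 0)) K0add.
Proof. by move=> x; rewrite -(reprKK x) K0addE !add0r; case: (repr x). Qed.

Lemma K0addN : left_inverse (K0diff (0, 0)) K0opp K0add.
Proof.
move=> x; rewrite -(reprKK x) K0oppE K0addE; apply/K0diffP; exists 0 => /=.
by rewrite !addr0 add0r addrC.
Qed.

HB.instance Definition _ :=
  GRing.isZmodule.Build K0 K0addA K0addC K0add0 K0addN.

Definition K0idem (e : idmx) : K0 := K0diff (Vclass e, 0).

(* M is isomorphic to the right module e A^n of columns v with e v = v *)
Definition represents (M : lmodType A^c) (e : idmx) :=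
  exists phi : {additive M -> 'cV[A]_(idim e)},
    [/\ injective phi,
        forall m a, phi (ract m a) = phi m *m a%:M &
        range phi = [set v | imx e *m v = v]].

(* [M], for M finitely generated projective (0 otherwise) *)
Definition K0class (M : lmodType A^c) : K0 :=
  xget 0 [set x | exists2 e, represents M e & x = K0idem e].

Lemma represents_map (M : lmodType A^c) (e f : idmx)
    (phi : {additive M -> 'cV[A]_(idim e)})
    (psi : {additive M -> 'cV[A]_(idim f)}) :
  injective phi -> (forall m a, phi (ract m a) = phi m *m a%:M) ->
  range phi = [set v | imx e *m v = v] ->
  (forall m a, psi (ract m a) = psi m *m a%:M) ->
  exists (y : 'M[A]_(idim f, idim e)) (g : 'I_(idim e) -> M),
    [/\ forall m, psi m = y *m phi m,
        forall j, col j y = psi (g j) &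
        forall j, col j (imx e) = phi (g j)].
Proof.
move=> phi_inj phiM rphi psiM.
have /choice[g gE] : forall j, exists m, phi m = col j (imx e).
  move=> j; have : range phi (col j (imx e)).
    by rewrite rphi /= colE mulmxA imxP.
  by case=> m _ <-; exists m.
exists (\matrix_(i, j) psi (g j) i 0), g; split=> // [m|j]; last first.
  by apply/colP => i; rewrite !mxE.
have {1}-> : m = \sum_j ract (g j) (phi m j 0).
  apply: phi_inj; rewrite raddf_sum.
  have : range phi (phi m) by exists m.
  rewrite rphi /= => {1}<-; apply/colP => i.
  rewrite mxE summxE; apply: eq_bigr => j _.
  by rewrite phiM gE mxE big_ord1 !mxE mulr1n.
rewrite raddf_sum; apply/colP => i; rewrite summxE mxE; apply: eq_bigr => j _.
by rewrite psiM !mxE big_ord1 !mxE mulr1n.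
Qed.

Lemma represents_mvn M e f : represents M e -> represents M f -> mvn e f.
Proof.
move=> [phi [phi_inj phiM rphi]] [psi [psi_inj psiM rpsi]].
have [y [g [yE yg eg]]] := represents_map phi_inj phiM rphi psiM.
have [x [h [xE xh fh]]] := represents_map psi_inj psiM rpsi phiM.
exists x, y; split; apply/matrixP => i j.
- suff /colP/(_ i) : col j (x *m y) = col j (imx e) by rewrite [LHS]mxE [RHS]mxE.
  by rewrite colE -mulmxA -colE yg -xE eg.
- suff /colP/(_ i) : col j (y *m x) = col j (imx f) by rewrite [LHS]mxE [RHS]mxE.
  by rewrite colE -mulmxA -colE xh -yE fh.
Qed.

Lemma K0classE M e : represents M e -> K0class M = K0idem e.
Proof.
move=> Me; rewrite /K0class; case: xgetP => [x _ [f Mf ->]|/(_ (K0idem e)) []].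
  by rewrite /K0idem; congr (K0diff (_, _)); apply/VclassP/(represents_mvn Mf Me).
by exists e.
Qed.

Section Trace.
Variables (S : zmodType) (tau : A -> S).

Definition Vtrace (x : Vmon) : S := tau (\tr (imx (repr x))).

(* the induced map tau_*, well defined when tau is additive and tracial
   (K0trace_idem) *)
Definition K0trace (x : K0) : S :=
  Vtrace (repr x).1 - Vtrace (repr x).2.

Hypothesis tauD : {morph tau : a b / a + b}.
Hypothesis tauC : forall a b, tau (a * b) = tau (b * a).

Let tau0 : tau 0 = 0.
Proof. by apply: (addIr (tau 0)); rewrite -tauD !add0r. Qed.

Let tau_tr n (x : 'M[A]_n) : tau (\tr x) = \sum_i tau (x i i).
Proof. exact: (big_morph tau tauD tau0). Qed.

Let tau_mvn e f : mvn e f -> tau (\tr (imx e)) = tau (\tr (imx f)).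
Proof.
case=> x [y [<- <-]]; rewrite !tau_tr.
under eq_bigr do rewrite mxE (big_morph tau tauD tau0).
under [RHS]eq_bigr do rewrite mxE (big_morph tau tauD tau0).
rewrite exchange_big; apply: eq_bigr => i _; apply: eq_bigr => j _.
exact: tauC.
Qed.

Lemma VtraceE e : Vtrace (Vclass e) = tau (\tr (imx e)).
Proof. exact/tau_mvn/VclassP/reprVK. Qed.

Lemma VtraceD : {morph Vtrace : x y / x + y}.
Proof.
move=> x y; rewrite -(reprVK x) -(reprVK y) [_ + _]VaddE !VtraceE.
by rewrite mxtrace_block tauD.
Qed.

Lemma K0traceE p : K0trace (K0diff p) = Vtrace p.1 - Vtrace p.2.
Proof.
have /K0diffP[z /(congr1 Vtrace)] := reprKK (K0diff p).
rewrite /K0trace !VtraceD => /addIr E.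
by apply/eqP; rewrite subr_eq addrAC -E addrK.
Qed.

Lemma K0traceD : {morph K0trace : x y / x + y}.
Proof.
move=> x y; rewrite -(reprKK x) -(reprKK y) [_ + _]K0addE !K0traceE /=.
by rewrite !VtraceD opprD addrACA.
Qed.

Lemma K0trace_idem e : K0trace (K0idem e) = tau (\tr (imx e)).
Proof.
rewrite K0traceE /= VtraceE -[0]/(Vclass id0) VtraceE.
by rewrite [\tr (imx id0)]mxtrace0 tau0 subr0.
Qed.

End Trace.

End Modules.

Section Schwartz.
Variable R : realType.
Local Notation C := R[i].

Definition schwartz_real (g : R -> R) :=
  (forall (n : nat) (x : R), derivable (derive1n n g) x 1) /\
  (forall k l : nat, exists K : R, forall t : R,
     `|t| ^+ k * `|derive1n l g t| <= K).

Definition schwartz (f : R -> C) :=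
  schwartz_real (fun t => complex.Re (f t)) /\
  schwartz_real (fun t => complex.Im (f t)).

Definition cintegral (g : R -> C) : C :=
  Complex (\int[lebesgue_measure]_x complex.Re (g x))
          (\int[lebesgue_measure]_x complex.Im (g x)).

Definition opU (alpha : R) (f : R -> C) : R -> C := fun t => f (t - alpha).

Definition opV (alpha : R) (f : R -> C) : R -> C :=
  fun t => e_ (- (alpha * t)) * f t.

(* i^(1/6) = e(1/24) *)
Definition opW (f : R -> C) : R -> C :=
  fun t => e_ (1 / 24) * cintegral (fun x => f x * e_ (t * x - x ^+ 2 / 2)).

Definition opW2 (f : R -> C) : R -> C :=
  fun t => e_ (- (1 / 24)) * e_ (t ^+ 2 / 2) *
           cintegral (fun x => f x * e_ (t * x)).

Section Action.
Variables (B : cstarAlgType R) (A : nzRingType) (iota : {rmorphism A -> B}).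
Variables (M : lmodType A^c) (phi : {additive M -> (R -> C)}).

Definition acts_as (x : B) (T : (R -> C) -> (R -> C)) :=
  forall a, iota a = x -> forall m, phi (ract m a) = T (phi m).

(* elements \sum a_mn U^m V^n act by the corresponding series, the function
   series being summed unconditionally at every point; R[i]^o carries the
   topology of R[i] *)
Definition acts_by_series (U V : B) :=
  forall u : int * int -> A, (forall p, iota (u p) = mono U V p) ->
  forall a b, is_series U V a (iota b) ->
  forall m t,
    summability.partial_sum
      (fun p => a p * phi (ract m (u p)) t : C^o) F @[F --> summability.totally]
    --> (phi (ract m b) t : C^o).

(* phi identifies the abelian group of M with the Schwartz space, in such a
   way that U, V and their series act as prescribed *)
Definition schwartz_module (alpha : R) (U V : B) :=
  [/\ injective phi,
      range phi = [set f | schwartz f],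
      acts_as U (opU alpha),
      acts_as V (opV alpha) &
      acts_by_series U V].

End Action.

End Schwartz.

(* Main.v *)
From Pilot Require Import Defs.
From HB Require Import structures.
From mathcomp Require Import all_boot all_order all_algebra finmap.
From mathcomp Require Import all_classical all_reals all_analysis.
From mathcomp Require Import measurable_realfun complex ring lra zify.
From mathcomp Require summability.
Import Order.TTheory GRing.Theory Num.Theory numFieldNormedType.Exports.
Local Open Scope classical_set_scope.
Local Open Scope ring_scope.
Set Implicit Arguments.
Unset Strict Implicit.
Unset Printing Implicit Defensive.

(* With theta = al ^ 2, write w_p (p in Z^2) for the Weyl elements of A_theta. The action of
   x = \sum_j W^j \sum_p c_jp w_p on a Schwartz function f is read off from its coefficients
   c_jp = tau(x w_(-p) W^(-j)), so that no representation of the C*-algebra is needed, and it is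
   multiplicative because the integral operator W has order six and permutes the Weyl
   operators. Its order, and the formula for its square, hold because an operator that
   commutes with multiplication by t and fixes a nowhere vanishing Gaussian is the identity
   (Hadamard division).

   Cutting R into al-periodic families of short bumps g_i, and taking plateaus h_i equal to 1 on
   the support of g_i, Poisson summation gives u = \sum_i g_i . <h_i, u> where
   <h, u> = \sum_p al (\int h (u . w_(-p))) w_p. Averaging over the cyclic group of order n
   turns the u |-> <h_i, u> into module maps phi_i over the crossed product, characterized by
   tau(phi_i(u) z) = (al / n) \int h_i (u . z). Thus (g_i, phi_i) is a finite dual basis, the
   matrix phi_i(g_j) is an idempotent representing the module, and its trace is
   (al / n) \sum_i \int g_i = al ^ 2 / n. *)

(** Only relations, norm and trace of the C*-algebra are at hand, so identities between smooth
    elements are proved by pairing with an arbitrary smooth z: the trace pairing is nondegenerate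
    and turns additivity and linearity of the phi_i into identities between integrals. Closure of
    the smooth elements under products comes from the ring given with them. Both crossed products
    are treated at once, as sums \sum_j y_j W^(d j) with d n = 6. The fixed Gaussian is exp(- pi a
    t^2): formally W sends it to a multiple of exp(- pi t^2 / (a + i)), so a^2 + i a = 1, which a =
    e^(- i pi / 6) solves; i^(1/6) is the phase for which the eigenvalue is 1. The sign of the
    square root in the Gaussian integral is settled by following its real part from the real case.
    The g_i must be short against the period 1/al: then each function entering Poisson summation is
    supported within half a period of 0, and a single point contributes. The g_i and their
    translates are differences of one smooth step, so that they sum to 1 by telescoping. *)

Section ComplexModulus.
Variable R : realType.
Local Notation C := R[i].

(** The canonical norm of [R[i]] takes its values in [R[i]]; a modulus with values in [R] keeps all
    estimates in the real field. *)
Definition cabs (z : C) : R := Normc.normc z.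

Lemma cabs_ge0 z : 0 <= cabs z.
Proof. by rewrite /cabs /Normc.normc; case: z => a b; exact: sqrtr_ge0. Qed.

Lemma cabs0 : cabs 0 = 0. Proof. exact: Normc.normc0. Qed.
Lemma cabs1 : cabs 1 = 1. Proof. exact: Normc.normc1. Qed.
Lemma cabsM x y : cabs (x * y) = cabs x * cabs y. Proof. exact: Normc.normcM. Qed.
Lemma cabsN x : cabs (- x) = cabs x. Proof. exact: normcN. Qed.
Lemma cabsD x y : cabs (x + y) <= cabs x + cabs y. Proof. exact: le_normcD. Qed.
Lemma cabs_eq0 x : cabs x = 0 -> x = 0. Proof. exact: Normc.eq0_normc. Qed.

Lemma cabsE (z : C) : `|z| = ((cabs z)%:C)%C.
Proof. by rewrite normc_def; congr (_%:C)%C; case: z. Qed.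

Lemma cabs_sqr (z : C) : cabs z ^+ 2 = complex.Re z ^+ 2 + complex.Im z ^+ 2.
Proof. by case: z => a b; rewrite /cabs /= sqr_sqrtr// addr_ge0// sqr_ge0. Qed.

Lemma Re_le_cabs (z : C) : `|complex.Re z| <= cabs z.
Proof.
rewrite -(ler_pXn2r (n := 2)) ?nnegrE ?cabs_ge0// cabs_sqr -normrX ger0_norm ?sqr_ge0//.
by rewrite lerDl sqr_ge0.
Qed.

Lemma Im_le_cabs (z : C) : `|complex.Im z| <= cabs z.
Proof.
rewrite -(ler_pXn2r (n := 2)) ?nnegrE ?cabs_ge0// cabs_sqr -normrX ger0_norm ?sqr_ge0//.
by rewrite lerDr sqr_ge0.
Qed.

Lemma cabs_le (z : C) : cabs z <= `|complex.Re z| + `|complex.Im z|.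
Proof.
rewrite -(ler_pXn2r (n := 2)) ?nnegrE ?cabs_ge0 ?addr_ge0// cabs_sqr.
rewrite -[X in X + _]real_normK ?num_real// -[X in _ + X]real_normK ?num_real//.
have := normr_ge0 (complex.Re z); have := normr_ge0 (complex.Im z).
move: `|_| `|_| => a b a0 b0; nra.
Qed.

Lemma cabs_real (r : R) : cabs (r%:C)%C = `|r|.
Proof. by rewrite /cabs /= expr0n addr0 sqrtr_sqr. Qed.

Lemma cabsX z n : cabs (z ^+ n) = cabs z ^+ n.
Proof. by elim: n => [|n IH]; rewrite ?expr0 ?cabs1// !exprS cabsM IH. Qed.

Lemma cabsB x y : cabs (x - y) <= cabs x + cabs y.
Proof. by rewrite -(cabsN y) cabsD. Qed.

Lemma cabs_dist x y : cabs (x - y) = cabs (y - x).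
Proof. by rewrite -cabsN opprB. Qed.

Lemma cabs_sum (I : Type) (s : seq I) (F : I -> C) :
  cabs (\sum_(i <- s) F i) <= \sum_(i <- s) cabs (F i).
Proof.
elim: s => [|i s IH]; rewrite ?big_nil ?cabs0// !big_cons.
by apply: le_trans (cabsD _ _) _; rewrite lerD2l.
Qed.

Lemma mulr_conj_cabs1 (z : C) : cabs z = 1 -> z * Num.conj z = 1.
Proof. by move=> z1; rewrite -normCK cabsE z1 expr1n. Qed.

Lemma normC_le (z : C) (K : R) : (`|z| <= (K%:C)%C) = (cabs z <= K).
Proof. by rewrite cabsE lecR. Qed.

(** Completeness in the sequential form of [cnorm_complete], so that [C] and the C*-algebra become
    instances of one [complete_norm]. *)
Lemma complex_cauchy (u : nat -> C) :
  (forall e : R, 0 < e -> exists N : nat,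
     forall m n : nat, (N <= m)%N -> (N <= n)%N -> cabs (u m - u n) < e) ->
  exists l : C, cabs (u n - l) @[n --> \oo] --> (0 : R).
Proof.
move=> Cu.
have comp (p : C -> R) : (forall x y, p (x - y) = p x - p y) ->
    (forall x, `|p x| <= cabs x) ->
    exists l : R, (fun n => p (u n)) @ \oo --> l.
  move=> pB ple.
  have : cvg ((fun n => p (u n)) @ \oo).
    apply/cauchy_cvgP/cauchy_ballP => e e0.
    have [N NP] := Cu _ e0.
    exists ((fun n => p (u n)) @` [set n | (N <= n)%N],
            (fun n => p (u n)) @` [set n | (N <= n)%N]) => /=.
      by split; exists N => // n Nn; exists n.
    move=> [_ _] [[m Nm <-] [n Nn <-]] /=; rewrite /ball /=.
    by rewrite -pB; apply: le_lt_trans (ple _) _; exact: NP.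
  by move=> /cvg_ex[l ul]; exists l.
have [a ua] := comp _ (fun x y => raddfB (@complex.Re R : Rcomplex R -> R) x y) Re_le_cabs.
have [b ub] := comp _ (fun x y => raddfB (@complex.Im R : Rcomplex R -> R) x y) Im_le_cabs.
exists (Complex a b).
have lim : `|complex.Re (u n) - a| + `|complex.Im (u n) - b| @[n --> \oo] --> (0 : R).
  rewrite -(addr0 0); apply: cvgD; apply/norm_cvg0P/subr_cvg0 => //.
apply: (squeeze_cvgr _ (@cvg_cst _ _ _ _ _) lim).
near=> n; rewrite cabs_ge0/=; apply: le_trans (cabs_le _) _.
by case: (u n) => x y.
Unshelve. all: by end_near. Qed.

End ComplexModulus.

(** * Unconditional summation *)

Section UnconditionalSums.
Variable R : realType.

Definition bounded_sums (I : choiceType) (a : I -> R) (M : R) :=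
  forall F : {fset I}, \sum_(i <- F) a i <= M.

Lemma bounded_sumsS (I : choiceType) (a b : I -> R) M :
  (forall i, a i <= b i) -> bounded_sums b M -> bounded_sums a M.
Proof. by move=> ab bM F; apply: le_trans (bM F); apply: ler_sum. Qed.

Lemma fset_bigU (I : choiceType) (V : nmodType) (a : I -> V) (F G : {fset I}) :
  [disjoint F & G]%fset ->
  \sum_(i <- (F `|` G)%fset) a i = \sum_(i <- F) a i + \sum_(i <- G) a i.
Proof.
move=> FG; rewrite (big_fsetID _ (fun i => i \in F)) /=; congr (_ + _).
  apply: eq_fbigl => i; rewrite !inE /=.
  by case: (i \in F); rewrite ?andbT ?andbF// orbF.
apply: eq_fbigl => i; rewrite !inE /=.
have [iF|iF] := boolP (i \in F); rewrite ?andbT ?andbF//=.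
by apply/esym/negbTE; exact: (fdisjointP FG).
Qed.

Lemma fdisjoint_setD (I : choiceType) (F G : {fset I}) : [disjoint F & G `\` F]%fset.
Proof. by apply/fdisjointP => i iF; rewrite inE iF. Qed.

Lemma fset_big_sub (I : choiceType) (V : nmodType) (a : I -> V) (F G : {fset I}) :
  (F `<=` G)%fset ->
  \sum_(i <- G) a i = \sum_(i <- F) a i + \sum_(i <- (G `\` F)%fset) a i.
Proof.
move=> FG; rewrite -fset_bigU ?fdisjoint_setD//; apply: eq_fbigl => i.
by rewrite !inE; case: (boolP (i \in F)) => // /(fsubsetP FG).
Qed.

(** A finite [F] whose sum is within [e] of the supremum of all finite sums leaves less than [e] to
    any finite set disjoint from it. *)
Lemma small_tail (I : choiceType) (a : I -> R) M : (forall i, 0 <= a i) ->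
  bounded_sums a M -> forall e, 0 < e -> exists F : {fset I},
  forall G, [disjoint F & G]%fset -> \sum_(i <- G) a i < e.
Proof.
move=> a0 aM e e0.
pose S := [set \sum_(i <- F) a i | F in @setT {fset I}].
have hS : has_sup S.
  by split; [exists (\sum_(i <- fset0) a i), fset0|exists M => _ [F _ <-]; exact: aM].
have [_ [F _ <-] supF] := sup_adherent e0 hS.
exists F => G FG.
have : \sum_(i <- (F `|` G)%fset) a i <= sup S.
  by apply: sup_upper_bound => //; exists (F `|` G)%fset.
by rewrite fset_bigU//; lra.
Qed.

(** Summation is developed once for a complete normed group; [cabs] on [C] and [cnorm] on the
    C*-algebra are the two instances. *)
Record complete_norm (V : zmodType) (N : V -> R) : Prop := {
  cn_0 : N 0 = 0;
  cn_N : forall x, N (- x) = N x;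
  cn_D : forall x y, N (x + y) <= N x + N y;
  cn_eq0 : forall x, N x = 0 -> x = 0;
  cn_complete : forall u : nat -> V,
    (forall e : R, 0 < e -> exists N0 : nat,
       forall m n : nat, (N0 <= m)%N -> (N0 <= n)%N -> N (u m - u n) < e) ->
    exists l : V, N (u n - l) @[n --> \oo] --> (0 : R)
}.

Section Sums.
Variables (V : zmodType) (N : V -> R).
Hypothesis V_cn : complete_norm N.
Let N_0 := cn_0 V_cn.
Let N_N := cn_N V_cn.
Let N_D := cn_D V_cn.
Let N_eq0 := cn_eq0 V_cn.
Let N_complete := cn_complete V_cn.

Variable I : choiceType.
Implicit Types (u v : I -> V) (F G : {fset I}).

Definition sums u s := forall e, 0 < e -> exists F, forall G, (F `<=` G)%fset ->
  N (\sum_(i <- G) u i - s) < e.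

Definition asums u := exists M, bounded_sums (fun i => N (u i)) M.

Let N_ge0 x : 0 <= N x.
Proof.
have := N_D x (- x); rewrite N_N subrr N_0; lra.
Qed.

Lemma N_sum (J : Type) (s : seq J) (u : J -> V) :
  N (\sum_(i <- s) u i) <= \sum_(i <- s) N (u i).
Proof.
elim: s => [|i s IH]; rewrite ?big_nil ?N_0// !big_cons.
by apply: le_trans (N_D _ _) _; rewrite lerD2l.
Qed.

Lemma N_tri y x z : N (x - z) <= N (x - y) + N (y - z).
Proof. by rewrite -(subrKA y x); exact: N_D. Qed.

Lemma N_B x y : N (x - y) = N (y - x).
Proof. by rewrite -N_N opprB. Qed.

Lemma sums_exists u : asums u -> exists s, sums u s.
Proof.
move=> [M uM].
have tail := small_tail (fun i => N_ge0 (u i)) uM.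
have /choice[F FP] : forall n : nat, exists F, forall G, [disjoint F & G]%fset ->
    \sum_(i <- G) N (u i) < n.+1%:R^-1.
  by move=> n; apply: tail; rewrite invr_gt0.
(* Making the sets increase turns the partial sums over them into a Cauchy sequence; its limit is
   then the sum over the whole index type. *)
pose H n := (\bigcup_(k <- iota 0 n.+1) F k)%fset.
have HH m n : (m <= n)%N -> (H m `<=` H n)%fset.
  move=> mn; apply/bigfcupsP => k; rewrite mem_iota add0n ltnS => /= km _.
  by apply: (bigfcup_sup (j := k)) => //; rewrite mem_iota add0n ltnS (leq_trans km).
have FH n : (F n `<=` H n)%fset.
  by apply: (bigfcup_sup (j := n)) => //; rewrite mem_iota add0n ltnS leqnn.
have close n G : (H n `<=` G)%fset ->
    N (\sum_(i <- G) u i - \sum_(i <- H n) u i) < n.+1%:R^-1.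
  move=> HG; rewrite (fset_big_sub _ HG) addrAC subrr add0r.
  apply: le_lt_trans (N_sum _ _) _; apply: FP.
  by apply: fdisjointWl (FH n) _; exact: fdisjoint_setD.
have small (e : R) : 0 < e -> exists n : nat, n.+1%:R^-1 < e.
  move=> e0; exists (Num.trunc e^-1).
  by rewrite invf_plt ?posrE// truncnS_gt.
have [|l lP] := N_complete (u := fun n => \sum_(i <- H n) u i).
  move=> e e0; have [n nP] : exists n : nat, n.+1%:R^-1 < e / 2 by apply: small; rewrite divr_gt0.
  exists n => m k nm nk; have := N_tri (\sum_(i <- H n) u i)
    (\sum_(i <- H m) u i) (\sum_(i <- H k) u i).
  have := close _ _ (HH _ _ nm); have := close _ _ (HH _ _ nk).
  by rewrite [X in _ <= _ + X -> _]N_B; move: (n.+1%:R^-1) nP => r *; lra.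
exists l => e e0; have e40 : 0 < e / 4 by rewrite divr_gt0.
have [n nP] := small _ e40.
have /cvgr0Pnorm_lt/(_ _ e40)[m _ mP] := lP.
have {}mP := mP (maxn m n) (leq_maxl _ _).
exists (H (maxn m n)) => G HG.
have := N_tri (\sum_(i <- H n) u i) (\sum_(i <- G) u i) l.
have := N_tri (\sum_(i <- H (maxn m n)) u i) (\sum_(i <- H n) u i) l.
have := close _ _ (HH _ _ (leq_maxr m n)).
have := close _ _ (fsubset_trans (HH _ _ (leq_maxr m n)) HG).
move: mP; rewrite ger0_norm// => mP; rewrite [X in _ <= X + _ -> _]N_B.
by move: (n.+1%:R^-1) nP => r *; lra.
Qed.

Lemma sums_unique u s t : sums u s -> sums u t -> s = t.
Proof.
move=> us ut; apply/eqP; rewrite -subr_eq0; apply/eqP/N_eq0/eqP.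
rewrite eq_le N_ge0 andbT; apply/ler_addgt0Pr => e e0; rewrite add0r.
have e20 : 0 < e / 2 by apply: divr_gt0.
have [F FP] := us _ e20; have [G GP] := ut _ e20.
have := N_tri (\sum_(i <- (F `|` G)%fset) u i) s t; rewrite [X in _ <= X + _]N_B.
by have := FP _ (fsubsetUl F G); have := GP _ (fsubsetUr F G); lra.
Qed.

Lemma sums_le u s M : sums u s -> (forall F, N (\sum_(i <- F) u i) <= M) -> N s <= M.
Proof.
move=> us uM; apply/ler_addgt0Pr => e e0; have [F FP] := us _ e0.
have := N_tri (\sum_(i <- F) u i) s 0; rewrite !subr0 N_B.
have := FP _ (fsubset_refl F); have := uM F; lra.
Qed.

Lemma sums_bound u s M : sums u s -> bounded_sums (fun i => N (u i)) M -> N s <= M.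
Proof.
by move=> us uM; apply: (sums_le us) => F; exact: le_trans (N_sum _ _) (uM F).
Qed.

Lemma sumsD u v s t : sums u s -> sums v t -> sums (fun i => u i + v i) (s + t).
Proof.
move=> us vt e e0; have e20 : 0 < e / 2 by apply: divr_gt0.
have [F FP] := us _ e20; have [G GP] := vt _ e20.
exists (F `|` G)%fset => H; rewrite fsubUset => /andP[/FP h1 /GP h2].
rewrite big_split/= opprD addrACA; apply: le_lt_trans (N_D _ _) _; lra.
Qed.

Lemma sumsN u s : sums u s -> sums (fun i => - u i) (- s).
Proof.
move=> us e e0; have [F FP] := us _ e0; exists F => G /FP.
by rewrite sumrN -opprD N_N.
Qed.

Lemma sums0 : sums (fun=> 0) 0.
Proof. by move=> e e0; exists fset0 => G _; rewrite big1// subr0 N_0. Qed.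

Lemma sums_sum (J : Type) (r : seq J) (f : J -> I -> V) (s : J -> V) :
  (forall j, sums (f j) (s j)) ->
  sums (fun i => \sum_(j <- r) f j i) (\sum_(j <- r) s j).
Proof.
move=> fs; elim: r => [|j r IH].
  by rewrite big_nil; under [X in sums X]eq_fun do rewrite big_nil; exact: sums0.
by rewrite big_cons; under [X in sums X]eq_fun do rewrite big_cons; exact: sumsD.
Qed.

Lemma eq_sums u v s : u =1 v -> sums u s -> sums v s.
Proof. by move=> /funext ->. Qed.

Lemma sums_supp u F : (forall i, i \notin F -> u i = 0) -> sums u (\sum_(i <- F) u i).
Proof.
move=> uF e e0; exists F => G FG; rewrite (fset_big_sub _ FG) addrAC subrr add0r.
rewrite big_seq big1 ?N_0// => i; rewrite inE => /andP[iF _]; exact: uF.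
Qed.

Lemma sums_delta u j : (forall i, i != j -> u i = 0) -> sums u (u j).
Proof.
move=> uj; have := @sums_supp u [fset j]%fset; rewrite big_seq_fset1; apply => i.
by rewrite inE => /uj.
Qed.

(** [T] ranges over the upper bounds of the tail of [b] outside [G]. This is the form used for
    integration term by term, where only that tail controls the error over [G]. *)
Lemma sums_approx u s b M (K : R) : (forall i, 0 <= b i) -> bounded_sums b M -> 0 <= K ->
  (forall G T, (forall H, [disjoint G & H]%fset -> \sum_(i <- H) b i <= T) ->
     N (\sum_(i <- G) u i - s) <= K * T) -> sums u s.
Proof.
move=> b0 bM K0 uP e e0.
have K1 : 0 < K + 1 by rewrite ltr_wpDl.
have [F FP] := small_tail b0 bM (divr_gt0 e0 K1).
exists F => G FG; apply: (@le_lt_trans _ _ (K * (e / (K + 1)))).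
  apply: uP => H GH; apply/ltW/FP; exact: fdisjointWl FG GH.
by rewrite mulrA ltr_pdivrMr//; nra.
Qed.

Lemma sums_tail u s G T : sums u s ->
  (forall H, [disjoint G & H]%fset -> N (\sum_(i <- H) u i) <= T) ->
  N (s - \sum_(i <- G) u i) <= T.
Proof.
move=> us uT; apply/ler_addgt0Pr => e e0; have [F FP] := us _ e0.
have := FP _ (fsubsetUl F G).
rewrite (fset_big_sub _ (fsubsetUr F G)) => h1.
have h2 : N (\sum_(i <- ((F `|` G) `\` G)%fset) u i) <= T.
  by apply: uT; exact: fdisjoint_setD.
move: h1 h2; set A := \sum_(i <- G) u i; set B := \sum_(i <- _) u i => h1 h2.
have := N_tri (A + B) s A; rewrite [X in _ <= X + _]N_B [A + B - A]addrAC subrr.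
by rewrite add0r; lra.
Qed.

End Sums.

Lemma sums_morph (V V' : zmodType) (N : V -> R) (N' : V' -> R) (I : choiceType)
    (f : {additive V -> V'}) K (u : I -> V) s : 0 <= K ->
  (forall x, N' (f x) <= K * N x) -> sums N u s -> sums N' (f \o u) (f s).
Proof.
move=> K0 fK us e e0; have K1 : 0 < K + 1 by rewrite ltr_wpDl.
have [F FP] := us _ (divr_gt0 e0 K1); exists F => G /FP h.
rewrite -raddf_sum -raddfB; apply: le_lt_trans (fK _) _.
apply: (@le_lt_trans _ _ (K * (e / (K + 1)))); first by rewrite ler_wpM2l// ltW.
by rewrite mulrA ltr_pdivrMr//; nra.
Qed.

Lemma sums_bij (V : zmodType) (N : V -> R) (I J : choiceType) (u : I -> V) s
    (g : J -> I) (h : I -> J) : cancel g h -> cancel h g ->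
  sums N u s -> sums N (u \o g) s.
Proof.
move=> gK hK us e e0; have [F FP] := us _ e0.
exists [fset h i | i in F]%fset => G FG.
rewrite (_ : \sum_(i <- G) _ = \sum_(i <- [fset g i | i in G]%fset) u i); last first.
  by rewrite big_imfset//= => i j _ _ /(can_inj gK).
apply: FP; apply/fsubsetP => i iF; apply/imfsetP; exists (h i) => //=.
by apply: (fsubsetP FG); apply/imfsetP; exists i.
Qed.

End UnconditionalSums.

(** * Sums of complex families and their rearrangement *)

Section ComplexSums.
Variable R : realType.
Local Notation C := R[i].
Implicit Types I J : choiceType.

Definition csums I (u : I -> C) (s : C) := sums (@cabs R) u s.
Definition casums I (u : I -> C) := asums (@cabs R) u.
Definition csum I (u : I -> C) : C := xget 0 [set s | csums u s].

Lemma cabs_complete_norm : complete_norm (@cabs R).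
Proof.
split; [exact: cabs0|exact: cabsN|exact: cabsD|exact: cabs_eq0|exact: complex_cauchy].
Qed.
Let nC := cabs_complete_norm.

Lemma csumP I (u : I -> C) : casums u -> csums u (csum u).
Proof.
move=> uM; have [s us] := sums_exists nC uM.
by rewrite /csum; case: xgetP => [y -> //|/(_ s)].
Qed.

Lemma csum_eq I (u : I -> C) s : csums u s -> csum u = s.
Proof.
move=> us; rewrite /csum; case: xgetP => [y -> /= uy|/(_ s)//].
exact (sums_unique nC uy us).
Qed.

Lemma casums_le I (u v : I -> C) K : 0 <= K -> (forall i, cabs (u i) <= K * cabs (v i)) ->
  casums v -> casums u.
Proof.
move=> K0 uv [M vM]; exists (K * M) => F.
apply: (@le_trans _ _ (\sum_(i <- F) K * cabs (v i))); first exact: ler_sum.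
by rewrite -mulr_sumr ler_wpM2l.
Qed.

Lemma csums_scale I (u : I -> C) s c : csums u s -> csums (fun i => c * u i) (c * s).
Proof.
apply: (sums_morph (N := @cabs R) (N' := @cabs R) (f := GRing.mull_fun c (@idfun C)) (K := cabs
  c)).
  exact: cabs_ge0.
by move=> x; rewrite /= cabsM.
Qed.

Lemma csumD I (u v : I -> C) : casums u -> casums v ->
  csum (fun i => u i + v i) = csum u + csum v.
Proof. by move=> /csumP us /csumP vs; exact: csum_eq (sumsD nC us vs). Qed.

Lemma csum_scale I (u : I -> C) c : casums u -> csum (fun i => c * u i) = c * csum u.
Proof. by move=> /csumP us; apply/csum_eq/csums_scale. Qed.

Lemma csum_le I (u : I -> C) M : bounded_sums (fun i => cabs (u i)) M -> cabs (csum u) <= M.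
Proof. by move=> uM; apply: (sums_bound nC _ uM); apply: csumP; exists M. Qed.

Lemma casums_inj I J (u : I -> C) (g : J -> I) : injective g -> casums u ->
  casums (u \o g).
Proof.
move=> gI [M uM]; exists M => F; apply: le_trans (uM [fset g i | i in F]%fset).
by rewrite big_imfset//= => i j _ _ /gI.
Qed.

Lemma csum_bij I J (u : I -> C) (g : J -> I) (h : I -> J) : cancel g h -> cancel h g ->
  casums u -> csum (u \o g) = csum u.
Proof. by move=> gK hK /csumP us; apply: csum_eq; exact: sums_bij gK hK us. Qed.

Lemma big_fsetM I J (V : nmodType) (f : I * J -> V) (G : {fset I}) (H : {fset J}) :
  \sum_(p <- (G `*` H)%fset) f p = \sum_(i <- G) \sum_(j <- H) f (i, j).
Proof.
rewrite -(big_allpairs (r1 := G) (r2 := H) (F := f)); apply: perm_big; apply: uniq_perm.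
- exact: fset_uniq.
- by apply: allpairs_uniq => //; move=> [a b] [c d] _ _ [-> ->].
move=> [i j]; rewrite in_fsetM /=;
  apply/andP/allpairsP => [[iG jH]|[[a b] /= [aG bH [-> ->]]]] //.
by exists (i, j).
Qed.

(** A phase turning [s] into its modulus: with it a finite sum of moduli becomes the modulus of a
    single sum, to which bounds on partial sums apply. *)
Lemma unimodular_dual (s : C) : exists2 z : C, cabs z <= 1 & z * s = ((cabs s)%:C)%C.
Proof.
have [->|s0] := eqVneq s 0; first by exists 0; rewrite ?cabs0 ?ler01// mulr0.
exists (((cabs s)%:C)%C / s); last by rewrite divfK.
rewrite cabsM cabs_real ger0_norm ?cabs_ge0// /cabs Normc.normcV divff//.
by apply: contra s0 => /eqP/cabs_eq0 ->.
Qed.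

Section Fubini.
Variables (I J : choiceType) (u : I * J -> C).
Hypothesis uS : casums u.

Lemma casums_section i : casums (fun j => u (i, j)).
Proof. by apply: (@casums_inj _ _ u (fun j => (i, j))) => // a b [->]. Qed.

(** After multiplication by phases, the sum of the moduli of finitely many inner sums is a limit of
    finite double sums, each bounded by the constant of [u]. *)
Lemma casums_iter : casums (fun i => csum (fun j => u (i, j))).
Proof.
have [M uM] := uS; exists M => F.
pose s i := csum (fun j => u (i, j)).
have /choice[z zP] : forall i, exists z : C, cabs z <= 1 /\ z * s i = ((cabs (s i))%:C)%C.
  by move=> i; have [z] := unimodular_dual (s i); exists z.
have : csums (fun j => \sum_(i <- F) z i * u (i, j)) (\sum_(i <- F) z i * s i).
  apply: (sums_sum nC) => i; apply: csums_scale; apply: csumP; exact: casums_section.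
move/(sums_le nC)=> /(_ M) h.
have : cabs (\sum_(i <- F) z i * s i) <= M.
  apply: h => G; rewrite exchange_big/=; apply: le_trans (cabs_sum _ _) _.
  apply: le_trans (uM (F `*` G)%fset); rewrite big_fsetM; apply: ler_sum => i _.
  apply: le_trans (cabs_sum _ _) _; apply: ler_sum => j _.
  by rewrite cabsM ler_piMl ?cabs_ge0//; case: (zP i).
rewrite (eq_bigr (fun i => ((cabs (s i))%:C)%C)); last by move=> i _; case: (zP i).
rewrite -[\sum_(i <- F) ((cabs _)%:C)%C](raddf_sum (real_complex R)) cabs_real.
by move=> hh; apply: le_trans hh; exact: ler_norm.
Qed.

Lemma csum_fubini : csum (fun i => csum (fun j => u (i, j))) = csum u.
Proof.
apply: csum_eq => e e0; have e20 : 0 < e / 2 by rewrite divr_gt0.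
have [F0 FP] := csumP uS e20.
(* Enlarging the finite set of second indices by those of [F0] makes the rectangle over [G] contain
   [F0], so that one finite sum approximates both sides. *)
exists [fset p.1 | p in F0]%fset => G FG.
have : csums (fun j => \sum_(i <- G) u (i, j)) (\sum_(i <- G) csum (fun j => u (i, j))).
  by apply: (sums_sum nC) => i; apply: csumP; exact: casums_section.
move=> /(_ _ e20)[H HP].
have := HP _ (fsubsetUl H [fset p.2 | p in F0]%fset).
have := FP (G `*` (H `|` [fset p.2 | p in F0]))%fset.
have -> : (F0 `<=` G `*` (H `|` [fset p.2 | p in F0]))%fset.
  apply/fsubsetP => p pF; rewrite in_fsetM; apply/andP; split.
    by apply: (fsubsetP FG); apply/imfsetP; exists p.
  by rewrite inE; apply/orP; right; apply/imfsetP; exists p.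
move=> /(_ isT); rewrite big_fsetM exchange_big/=.
set A := \sum_(j <- _) _; set B := \sum_(i <- G) _ => h1 h2.
have := N_tri nC A B (csum u).
by rewrite [X in _ <= X + _]cabs_dist; lra.
Qed.

End Fubini.

Lemma csum_exchange I J (u : I -> J -> C) : casums (fun p => u p.1 p.2) ->
  csum (fun i => csum (u i)) = csum (fun j => csum (u^~ j)).
Proof.
move=> uS; rewrite (csum_fubini (u := fun p => u p.1 p.2) uS).
have sS : casums (fun p : J * I => u p.2 p.1).
  by apply: (@casums_inj _ _ (fun p => u p.1 p.2) (fun p => (p.2, p.1))) =>
    // -[a b] [c d] [-> ->].
rewrite (csum_fubini (u := fun p : J * I => u p.2 p.1) sS).
by rewrite -(@csum_bij _ _ (fun p => u p.1 p.2) (fun p => (p.2, p.1)) (fun p => (p.2, p.1)))//;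
  move=> [].
Qed.

Lemma casums_prod I J (u : I * J -> C) (a : I -> C) (b : J -> C) :
  (forall p, cabs (u p) <= cabs (a p.1) * cabs (b p.2)) -> casums a -> casums b -> casums u.
Proof.
move=> uab [M aM] [M' bM].
have M0 : 0 <= M' by apply: le_trans (bM fset0); rewrite big_seq_fset0.
exists (M * M') => F.
have FF : (F `<=` [fset p.1 | p in F] `*` [fset p.2 | p in F])%fset.
  by apply/fsubsetP => p pF; rewrite in_fsetM; apply/andP; split; apply/imfsetP; exists p.
apply: (@le_trans _ _ (\sum_(p <- F) cabs (a p.1) * cabs (b p.2))); first exact: ler_sum.
apply: (@le_trans _ _ (\sum_(p <- ([fset p.1 | p in F] `*` [fset p.2 | p in F])%fset)
   cabs (a p.1) * cabs (b p.2))).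
  rewrite [leRHS](fset_big_sub _ FF) lerDl; apply: sumr_ge0 => i _.
  by rewrite mulr_ge0 ?cabs_ge0.
rewrite big_fsetM /=; under eq_bigr do rewrite -mulr_sumr.
rewrite -mulr_suml; apply: ler_pM => //; apply: sumr_ge0 => i _; exact: cabs_ge0.
Qed.

End ComplexSums.

(** * Rapidly decreasing families on Z^2 *)

Section Rapid.
Variable R : realType.
Local Notation C := R[i].

Definition wt (p : int * int) : R := 1 + `|p.1|%N%:R + `|p.2|%N%:R.

Lemma wt_ge1 p : 1 <= wt p.
Proof. by rewrite /wt -addrA lerDl addr_ge0. Qed.

Lemma wt_ge0 p : 0 <= wt p. Proof. exact: le_trans ler01 (wt_ge1 p). Qed.

Lemma rapidP (a : int * int -> C) :
  rapid a <-> forall k, exists K, forall p, cabs (a p) * wt p ^+ k <= K.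
Proof.
have E p k : ((1 + `|p.1|%N + `|p.2|%N) ^ k)%:R = ((wt p ^+ k)%:C)%C :> C.
  by rewrite natrX !natrD /wt rmorphXn !rmorphD !rmorph_nat rmorph1.
split=> ak k; have [K KP] := ak k; exists K => p; have := KP p.
  by rewrite E cabsE -rmorphM lecR.
by rewrite E cabsE -rmorphM lecR.
Qed.

Lemma sum_inv_sq n : \sum_(i < n) (i.+1%:R ^- 2 : R) <= 2.
Proof.
case: n => [|n]; first by rewrite big_ord0.
(* The sharper bound passes through the induction because 1/(x+1)^2 <= 1/x - 1/(x+1). *)
suff : \sum_(i < n.+1) (i.+1%:R ^- 2 : R) <= 2 - n.+1%:R^-1.
  by move=> h; apply: le_trans h _; rewrite gerBl invr_ge0.
elim: n => [|n IH]; first by rewrite big_ord1 expr1n !invr1; lra.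
rewrite big_ord_recr/=; apply: le_trans (lerD IH (lexx _)) _.
have n0 : 0 < n.+1%:R :> R by [].
have -> : n.+2%:R = n.+1%:R + 1 :> R by rewrite -natr1.
move: (n.+1%:R) n0 => x x0.
have x1 : 0 < x + 1 by lra.
rewrite -subr_ge0.
have -> : 2 - (x + 1)^-1 - (2 - x^-1 + (x + 1) ^- 2) = (x * (x + 1) ^+ 2)^-1.
  by field; rewrite !gt_eqF.
by rewrite invr_ge0 mulr_ge0 ?sqr_ge0// ltW.
Qed.

Definition int_box (n : nat) : {fset int} :=
  [fset x in [seq Posz i | i <- iota 0 n] ++ [seq Negz i | i <- iota 0 n]]%fset.

Lemma big_int_box (V : nmodType) (u : int -> V) n :
  \sum_(i <- int_box n) u i = \sum_(i < n) u (Posz i) + \sum_(i < n) u (Negz i).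
Proof.
have hn : ~~ has (mem [seq Posz i | i <- iota 0 n]) [seq Negz i | i <- iota 0 n].
  by apply/hasPn => _ /mapP[i _ ->]; apply/negP => /mapP[].
have lU : uniq ([seq Posz i | i <- iota 0 n] ++ [seq Negz i | i <- iota 0 n]).
  rewrite cat_uniq hn !map_inj_uniq ?iota_uniq//; by move=> i j [].
transitivity (\sum_(i <- [seq Posz i | i <- iota 0 n] ++ [seq Negz i | i <- iota 0 n]) u i).
  apply: perm_big; apply: uniq_perm; rewrite ?fset_uniq// => i; by rewrite in_fset.
by rewrite big_cat !big_map -[iota 0 n](congr1 (iota 0) (subn0 n)) -/(index_iota 0 n) !big_mkord.
Qed.

Lemma fsubset_int_box (F : {fset int}) :
  exists n, forall N, (n <= N)%N -> (F `<=` int_box N)%fset.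
Proof.
exists (\max_(m <- F) `|m|%N).+1 => n nN.
apply/fsubsetP => m mF; apply/imfsetP; exists m => //=.
have : (`|m| < n)%N by apply: leq_trans nN; rewrite ltnS; exact: (leq_bigmax_seq m).
rewrite mem_cat; case: m {mF} => i ilt; apply/orP; [left|right]; apply/mapP; exists i => //.
  by rewrite mem_iota.
by rewrite mem_iota /= add0n ltnW.
Qed.

Lemma int_inv_sq : bounded_sums (fun m : int => (1 + `|m|%N%:R) ^- 2 : R) 4.
Proof.
move=> F; have [n /(_ n (leqnn n)) FL] := fsubset_int_box F.
apply: (@le_trans _ _ (\sum_(i <- int_box n) (1 + `|i|%N%:R) ^- 2)).
  by rewrite [leRHS](fset_big_sub _ FL) lerDl; apply: sumr_ge0 => i _; rewrite invr_ge0 sqr_ge0.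
rewrite big_int_box; have -> : 4 = 2 + 2 :> R by lra.
apply: lerD; apply: le_trans (sum_inv_sq n); apply: ler_sum => i _ /=.
  by rewrite nat1r.
rewrite nat1r lef_pV2 ?posrE ?exprn_gt0// lerXn2r ?nnegrE// ler_nat; lia.
Qed.

Lemma rapid_weighted (a : int * int -> C) k : rapid a ->
  exists M, bounded_sums (fun p => cabs (a p) * wt p ^+ k) M.
Proof.
(* Four extra powers of the weight suffice: (1 + |m|) (1 + |n|) <= wt^2, so wt^(-4) is dominated by
   a product of two summable inverse squares. *)
move=> /rapidP ra; have [K KP] := ra (k + 4)%N.
have K0 : 0 <= K by apply: le_trans (KP (0, 0)); rewrite mulr_ge0 ?cabs_ge0 ?exprn_ge0 ?wt_ge0.
pose b (m : int) : C := (((1 + `|m|%N%:R) ^- 2 : R)%:C)%C.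
have bE m : cabs (b m) = (1 + `|m|%N%:R) ^- 2.
  by rewrite cabs_real ger0_norm// invr_ge0 sqr_ge0.
have bS : casums b by exists 4 => F; under eq_bigr do rewrite bE; exact: int_inv_sq.
have [|M] := @casums_prod R _ _ (fun p => b p.1 * b p.2) b b _ bS bS.
  by move=> p; rewrite cabsM.
move=> bM; exists (K * M) => F.
apply: (@le_trans _ _ (\sum_(p <- F) K * cabs (b p.1 * b p.2))); last first.
  by rewrite -mulr_sumr ler_wpM2l.
apply: ler_sum => p _; have := KP p; rewrite exprD mulrA cabsM !bE.
have w1 := wt_ge1 p; have w0 : 0 < wt p by lra.
rewrite -ler_pdivlMr ?exprn_gt0// => h; apply: le_trans h _; rewrite ler_wpM2l//.
rewrite -invfM lef_pV2 ?posrE ?exprn_gt0 ?mulr_gt0 ?exprn_gt0 ?ltr_wpDr//.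
rewrite -exprMn (_ : 4 = 2 * 2)%N// exprM lerXn2r ?nnegrE ?mulr_ge0 ?sqr_ge0 ?addr_ge0//.
rewrite /wt; have := ler0n R `|p.1|%N; have := ler0n R `|p.2|%N.
move: (`|p.1|%N%:R) (`|p.2|%N%:R) => x y; nra.
Qed.

Lemma rapid_casums (a : int * int -> C) : rapid a -> casums a.
Proof. by move=> /(rapid_weighted 0)[M aM]; exists M => F; have := aM F;
  under eq_bigr do rewrite expr0 mulr1. Qed.

Lemma rapidD (a b : int * int -> C) : rapid a -> rapid b -> rapid (fun p => a p + b p).
Proof.
move=> /rapidP ra /rapidP rb; apply/rapidP => k; have [K KP] := ra k; have [L LP] := rb k.
exists (K + L) => p; apply: le_trans (lerD (KP p) (LP p)).
by rewrite -mulrDl ler_wpM2r ?exprn_ge0 ?wt_ge0// cabsD.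
Qed.

Lemma rapid_mul (a : int * int -> C) (c : int * int -> C) (K : R) n : 0 <= K ->
  (forall p, cabs (c p) <= K * wt p ^+ n) -> rapid a -> rapid (fun p => c p * a p).
Proof.
move=> K0 cK /rapidP ra; apply/rapidP => k; have [L LP] := ra (n + k)%N.
exists (K * L) => p; rewrite cabsM mulrAC.
apply: (@le_trans _ _ (K * wt p ^+ n * wt p ^+ k * cabs (a p))).
  by rewrite !ler_wpM2r ?exprn_ge0 ?wt_ge0 ?cabs_ge0.
by rewrite -!mulrA ler_wpM2l// mulrA -exprD mulrC.
Qed.

Lemma rapid_scale (a : int * int -> C) c : rapid a -> rapid (fun p => c * a p).
Proof.
by apply: (rapid_mul (K := cabs c) (n := 0)) => [|p]; rewrite ?cabs_ge0// expr0 mulr1.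
Qed.

Lemma rapid_supp1 (a : int * int -> C) q : (forall p, p != q -> a p = 0) -> rapid a.
Proof.
move=> aq; apply/rapidP => k; exists (cabs (a q) * wt q ^+ k) => p.
have [->//|/aq ->] := eqVneq p q.
by rewrite cabs0 mul0r mulr_ge0 ?cabs_ge0 ?exprn_ge0 ?wt_ge0.
Qed.

Lemma rapid_reindex (a : int * int -> C) (g : int * int -> int * int) (K : R) :
  0 <= K -> (forall p, wt p <= K * wt (g p)) -> rapid a -> rapid (a \o g).
Proof.
move=> K0 gK /rapidP ra; apply/rapidP => k; have [L LP] := ra k.
exists (K ^+ k * L) => p /=; apply: le_trans (ler_wpM2l (exprn_ge0 k K0) (LP (g p))).
rewrite mulrCA ler_wpM2l ?cabs_ge0// -exprMn lerXn2r ?nnegrE ?wt_ge0 ?mulr_ge0 ?wt_ge0//.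
Qed.

End Rapid.

(** * Calculus of complex-valued functions *)

Section RealTaylor.
Variable R : realType.
Implicit Types f g : R -> R.

Lemma is_derive_of_quadratic f (t l K : R) :
  (forall d, `|d| <= 1 -> `|f (t + d) - f t - d * l| <= K * d ^+ 2) ->
  is_derive t 1 f l.
Proof.
move=> fK.
have cv : (fun h : R => h^-1 *: (f (h *: 1 + t) - f t)) @ 0^' --> l.
  apply/cvgrPdist_le => e e0.
  have K1 : 0 < `|K| + 1 by rewrite ltr_wpDl.
  near=> h.
  have h0 : h != 0 by near: h; exact: nbhs_dnbhs_neq.
  have h1 : `|h| <= 1.
    by near: h; apply: dnbhs0_le.
  have he : `|h| <= e / (`|K| + 1).
    by near: h; apply: dnbhs0_le; rewrite divr_gt0.
  have := fK h h1; rewrite [t + h]addrC => H.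
  have -> : h *: 1 + t = h + t :> R by rewrite /GRing.scale/= mulr1.
  have -> : l - h^-1 *: (f (h + t) - f t) = - (h^-1 * (f (h + t) - f t - h * l)).
    by rewrite /GRing.scale/=; field.
  rewrite normrN normrM normfV ler_pdivrMl ?normr_gt0//.
  apply: le_trans H _; rewrite -[h ^+ 2]real_normK ?num_real// mulrC.
  rewrite expr2 -mulrA ler_wpM2l//.
  move: he; rewrite ler_pdivlMr// => he; apply: le_trans he.
  rewrite ler_wpM2l//; have := ler_norm K; lra.
apply: DeriveDef; first by apply/cvg_ex; exists l.
exact: cvg_lim.
Unshelve. all: by end_near. Qed.

Lemma is_derive_continuous f (f' : R -> R) : (forall t : R, is_derive t 1 f (f' t)) ->
  continuous f.
Proof.
by move=> df t; apply/differentiable_continuous/derivable1_diffP; case: (df t).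
Qed.

Lemma mvt_everywhere f (f' : R -> R) : (forall t : R, is_derive t 1 f (f' t)) ->
  forall a b, exists2 c, `|c - a| <= `|b - a| & f b - f a = f' c * (b - a).
Proof.
move=> df a b; have [ab|ba] := leP a b.
  have [|c] := @MVT_segment R f f' a b ab.
  - exact/continuous_subspaceT/(is_derive_continuous df).
  rewrite in_itv/= => /andP[ac cb] E; exists c => //.
  by rewrite !ger0_norm ?subr_ge0// lerD2r.
have [|c] := @MVT_segment R f f' b a (ltW ba).
- exact/continuous_subspaceT/(is_derive_continuous df).
rewrite in_itv/= => /andP[bc ca] E; exists c.
  rewrite distrC [leRHS]distrC !ger0_norm ?subr_ge0// ?(ltW ba)// lerD2l lerN2//.
by rewrite -opprB E -mulrN opprB.
Qed.

Lemma taylor1_bound f (f' f'' : R -> R) (K t d : R) :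
  (forall t : R, is_derive t 1 f (f' t)) -> (forall t : R, is_derive t 1 f' (f'' t)) ->
  (forall c, `|c - t| <= `|d| -> `|f'' c| <= K) ->
  `|f (t + d) - f t - d * f' t| <= K * d ^+ 2.
Proof.
move=> df df' K2.
have [c] := mvt_everywhere df t (t + d); rewrite [t + d - t]addrAC subrr add0r => ct ->.
have [b] := mvt_everywhere df' t c; move=> bt E.
rewrite [d * _]mulrC -mulrBl E !normrM -[d ^+ 2]real_normK ?num_real// expr2 mulrA.
rewrite ler_wpM2r// ler_pM//; apply: K2; exact: le_trans bt ct.
Qed.

End RealTaylor.

(** * Derivatives of complex-valued functions *)

Section ComplexDerivative.
Variable R : realType.
Local Notation C := R[i].
Local Notation rc := (real_complex R).
Implicit Types f g h : R -> C.

Definition cderiv f f' := forall t : R,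
  is_derive t 1 (fun t => complex.Re (f t)) (complex.Re (f' t)) /\
  is_derive t 1 (fun t => complex.Im (f t)) (complex.Im (f' t)).

Lemma cReD (x y : C) : complex.Re (x + y) = complex.Re x + complex.Re y.
Proof. by case: x; case: y. Qed.
Lemma cImD (x y : C) : complex.Im (x + y) = complex.Im x + complex.Im y.
Proof. by case: x; case: y. Qed.
Lemma cReN (x : C) : complex.Re (- x) = - complex.Re x. Proof. by case: x. Qed.
Lemma cImN (x : C) : complex.Im (- x) = - complex.Im x. Proof. by case: x. Qed.
Lemma cReM (x y : C) :
  complex.Re (x * y) = complex.Re x * complex.Re y - complex.Im x * complex.Im y.
Proof. by case: x; case: y. Qed.
Lemma cImM (x y : C) :
  complex.Im (x * y) = complex.Re x * complex.Im y + complex.Im x * complex.Re y.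
Proof. by case: x => a b; case: y => c d /=; rewrite [b * c]mulrC. Qed.
Lemma complex_eq (x y : C) :
  complex.Re x = complex.Re y -> complex.Im x = complex.Im y -> x = y.
Proof. by case: x => a b; case: y => c d /= -> ->. Qed.

(** Quadratic remainder estimates survive integration and summation, so this criterion serves to
    differentiate under an integral or a series. *)
Lemma cderiv_of_quadratic f f' :
  (forall t, exists K, forall d, `|d| <= 1 ->
     cabs (f (t + d) - f t - rc d * f' t) <= K * d ^+ 2) -> cderiv f f'.
Proof.
move=> fK t; have [K KP] := fK t.
split; apply: (@is_derive_of_quadratic R _ _ _ K) => d d1; apply: le_trans (KP d d1).
  by apply: le_trans _ (Re_le_cabs _); rewrite !cReD !cReN cReM /= mul0r subr0.
by apply: le_trans _ (Im_le_cabs _); rewrite !cImD !cImN cImM /= mul0r addr0.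
Qed.

Lemma cderiv_unique f g h : cderiv f g -> cderiv f h -> g = h.
Proof.
move=> fg fh; apply/funext => t; have [a b] := fg t; have [c d] := fh t.
by apply: complex_eq; [case: a => _ <-; case: c => _ <-|case: b => _ <-; case: d => _ <-].
Qed.

Lemma eq_cderiv f f' g g' : f =1 g -> f' =1 g' -> cderiv f f' -> cderiv g g'.
Proof. by move=> /funext -> /funext ->. Qed.

Lemma cderivD f f' g g' : cderiv f f' -> cderiv g g' ->
  cderiv (fun t => f t + g t) (fun t => f' t + g' t).
Proof.
move=> df dg t; have [a b] := df t; have [c d] := dg t.
under [X in is_derive _ _ X]eq_fun do rewrite cReD.
under [X in _ /\ is_derive _ _ X _]eq_fun do rewrite cImD.
by rewrite cReD cImD; split; exact: is_deriveD.
Qed.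

Lemma cderivM f f' g g' : cderiv f f' -> cderiv g g' ->
  cderiv (fun t => f t * g t) (fun t => f' t * g t + f t * g' t).
Proof.
move=> df dg t; have [a b] := df t; have [c d] := dg t.
under [X in is_derive _ _ X]eq_fun do rewrite cReM.
under [X in _ /\ is_derive _ _ X _]eq_fun do rewrite cImM.
split.
  apply: (is_derive_eq (is_deriveB (is_deriveM a c) (is_deriveM b d))).
  by rewrite /GRing.scale/= !(cReD, cReM); ring.
apply: (is_derive_eq (is_deriveD (is_deriveM a d) (is_deriveM b c))).
by rewrite /GRing.scale/= !(cImD, cImM); ring.
Qed.

Lemma cderiv_cst (c : C) : cderiv (fun=> c) (fun=> 0).
Proof. by move=> t; split; exact: is_derive_cst. Qed.

Lemma cderiv_scale c f f' : cderiv f f' -> cderiv (fun t => c * f t) (fun t => c * f' t).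
Proof.
move=> df; apply: eq_cderiv (cderivM (cderiv_cst c) df) => // t.
by rewrite mul0r add0r.
Qed.

Lemma cderivN f f' : cderiv f f' -> cderiv (fun t => - f t) (fun t => - f' t).
Proof.
by move=> df; apply: eq_cderiv (cderiv_scale (-1) df) => t; rewrite mulN1r.
Qed.

Lemma cderiv_id : cderiv rc (fun=> 1).
Proof. by move=> t; split; [exact: is_derive_id|exact: is_derive_cst]. Qed.

Lemma cderiv_comp f f' (u u' : R -> R) : (forall t : R, is_derive t 1 u (u' t)) ->
  cderiv f f' -> cderiv (fun t => f (u t)) (fun t => rc (u' t) * f' (u t)).
Proof.
move=> du df t; have [c d] := df (u t); split.
  apply: (is_derive_eq (is_derive1_comp (g := u) c (du t))).
  by rewrite cReM /= mul0r subr0 /GRing.scale/= mulrC.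
apply: (is_derive_eq (is_derive1_comp (g := u) d (du t))).
by rewrite cImM /= mul0r addr0 /GRing.scale/= mulrC.
Qed.

Lemma cderiv_affine f f' (a b : R) : cderiv f f' ->
  cderiv (fun t => f (a * t + b)) (fun t => rc a * f' (a * t + b)).
Proof.
apply: (cderiv_comp (u := fun t => a * t + b) (u' := fun=> a)) => t.
apply: (is_derive_eq (is_deriveD (is_deriveM (is_derive_cst a t 1) (is_derive_id t 1))
  (is_derive_cst b t 1))).
by rewrite /GRing.scale/= mulr0 !addr0 mulr1.
Qed.

Lemma cderiv_shift f f' (a : R) : cderiv f f' ->
  cderiv (fun t => f (t + a)) (fun t => f' (t + a)).
Proof.
move=> df; apply: eq_cderiv (cderiv_affine 1 a df) => t; first by rewrite mul1r.
by rewrite mul1r mul1r.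
Qed.

Lemma cderiv_continuous f f' : cderiv f f' ->
  continuous (fun t => complex.Re (f t)) /\ continuous (fun t => complex.Im (f t)).
Proof.
move=> df; split.
  by apply: is_derive_continuous => t; case: (df t) => + _; apply.
by apply: is_derive_continuous => t; case: (df t) => _; apply.
Qed.

Lemma cderiv_lipschitz f f' (K : R) : cderiv f f' -> (forall t, cabs (f' t) <= K) ->
  forall a b, cabs (f b - f a) <= 2 * K * `|b - a|.
Proof.
move=> df fK a b; apply: le_trans (cabs_le _) _.
have [c1 _] := mvt_everywhere (fun t => (df t).1) a b.
have [c2 _] := mvt_everywhere (fun t => (df t).2) a b.
rewrite !cReD !cImD !cReN !cImN => -> ->; rewrite !normrM -mulrDl ler_wpM2r//.
rewrite mulrDl !mul1r; apply: lerD; apply: le_trans (fK _).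
  exact: Re_le_cabs.
exact: Im_le_cabs.
Qed.

(** The factor 2 comes from treating real and imaginary parts separately, as their mean value points
    differ. The bound on [f''] is asked only near [t], which keeps the decay of [f''] available. *)
Lemma cderiv_taylor f f' f'' (K t d : R) : cderiv f f' -> cderiv f' f'' ->
  (forall c, `|c - t| <= `|d| -> cabs (f'' c) <= K) ->
  cabs (f (t + d) - f t - rc d * f' t) <= 2 * K * d ^+ 2.
Proof.
move=> df df' fK; apply: le_trans (cabs_le _) _.
rewrite -mulrA mulrDl !mul1r; apply: lerD.
  rewrite !cReD !cReN cReM /= mul0r subr0.
  have := @taylor1_bound R (fun t => complex.Re (f t)) (fun t => complex.Re (f' t))
    (fun t => complex.Re (f'' t)) K t d (fun x => (df x).1) (fun x => (df' x).1).
  by apply => c /fK h; exact: le_trans (Re_le_cabs _) h.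
rewrite !cImD !cImN cImM /= mul0r addr0.
have := @taylor1_bound R (fun t => complex.Im (f t)) (fun t => complex.Im (f' t))
  (fun t => complex.Im (f'' t)) K t d (fun x => (df x).2) (fun x => (df' x).2).
by apply => c /fK h; exact: le_trans (Im_le_cabs _) h.
Qed.

Lemma cderiv0_cst f : cderiv f (fun=> 0) -> forall a b, f a = f b.
Proof.
move=> df a b; apply/eqP; rewrite -subr_eq0; apply/eqP/cabs_eq0/eqP.
rewrite eq_le cabs_ge0 andbT; apply: le_trans (cabs_le _) _.
have [c1 _] := mvt_everywhere (fun t => (df t).1) b a.
have [c2 _] := mvt_everywhere (fun t => (df t).2) b a.
by rewrite !cReD !cImD !cReN !cImN => -> ->; rewrite /= !mul0r normr0 addr0.
Qed.

End ComplexDerivative.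

(** * The character e(t) *)

Section Exponential.
Variable R : realType.
Local Notation rc := (real_complex R).
Local Notation pi := (@trigo.pi R).

Lemma e_D (x y : R) : e_ (x + y) = e_ x * e_ y.
Proof. by rewrite /e_ mulrDr cosD sinD; apply: complex_eq; rewrite ?cReM ?cImM /=; ring. Qed.

Lemma e_0 : e_ (0 : R) = 1.
Proof. by rewrite /e_ mulr0 cos0 sin0. Qed.

Lemma cabs_e (x : R) : cabs (e_ x) = 1.
Proof. by rewrite /cabs /= cos2Dsin2 sqrtr1. Qed.

Lemma e_N (x : R) : e_ (- x) = (e_ x)^-1.
Proof.
have h : e_ x * e_ (- x) = 1 by rewrite -e_D subrr e_0.
have e0 : e_ x != 0 by apply: contra_eq_neq h => ->; rewrite mul0r eq_sym oner_eq0.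
by apply: (mulfI e0); rewrite h divff.
Qed.

Lemma e_neq0 (x : R) : e_ x != 0.
Proof.
have h : e_ x * e_ (- x) = 1 by rewrite -e_D subrr e_0.
by apply: contra_eq_neq h => ->; rewrite mul0r eq_sym oner_eq0.
Qed.

Lemma e_conj (x : R) : Num.conj (e_ x) = e_ (- x).
Proof. by rewrite /e_ mulrN cosN sinN. Qed.

Lemma e_1 : e_ (1 : R) = 1.
Proof. by rewrite /e_ mulr1 mulr_natl cos2pi sin2pi. Qed.

Lemma e_nat n : e_ (n%:R : R) = 1.
Proof. by elim: n => [|n IH]; rewrite ?e_0// -natr1 e_D IH e_1 mulr1. Qed.

Lemma e_int (m : int) : e_ (m%:~R : R) = 1.
Proof.
case: m => n; first exact: e_nat.
by rewrite NegzE rmorphN /= e_N -[_%:~R]/(n.+1%:R) e_nat invr1.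
Qed.

Lemma cderiv_e : cderiv (@e_ R) (fun t => Complex 0 (2 * pi) * e_ t).
Proof.
move=> t; have da : is_derive t 1 (fun t : R => 2 * pi * t) (2 * pi).
  apply: (is_derive_eq (is_deriveM (is_derive_cst (2 * pi) t 1) (is_derive_id t 1))).
  by rewrite /GRing.scale/= mulr0 addr0 mulr1.
split.
  apply: (is_derive_eq (is_derive1_comp (is_derive_cos (2 * pi * t)) da)).
  by rewrite cReM /= mul0r sub0r /GRing.scale/=; ring.
apply: (is_derive_eq (is_derive1_comp (is_derive_sin (2 * pi * t)) da)).
by rewrite cImM /= mul0r add0r /GRing.scale/=; ring.
Qed.

Lemma cderiv_e_affine (a b : R) :
  cderiv (fun t => e_ (a * t + b)) (fun t => Complex 0 (2 * pi * a) * e_ (a * t + b)).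
Proof.
apply: eq_cderiv (cderiv_affine a b cderiv_e) => // t.
by rewrite mulrA; congr (_ * _); apply: complex_eq; rewrite ?cReM ?cImM /=; ring.
Qed.

Lemma cderiv_e_quad (a : R) :
  cderiv (fun t => e_ (a * t ^+ 2)) (fun t => Complex 0 (4 * pi * a) * rc t * e_ (a * t ^+ 2)).
Proof.
have da (t : R) : is_derive t 1 (fun t : R => a * t ^+ 2) (2 * a * t).
  apply: (is_derive_eq (is_deriveM (is_derive_cst a t 1)
     (is_deriveM (is_derive_id t 1) (is_derive_id t 1)))).
  by rewrite /GRing.scale/=; ring.
apply: eq_cderiv (cderiv_comp da cderiv_e) => // t.
by rewrite mulrA; congr (_ * _); apply: complex_eq; rewrite ?cReM ?cImM /=; ring.
Qed.

Lemma e_taylor (x d : R) :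
  cabs (e_ (x + d) - e_ x - rc d * (Complex 0 (2 * pi) * e_ x)) <= 8 * pi ^+ 2 * d ^+ 2.
Proof.
have d1 := cderiv_e.
have d2 := cderiv_scale (Complex 0 (2 * pi)) d1.
apply: le_trans (cderiv_taylor (K := 4 * pi ^+ 2) d1 d2 _) _; last by lra.
move=> c _; rewrite !cabsM cabs_e mulr1 -expr2 /cabs /= expr0n add0r sqrtr_sqr.
by rewrite real_normK ?num_real// exprMn; lra.
Qed.

End Exponential.

(** * Schwartz functions *)

Section SchwartzSpace.
Variable R : realType.
Local Notation C := R[i].
Local Notation rc := (real_complex R).
Local Notation pi := (@trigo.pi R).
Local Notation schwartz := (@Pilot.Defs.schwartz R).
Implicit Types f g h : R -> C.

Definition mulX f : R -> C := fun t => rc t * f t.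
Definition cbounded f := exists K, forall t, cabs (f t) <= K.

Lemma derive1nE n (p : C -> R) f f' : (forall t : R, is_derive t 1 (fun t =>
  p (f t)) (p (f' t))) ->
  derive1n n.+1 (fun t => p (f t)) = derive1n n (fun t => p (f' t)).
Proof.
move=> df; rewrite derive1Sn; congr (derive1n n _); apply/funext => t.
by rewrite derive1E; case: (df t).
Qed.

(** Every t^k f^(l) stays in [P], hence is bounded: stability under the two operations replaces all
    seminorm estimates. *)
Lemma schwartz_coind (P : (R -> C) -> Prop) :
  (forall f, P f -> cbounded f) ->
  (forall f, P f -> exists2 f', P f' & cderiv f f') ->
  (forall f, P f -> P (mulX f)) ->
  forall f, P f -> schwartz f.
Proof.
move=> Pb Pd PQ f Pf.
have Pk k g : P g -> P (fun t => rc t ^+ k * g t).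
  move=> Pg; elim: k => [|k IH].
    by rewrite (_ : (fun t => _) = g)//; apply/funext => t; rewrite expr0 mul1r.
  rewrite (_ : (fun t => _) = mulX (fun t => rc t ^+ k * g t)); first exact: PQ.
  by apply/funext => t; rewrite /mulX mulrA -exprS.
have Pn n : exists2 g, P g & derive1n n (fun t => complex.Re (f t)) = (fun t =>
  complex.Re (g t)) /\
                            derive1n n (fun t => complex.Im (f t)) = (fun t => complex.Im (g t)).
  elim: n f {Pf} (Pf) => [|n IH] g Pg; first by exists g.
  have [g' Pg' dg] := Pd _ Pg; have [h Ph [h1 h2]] := IH _ Pg'.
  exists h => //; rewrite -h1 -h2; split; apply: derive1nE => t; by case: (dg t).
split; split.
- move=> n x; have [g Pg [-> _]] := Pn n; have [g' _ dg] := Pd _ Pg.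
  by case: (dg x) => -[].
- move=> k l; have [g Pg [-> _]] := Pn l; have [K KP] := Pb _ (Pk k g Pg).
  exists K => t; apply: le_trans (KP t); rewrite cabsM cabsX cabs_real.
  by rewrite ler_wpM2l ?exprn_ge0// Re_le_cabs.
- move=> n x; have [g Pg [_ ->]] := Pn n; have [g' _ dg] := Pd _ Pg.
  by case: (dg x) => _ -[].
- move=> k l; have [g Pg [_ ->]] := Pn l; have [K KP] := Pb _ (Pk k g Pg).
  exists K => t; apply: le_trans (KP t); rewrite cabsM cabsX cabs_real.
  by rewrite ler_wpM2l ?exprn_ge0// Im_le_cabs.
Qed.

Inductive lspan (G : (R -> C) -> Prop) : (R -> C) -> Prop :=
| lspan0 : lspan G (fun=> 0)
| lspanA c g f : G g -> lspan G f -> lspan G (fun t => c * g t + f t).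

Lemma lspanD G f g : lspan G f -> lspan G g -> lspan G (fun t => f t + g t).
Proof.
move=> Gf Gg; elim: Gf => [|c h f' Gh _ IH].
  by rewrite (_ : (fun t => _) = g)//; apply/funext => t; rewrite add0r.
rewrite (_ : (fun t => _) = (fun t => c * h t + (f' t + g t))); first exact: lspanA.
by apply/funext => t; rewrite addrA.
Qed.

Lemma lspanZ G c f : lspan G f -> lspan G (fun t => c * f t).
Proof.
move=> Gf; elim: Gf => [|d h f' Gh _ IH].
  by rewrite (_ : (fun t => _) = fun=> 0); [exact: lspan0|apply/funext => t; rewrite mulr0].
rewrite (_ : (fun t => _) = (fun t => (c * d) * h t + (c * f' t))); first exact: lspanA.
by apply/funext => t; rewrite mulrDr mulrA.
Qed.

Lemma lspan_in (G : (R -> C) -> Prop) f : G f -> lspan G f.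
Proof.
move=> Gf; have := lspanA 1 Gf (lspan0 G).
by under eq_fun do rewrite mul1r addr0.
Qed.

Lemma lspan_ind_lin (G P : (R -> C) -> Prop) : (forall g, G g -> P g) -> P (fun=> 0) ->
  (forall f g, P f -> P g -> P (fun t => f t + g t)) ->
  (forall c f, P f -> P (fun t => c * f t)) -> forall f, lspan G f -> P f.
Proof.
move=> GP P0 PD PZ f; elim=> [//|c g f' Gg _ Pf']; apply: PD => //; apply: PZ; exact: GP.
Qed.

(** The same principle, checked on generators only. Most closure properties of the Schwartz space
    are obtained by choosing a family whose derivatives and multiples by t remain in its span. *)
Lemma schwartz_span (G : (R -> C) -> Prop) :
  (forall f, G f -> cbounded f) ->
  (forall f, G f -> exists2 f', lspan G f' & cderiv f f') ->
  (forall f, G f -> lspan G (mulX f)) ->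
  forall f, lspan G f -> schwartz f.
Proof.
move=> Gb Gd GQ; apply: schwartz_coind.
- apply: lspan_ind_lin => // [|f g [K fK] [L gL]|c f [K fK]].
  + by exists 0 => t; rewrite cabs0.
  + by exists (K + L) => t; apply: le_trans (cabsD _ _) _; rewrite lerD.
  + by exists (cabs c * K) => t; rewrite cabsM ler_wpM2l ?cabs_ge0.
- apply: lspan_ind_lin => // [|f g [f' Gf df] [g' Gg dg]|c f [f' Gf df]].
  + by exists (fun=> 0); [exact: lspan0|exact: cderiv_cst].
  + by exists (fun t => f' t + g' t); [exact: lspanD|exact: cderivD].
  + by exists (fun t => c * f' t); [exact: lspanZ|exact: cderiv_scale].
- apply: lspan_ind_lin => // [|f g Gf Gg|c f Gf].
  + by rewrite (_ : mulX _ = fun=> 0); [exact: lspan0|apply/funext => t; rewrite /mulX mulr0].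
  + rewrite (_ : mulX _ = (fun t => mulX f t + mulX g t)); first exact: lspanD.
    by apply/funext => t; rewrite /mulX mulrDr.
  + rewrite (_ : mulX _ = (fun t => c * mulX f t)); first exact: lspanZ.
    by apply/funext => t; rewrite /mulX mulrCA.
Qed.

Lemma schwartz_derivable f : schwartz f -> exists2 f', schwartz f' & cderiv f f'.
Proof.
move=> [[rd rb] [id ib]].
exists (fun t => Complex (derive1 (fun t => complex.Re (f t)) t)
                        (derive1 (fun t => complex.Im (f t)) t)).
  split; split => /=.
  - by move=> n x; have := rd n.+1 x; rewrite derive1Sn.
  - by move=> k l; have := rb k l.+1; rewrite derive1Sn.
  - by move=> n x; have := id n.+1 x; rewrite derive1Sn.
  - by move=> k l; have := ib k l.+1; rewrite derive1Sn.
move=> t; split; rewrite /= derive1E; apply: DeriveDef => //.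
  exact: (rd 0%N t).
exact: (id 0%N t).
Qed.

Lemma schwartz_bounded f k : schwartz f -> exists K, forall t, `|t| ^+ k * cabs (f t) <= K.
Proof.
move=> [[_ rb] [_ ib]]; have [K KP] := rb k 0%N; have [L LP] := ib k 0%N.
exists (K + L) => t; apply: le_trans (lerD (KP t) (LP t)); rewrite -mulrDr.
by rewrite ler_wpM2l ?exprn_ge0// cabs_le.
Qed.

Lemma schwartz_bounded0 f : schwartz f -> exists K, forall t, cabs (f t) <= K.
Proof.
by move=> /(schwartz_bounded 0)[K KP]; exists K => t; have := KP t; rewrite expr0 mul1r.
Qed.

Lemma schwartz_decay f : schwartz f -> exists K, forall t, (1 + t ^+ 2) * cabs (f t) <= K.
Proof.
move=> Sf; have [K KP] := schwartz_bounded0 Sf; have [L LP] := schwartz_bounded 2 Sf.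
exists (K + L) => t; rewrite mulrDl mul1r lerD//.
by have := LP t; rewrite real_normK ?num_real.
Qed.

Lemma schwartz_cderiv f f' : schwartz f -> cderiv f f' -> schwartz f'.
Proof. by move=> /schwartz_derivable[g Sg dg] /(cderiv_unique dg) <-. Qed.

Lemma schwartz0 : schwartz (fun=> 0).
Proof.
apply: (schwartz_span (G := fun=> False)) => //; exact: lspan0.
Qed.

Lemma cderiv_mulX f f' : cderiv f f' -> cderiv (mulX f) (fun t => f t + mulX f' t).
Proof.
by move=> df; have := cderivM (@cderiv_id R) df; apply: eq_cderiv => // t; rewrite mul1r.
Qed.

Lemma cderiv_Xn k f f' : cderiv f f' ->
  cderiv (fun t => rc t ^+ k * f t) (fun t => k%:R * (rc t ^+ k.-1 * f t) + rc t ^+ k * f' t).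
Proof.
move=> df; elim: k => [|k IH].
  by apply: eq_cderiv df => t; rewrite ?mul0r ?add0r mul1r.
have := cderiv_mulX IH; apply: eq_cderiv => t; rewrite /mulX; first by rewrite exprS mulrA.
rewrite -(natr1 k) mulrDl mul1r !exprS /=; case: k {IH} => [|k]; rewrite /= ?exprS; ring.
Qed.

Lemma schwartz_mulX f : schwartz f -> schwartz (mulX f).
Proof.
pose G (h : R -> C) := exists k g, schwartz g /\ h = (fun t => rc t ^+ k * g t).
move=> Sf; apply: (schwartz_span (G := G)); last first.
- by apply: lspan_in; exists 1%N, f; split=> //; apply/funext => t; rewrite expr1.
- move=> _ [k [g [Sg ->]]]; apply: lspan_in; exists k.+1, g; split=> //.
  by apply/funext => t; rewrite /mulX exprS mulrA.
- move=> _ [k [g [Sg ->]]]; have [g' Sg' dg] := schwartz_derivable Sg.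
  exists (fun t => k%:R * (rc t ^+ k.-1 * g t) + rc t ^+ k * g' t); last exact: cderiv_Xn.
  apply: lspanD; last by apply: lspan_in; exists k, g'.
  by apply: lspanZ; apply: lspan_in; exists k.-1, g.
- move=> _ [k [g [Sg ->]]]; have [K KP] := schwartz_bounded k Sg.
  by exists K => t; rewrite cabsM cabsX cabs_real.
Qed.

Lemma schwartz_lspan f : lspan schwartz f -> schwartz f.
Proof.
apply: schwartz_span => g Sg.
- exact: schwartz_bounded0.
- by have [g' Sg' dg] := schwartz_derivable Sg; exists g' => //; exact: lspan_in.
- by apply: lspan_in; exact: schwartz_mulX.
Qed.

Lemma schwartzD f g : schwartz f -> schwartz g -> schwartz (fun t => f t + g t).
Proof. by move=> Sf Sg; apply: schwartz_lspan; apply: lspanD; exact: lspan_in. Qed.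

Lemma schwartzZ c f : schwartz f -> schwartz (fun t => c * f t).
Proof. by move=> Sf; apply: schwartz_lspan; apply: lspanZ; exact: lspan_in. Qed.

Lemma schwartzN f : schwartz f -> schwartz (fun t => - f t).
Proof. by move=> /(schwartzZ (-1)); under eq_fun do rewrite mulN1r. Qed.

Lemma schwartzB f g : schwartz f -> schwartz g -> schwartz (fun t => f t - g t).
Proof. by move=> Sf /schwartzN Sg; exact: schwartzD. Qed.

Lemma eq_schwartz f g : f =1 g -> schwartz f -> schwartz g.
Proof. by move=> /funext ->. Qed.

Lemma schwartz_sum (I : Type) (s : seq I) (F : I -> R -> C) :
  (forall i, schwartz (F i)) -> schwartz (fun t => \sum_(i <- s) F i t).
Proof.
move=> SF; elim: s => [|i s IH].
  by apply: eq_schwartz schwartz0 => t; rewrite big_nil.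
by apply: eq_schwartz (schwartzD (SF i) IH) => t; rewrite big_cons.
Qed.

Lemma schwartzM f g : schwartz f -> schwartz g -> schwartz (fun t => f t * g t).
Proof.
pose G (h : R -> C) := exists f g, [/\ schwartz f, schwartz g & h = (fun t => f t * g t)].
move=> Sf Sg; apply: (schwartz_span (G := G)); last by apply: lspan_in; exists f, g.
- move=> _ [u [v [/schwartz_bounded0[K KP] /schwartz_bounded0[L LP] ->]]].
  by exists (K * L) => t; rewrite cabsM ler_pM ?cabs_ge0.
- move=> _ [u [v [Su Sv ->]]]; have [u' Su' du] := schwartz_derivable Su.
  have [v' Sv' dv] := schwartz_derivable Sv.
  exists (fun t => u' t * v t + u t * v' t); last exact: cderivM.
  by apply: lspanD; apply: lspan_in; [exists u', v|exists u, v'].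
- move=> _ [u [v [Su Sv ->]]]; apply: lspan_in; exists (mulX u), v.
  by split=> //; [exact: schwartz_mulX|apply/funext => t; rewrite /mulX mulrA].
Qed.

(** The logarithmic derivative of the multiplier is affine, so the products [m * f] are stable under
    both operations; characters and chirps are the two cases. *)
Lemma schwartz_mul_char m (a b : C) f : (forall t, cabs (m t) <= 1) ->
  cderiv m (fun t => (a * rc t + b) * m t) -> schwartz f -> schwartz (fun t => m t * f t).
Proof.
pose G (h : R -> C) := exists2 f, schwartz f & h = (fun t => m t * f t).
move=> m1 dm Sf; apply: (schwartz_span (G := G)); last by apply: lspan_in; exists f.
- move=> _ [g /schwartz_bounded0[K KP] ->]; exists K => t.
  by rewrite cabsM; apply: le_trans (KP t); rewrite ler_piMl ?cabs_ge0.
- move=> _ [g Sg ->]; have [g' Sg' dg] := schwartz_derivable Sg.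
  exists (fun t => m t * (a * mulX g t + b * g t + g' t)).
    apply: lspan_in; exists (fun t => a * mulX g t + b * g t + g' t) => //.
    apply: schwartzD => //; apply: schwartzD; apply: schwartzZ => //; exact: schwartz_mulX.
  by apply: eq_cderiv (cderivM dm dg) => // t; rewrite /mulX; ring.
- move=> _ [g Sg ->]; apply: lspan_in; exists (mulX g); first exact: schwartz_mulX.
  by apply/funext => t; rewrite /mulX mulrCA.
Qed.

Lemma schwartz_e_affine (a b : R) f : schwartz f -> schwartz (fun t => e_ (a * t + b) * f t).
Proof.
apply: (schwartz_mul_char (a := 0) (b := Complex 0 (2 * pi * a))) => [t|].
  by rewrite cabs_e.
by apply: eq_cderiv (cderiv_e_affine a b) => // t; rewrite mul0r add0r.
Qed.

Lemma schwartz_e_quad (a : R) f : schwartz f -> schwartz (fun t => e_ (a * t ^+ 2) * f t).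
Proof.
apply: (schwartz_mul_char (b := 0) (a := Complex 0 (4 * pi * a))) => [t|].
  by rewrite cabs_e.
by apply: eq_cderiv (cderiv_e_quad a) => // t; rewrite addr0.
Qed.

Lemma schwartz_shift (a : R) f : schwartz f -> schwartz (fun t => f (t + a)).
Proof.
pose G (h : R -> C) := exists2 f, schwartz f & h = (fun t => f (t + a)).
move=> Sf; apply: (schwartz_span (G := G)); last by apply: lspan_in; exists f.
- by move=> _ [g /schwartz_bounded0[K KP] ->]; exists K.
- move=> _ [g Sg ->]; have [g' Sg' dg] := schwartz_derivable Sg.
  by exists (fun t => g' (t + a)); [apply: lspan_in; exists g'|exact: cderiv_shift].
- move=> _ [g Sg ->]; apply: lspan_in; exists (fun t => mulX g t - rc a * g t).
    by apply: schwartzB; [exact: schwartz_mulX|exact: schwartzZ].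
  by apply/funext => t; rewrite /mulX rmorphD /=; ring.
Qed.

(** Made for [plateau], whose derivative is known to be Schwartz while the function itself is given
    only as a difference of primitives. *)
Lemma schwartz_compact_support (r : R) f f' : (forall t, r < `|t| -> f t = 0) ->
  cderiv f f' -> schwartz f' -> schwartz f.
Proof.
move=> fr df Sf'.
pose G (h : R -> C) := schwartz h \/ exists k, h = (fun t => rc t ^+ k * f t).
apply: (schwartz_span (G := G)); last first.
- by apply: lspan_in; right; exists 0%N; apply/funext => t; rewrite mul1r.
- move=> h [Sh|[k ->]]; apply: lspan_in; first by left; exact: schwartz_mulX.
  by right; exists k.+1; apply/funext => t; rewrite /mulX exprS mulrA.
- move=> h [Sh|[k ->]].
    by have [h' Sh' dh] := schwartz_derivable Sh; exists h' => //; apply: lspan_in; left.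
  have Sk j : schwartz (fun t => rc t ^+ j * f' t).
    elim: j => [|j IH]; first by apply: eq_schwartz Sf' => t; rewrite mul1r.
    by apply: eq_schwartz (schwartz_mulX IH) => t; rewrite /mulX exprS mulrA.
  exists (fun t => k%:R * (rc t ^+ k.-1 * f t) + rc t ^+ k * f' t); last exact: cderiv_Xn.
  apply: lspanD; last by apply: lspan_in; left.
  by apply: lspanZ; apply: lspan_in; right; exists k.-1.
move=> h [/schwartz_bounded0 //|[k ->]].
have [K KP] := schwartz_bounded0 Sf'.
have K0 : 0 <= K := le_trans (cabs_ge0 _) (KP 0).
(* [f] vanishes at |r| + 1, and the Lipschitz constant [2 * K] times the distance to that point
   bounds it on the support. *)
pose M := 2 * K * (`|r| + (`|r| + 1)).
have M0 : 0 <= M by rewrite mulr_ge0 ?mulr_ge0// !addr_ge0.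
exists (`|r| ^+ k * M) => t; rewrite cabsM cabsX cabs_real.
have [tr|tr] := leP `|t| r; last by rewrite fr// cabs0 mulr0 mulr_ge0 ?exprn_ge0.
have tr' : `|t| <= `|r| by apply: le_trans tr _; exact: ler_norm.
apply: ler_pM; rewrite ?exprn_ge0 ?cabs_ge0 ?lerXn2r ?nnegrE//.
have f0 : f (`|r| + 1) = 0.
  apply: fr; rewrite ger0_norm ?addr_ge0//; have := ler_norm r; lra.
have := cderiv_lipschitz df KP (`|r| + 1) t; rewrite f0 subr0 => H.
apply: le_trans H _; rewrite /M ler_wpM2l ?mulr_ge0//.
apply: le_trans (ler_normB _ _) _; rewrite [X in _ + X]ger0_norm ?addr_ge0//.
by rewrite lerD2r.
Qed.

End SchwartzSpace.

(** * Integrals of decaying functions *)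

Section RealIntegral.
Variable R : realType.
Local Notation mu := (@lebesgue_measure R).
Implicit Types g : R -> R.

Lemma integrable_oneDsqrV : mu.-integrable setT (EFin \o (fun x : R => (1 + x ^+ 2)^-1)).
Proof.
have c : continuous (fun x : R => (1 + x ^+ 2)^-1) by exact: continuous_oneDsqrV.
apply/integrableP; split.
  apply/measurable_EFinP; exact: continuous_measurable_fun.
under eq_integral do rewrite /= ger0_norm ?invr_ge0 ?addr_ge0 ?sqr_ge0//.
rewrite ge0_symfun_integralT//=; last 2 first.
- by move=> x; rewrite invr_ge0 addr_ge0 ?sqr_ge0.
- by move=> x /=; rewrite sqrrN.
rewrite -set_itvcy; have := integral0y_oneDsqr R; rewrite /oneDsqr => ->.
by rewrite -EFinM ltry.
Qed.

Lemma integral_oneDsqrV_ge0 : 0 <= \int[mu]_x (1 + x ^+ 2)^-1.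
Proof. by apply: Rintegral_ge0 => x _; rewrite invr_ge0 addr_ge0 ?sqr_ge0. Qed.

Lemma decay_integrable g K : measurable_fun setT g ->
  (forall t, (1 + t ^+ 2) * `|g t| <= K) -> mu.-integrable setT (EFin \o g).
Proof.
move=> mg gK; apply: (@le_integrable _ _ _ mu setT _ _
   (EFin \o (fun x : R => K * (1 + x ^+ 2)^-1))) => //.
- exact/measurable_EFinP.
- move=> t _; rewrite lee_fin [leRHS]ger0_norm; last first.
    rewrite mulr_ge0 ?invr_ge0 ?addr_ge0 ?sqr_ge0//; apply: le_trans (gK 0).
    by rewrite mulr_ge0 ?addr_ge0 ?sqr_ge0.
  rewrite ler_pdivlMr ?(lt_le_trans ltr01) ?lerDl ?sqr_ge0// mulrC; exact: gK.
exact: (integrableZl measurableT K integrable_oneDsqrV).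
Qed.

Lemma decay_Rintegral_le g K : measurable_fun setT g ->
  (forall t, (1 + t ^+ 2) * `|g t| <= K) ->
  `|\int[mu]_x g x| <= K * \int[mu]_x (1 + x ^+ 2)^-1.
Proof.
move=> mg gK; have ig := decay_integrable mg gK.
apply: le_trans (le_normr_Rintegral measurableT ig) _.
rewrite -RintegralZl//; last exact: integrable_oneDsqrV.
apply: le_Rintegral => //.
- by have := integrable_norm ig.
- exact: (integrableZl measurableT K integrable_oneDsqrV).
move=> t _; rewrite ler_pdivlMr ?(lt_le_trans ltr01) ?lerDl ?sqr_ge0// mulrC; exact: gK.
Qed.

Lemma measurable_shift (a : R) : measurable_fun (setT : set (measurableTypeR R))
  ((fun x => x + a) : R -> measurableTypeR R).
Proof.
apply: continuous_measurable_fun => x.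
by apply: cvgD; [exact: cvg_id|exact: cvg_cst].
Qed.

(** The measure is determined by its values on half-open intervals, and translation preserves their
    length. *)
Lemma lebesgue_measure_shift (a : R) (A : set (measurableTypeR R)) : measurable A ->
  pushforward mu ((fun x => x + a) : R -> measurableTypeR R) A = mu A.
Proof.
move=> mA; have ms := measurable_shift a.
pose nu : {measure set (measurableTypeR R) -> \bar R} :=
  measure_function_pushforward__canonical__measure_function_Measure mu ms.
apply/esym; apply: (lebesgue_measure_unique (mu := nu)) mA => X -[[c d] _ <-] /=.
rewrite /nu /= /pushforward.
have -> : (fun x => x + a) @^-1` `]c, d]%classic = `]c - a, d - a]%classic.
  by apply/seteqP; split => x /=; rewrite !in_itv/= ltrBlDr lerBrDr.
rewrite !lebesgue_measure_itv /= !lte_fin ltrD2r; case: ifP => // _.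
by rewrite -!EFinB; congr EFin; ring.
Qed.

(** The point is 1 + t^2 <= 2 (1 + a^2) (1 + (t + a)^2), the difference being a sum of squares. The
    size [n] is abstract in order to cover real and complex values. *)
Lemma decay_shift (V : Type) (n : V -> R) (f : R -> V) K a : (forall v, 0 <= n v) ->
  (forall t, (1 + t ^+ 2) * n (f t) <= K) ->
  forall t, (1 + t ^+ 2) * n (f (t + a)) <= 2 * (1 + a ^+ 2) * K.
Proof.
move=> n0 fK t; apply: (@le_trans _ _ (2 * (1 + a ^+ 2) * ((1 + (t + a) ^+ 2) * n (f (t + a))))).
  rewrite mulrA ler_wpM2r//.
  suff : 0 <= 2 * (1 + a ^+ 2) * (1 + (t + a) ^+ 2) - (1 + t ^+ 2) by rewrite subr_ge0.
  have -> : 2 * (1 + a ^+ 2) * (1 + (t + a) ^+ 2) - (1 + t ^+ 2) =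
    1 + (t + 2 * a) ^+ 2 + 2 * (a * (t + a)) ^+ 2 by ring.
  apply: addr_ge0; first by apply: addr_ge0 => //; exact: sqr_ge0.
  by apply: mulr_ge0 => //; exact: sqr_ge0.
by rewrite ler_wpM2l// mulr_ge0// addr_ge0// sqr_ge0.
Qed.

Let sh (a : R) : R -> measurableTypeR R := fun x => x + a.

Lemma Rintegral_shift g a K : measurable_fun setT g ->
  (forall t, (1 + t ^+ 2) * `|g t| <= K) ->
  \int[mu]_x g (x + a) = \int[mu]_x g x.
Proof.
move=> mg gK; congr fine.
have ms := measurable_shift a.
have E1 : (\int[pushforward mu (sh a)]_x (g x)%:E = \int[mu]_x (g x)%:E)%E.
  apply: eq_measure_integral => A mA _; exact: lebesgue_measure_shift.
have mE : measurable_fun (setT : set (measurableTypeR R)) (EFin \o g) by exact/measurable_EFinP.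
have iE : mu.-integrable (sh a @^-1` setT) ((EFin \o g) \o sh a).
  apply: (@decay_integrable (g \o sh a) (2 * (1 + a ^+ 2) * K)).
    exact: (measurableT_comp mg ms).
  exact: (decay_shift (n := Num.norm)).
by rewrite -E1 (integral_pushforward ms mE iE).
Qed.

End RealIntegral.

(** * Integrals of complex-valued functions *)

Section ComplexIntegral.
Variable R : realType.
Local Notation C := R[i].
Local Notation rc := (real_complex R).
Local Notation schwartz := (@Pilot.Defs.schwartz R).
Local Notation mu := (@lebesgue_measure R).
Implicit Types f g h : R -> C.

Definition cmeasurable f := measurable_fun setT (fun t => complex.Re (f t)) /\
  measurable_fun setT (fun t => complex.Im (f t)).

Definition decay_le f (K : R) := forall t, (1 + t ^+ 2) * cabs (f t) <= K.

Definition decaying f := cmeasurable f /\ exists K, decay_le f K.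

Definition cintK : R := 2 * \int[mu]_x (1 + x ^+ 2)^-1.

Lemma cintK_ge0 : 0 <= cintK. Proof. by rewrite mulr_ge0 ?integral_oneDsqrV_ge0. Qed.

Lemma oneDsqr_ge0 (t : R) : 0 <= 1 + t ^+ 2. Proof. by rewrite addr_ge0 ?sqr_ge0. Qed.

Lemma decay_Re f K : decay_le f K -> forall t, (1 + t ^+ 2) * `|complex.Re (f t)| <= K.
Proof.
by move=> fK t; apply: le_trans (fK t); rewrite ler_wpM2l ?oneDsqr_ge0// Re_le_cabs.
Qed.

Lemma decay_Im f K : decay_le f K -> forall t, (1 + t ^+ 2) * `|complex.Im (f t)| <= K.
Proof.
by move=> fK t; apply: le_trans (fK t); rewrite ler_wpM2l ?oneDsqr_ge0// Im_le_cabs.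
Qed.

Lemma decaying_Re f : decaying f -> mu.-integrable setT (EFin \o (fun t => complex.Re (f t))).
Proof. by move=> [[mr _] [K /decay_Re]]; exact: decay_integrable. Qed.

Lemma decaying_Im f : decaying f -> mu.-integrable setT (EFin \o (fun t => complex.Im (f t))).
Proof. by move=> [[_ mi] [K /decay_Im]]; exact: decay_integrable. Qed.

Lemma cmeasurableD f g : cmeasurable f -> cmeasurable g -> cmeasurable (fun t => f t + g t).
Proof.
move=> [a b] [c d]; split.
  by under eq_fun do rewrite cReD; exact: measurable_funD.
by under eq_fun do rewrite cImD; exact: measurable_funD.
Qed.

Lemma cmeasurableM f g : cmeasurable f -> cmeasurable g -> cmeasurable (fun t => f t * g t).
Proof.
move=> [a b] [c d]; split.
  by under eq_fun do rewrite cReM; apply: measurable_funB; exact: measurable_funM.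
by under eq_fun do rewrite cImM; apply: measurable_funD; exact: measurable_funM.
Qed.

Lemma cmeasurable_cst c : cmeasurable (fun=> c).
Proof. by split; exact: measurable_cst. Qed.

Lemma cderiv_cmeasurable f f' : cderiv f f' -> cmeasurable f.
Proof.
by move=> /cderiv_continuous[a b]; split; exact: continuous_measurable_fun.
Qed.

Lemma decayingD f g : decaying f -> decaying g -> decaying (fun t => f t + g t).
Proof.
move=> [mf [K fK]] [mg [L gL]]; split; first exact: cmeasurableD.
exists (K + L) => t; apply: le_trans (lerD (fK t) (gL t)).
by rewrite -mulrDr ler_wpM2l ?oneDsqr_ge0 ?cabsD.
Qed.

Lemma decaying_mul w f : cmeasurable w -> cbounded w -> decaying f ->
  decaying (fun t => w t * f t).
Proof.
move=> mw [L wL] [mf [K fK]]; split; first exact: cmeasurableM.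
exists (L * K) => t; rewrite cabsM mulrCA.
by rewrite ler_pM ?cabs_ge0// mulr_ge0 ?oneDsqr_ge0 ?cabs_ge0.
Qed.

Lemma decayingZ c f : decaying f -> decaying (fun t => c * f t).
Proof. by apply: decaying_mul; [exact: cmeasurable_cst|exists (cabs c)]. Qed.

Lemma decayingN f : decaying f -> decaying (fun t => - f t).
Proof. by move=> /(decayingZ (-1)); under eq_fun do rewrite mulN1r. Qed.

Lemma decaying0 : decaying (fun=> 0).
Proof.
by split; [exact: cmeasurable_cst|exists 0 => t; rewrite cabs0 mulr0].
Qed.

Lemma decaying_sum (I : Type) (s : seq I) (F : I -> R -> C) : (forall i, decaying (F i)) ->
  decaying (fun t => \sum_(i <- s) F i t).
Proof.
move=> dF; elim: s => [|i s IH].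
  by under eq_fun do rewrite big_nil; exact: decaying0.
by under eq_fun do rewrite big_cons; exact: decayingD.
Qed.

Lemma decaying_shift f a : decaying f -> decaying (fun t => f (t + a)).
Proof.
move=> [[mr mi] [K fK]]; split; last first.
  by exists (2 * (1 + a ^+ 2) * K); apply: decay_shift fK; exact: cabs_ge0.
split; first exact: (measurableT_comp mr (measurable_shift a)).
exact: (measurableT_comp mi (measurable_shift a)).
Qed.

Lemma schwartz_decaying f : schwartz f -> decaying f.
Proof.
move=> Sf; split; last exact: schwartz_decay.
have [f' _ df] := schwartz_derivable Sf; exact: cderiv_cmeasurable df.
Qed.

Lemma cintD f g : decaying f -> decaying g ->
  cintegral (fun t => f t + g t) = cintegral f + cintegral g.
Proof.
move=> df dg; rewrite /cintegral; apply: complex_eq; rewrite ?cReD ?cImD /=.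
  rewrite -RintegralD//; [|exact: decaying_Re..].
  by apply: eq_Rintegral => t _; rewrite cReD.
rewrite -RintegralD//; [|exact: decaying_Im..].
by apply: eq_Rintegral => t _; rewrite cImD.
Qed.

Lemma cintZ c f : decaying f -> cintegral (fun t => c * f t) = c * cintegral f.
Proof.
move=> df; have ir := decaying_Re df; have ii := decaying_Im df.
have iZ (r : R) (g : R -> R) : mu.-integrable setT (EFin \o g) ->
    mu.-integrable setT (EFin \o (fun x => r * g x)).
  by move=> ig; exact: (integrableZl measurableT r ig).
rewrite /cintegral; apply: complex_eq; rewrite ?cReM ?cImM /=.
  rewrite -!RintegralZl// -RintegralB//; [|exact: iZ..].
  by apply: eq_Rintegral => t _; rewrite cReM.
rewrite -!RintegralZl// -RintegralD//; [|exact: iZ..].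
by apply: eq_Rintegral => t _; rewrite cImM.
Qed.

Lemma eq_cint f g : f =1 g -> cintegral f = cintegral g.
Proof. by move=> /funext ->. Qed.

Lemma cint0 : cintegral (fun=> 0) = 0 :> C.
Proof.
rewrite -[RHS](mul0r (cintegral (fun=> 0))) -cintZ; last exact: decaying0.
by apply: eq_cint => t; rewrite mulr0.
Qed.

Lemma cintN f : decaying f -> cintegral (fun t => - f t) = - cintegral f.
Proof.
by move=> df; rewrite -mulN1r -cintZ//; apply: eq_cint => t; rewrite mulN1r.
Qed.

Lemma cintB f g : decaying f -> decaying g ->
  cintegral (fun t => f t - g t) = cintegral f - cintegral g.
Proof. by move=> df dg; rewrite cintD ?cintN//; exact: decayingN. Qed.

Lemma cint_sum (I : Type) (s : seq I) (F : I -> R -> C) : (forall i, decaying (F i)) ->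
  cintegral (fun t => \sum_(i <- s) F i t) = \sum_(i <- s) cintegral (F i).
Proof.
move=> dF; elim: s => [|i s IH].
  by rewrite big_nil; apply: etrans cint0; apply: eq_cint => t; rewrite big_nil.
rewrite big_cons -IH -cintD//; last exact: decaying_sum.
by apply: eq_cint => t; rewrite big_cons.
Qed.

Lemma cint_shift f a : decaying f -> cintegral (fun t => f (t + a)) = cintegral f.
Proof.
move=> [[mr mi] [K fK]]; rewrite /cintegral; congr Complex.
  exact: Rintegral_shift mr (decay_Re fK).
exact: Rintegral_shift mi (decay_Im fK).
Qed.

Lemma cint_le f K : decaying f -> decay_le f K -> cabs (cintegral f) <= cintK * K.
Proof.
move=> [[mr mi] _] fK; apply: le_trans (cabs_le _) _.
rewrite /cintK -mulrA mulrDl mul1r [_ * K]mulrC; apply: lerD.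
  exact: decay_Rintegral_le mr (decay_Re fK).
exact: decay_Rintegral_le mi (decay_Im fK).
Qed.

(** By translation invariance the integral of f(t + d) - f(t) is zero, so d times the integral of f'
    equals, up to sign, the integral of a Taylor remainder of order d^2; one divides by d and lets
    it tend to 0. *)
Lemma cint_deriv f f' : schwartz f -> cderiv f f' -> cintegral f' = 0.
Proof.
move=> Sf df; have Sf' := schwartz_cderiv Sf df.
have [f'' Sf'' df'] := schwartz_derivable Sf'.
have [K KP] := schwartz_decay Sf''.
have K0 : 0 <= K by apply: le_trans (KP 0); rewrite mulr_ge0 ?oneDsqr_ge0 ?cabs_ge0.
have main (d : R) : 0 < d <= 1 -> cabs (cintegral f') <= (cintK * (6 * K)) * d.
  move=> /andP[d0 d1].
  have dec : decaying (fun t => f (t + d) - f t - rc d * f' t).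
    apply: decayingD; last by apply/decayingN/decayingZ/schwartz_decaying.
    apply: decayingD; last exact/decayingN/schwartz_decaying.
    exact/decaying_shift/schwartz_decaying.
  have := cint_le (K := 6 * K * d ^+ 2) dec.
  rewrite cintB; last 2 first.
  - apply: decayingD; last exact/decayingN/schwartz_decaying.
    exact/decaying_shift/schwartz_decaying.
  - exact/decayingZ/schwartz_decaying.
  rewrite cintB; [|exact/decaying_shift/schwartz_decaying|exact/schwartz_decaying].
  rewrite cint_shift; last exact: schwartz_decaying.
  rewrite subrr sub0r cabsN cintZ; last exact: schwartz_decaying.
  rewrite cabsM cabs_real gtr0_norm// => H.
  rewrite -(ler_pM2l d0); apply: le_trans (H _) _; last by rewrite le_eqVlt; apply/orP; left;
    apply/eqP; ring.
  move=> t; rewrite -ler_pdivlMl; last by rewrite ltr_wpDr ?sqr_ge0.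
  (* For |c - t| <= 1 one has 1 + t^2 <= 3 (1 + c^2), so the decay of [f''] at [c] is a decay at [t]
     with three times the constant. *)
  apply: le_trans (cderiv_taylor (K := 3 * K / (1 + t ^+ 2)) df df' _) _; last first.
    by rewrite le_eqVlt; apply/orP; left; apply/eqP; field; rewrite gt_eqF// ltr_wpDr ?sqr_ge0.
  move=> c; rewrite (gtr0_norm d0) => ct.
  rewrite ler_pdivlMr; last by rewrite ltr_wpDr ?sqr_ge0.
  apply: (@le_trans _ _ (3 * ((1 + c ^+ 2) * cabs (f'' c)))); last by rewrite ler_wpM2l.
  rewrite mulrA mulrC ler_wpM2r ?cabs_ge0//.
  move: (le_trans ct d1); rewrite ler_norml => /andP[h1 h2].
  have h3 : 0 <= (1 - (c - t)) * (1 + (c - t)) by apply: mulr_ge0; lra.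
  by have := sqr_ge0 (2 * c - (c - t)); nra.
apply/cabs_eq0/eqP; rewrite eq_le cabs_ge0 andbT; apply/ler_addgt0Pr => e e0; rewrite add0r.
set M := cintK * (6 * K) in main.
have M0 : 0 <= M by rewrite mulr_ge0 ?cintK_ge0 ?mulr_ge0.
have [h|h] := leP (e / (M + 1)) 1.
  have d0 : 0 < e / (M + 1) by rewrite divr_gt0// ltr_wpDl.
  apply: le_trans (main (e / (M + 1)) _) _; first by rewrite d0 h.
  by rewrite mulrA ler_pdivrMr ?ltr_wpDl//; nra.
apply: le_trans (main 1 _) _; first by rewrite ltr01 lexx.
move: h; rewrite ltr_pdivlMr ?ltr_wpDl//; lra.
Qed.

End ComplexIntegral.

(** * The order six operator *)

Section OscillatoryIntegral.
Variable R : realType.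
Local Notation C := R[i].
Local Notation rc := (real_complex R).
Local Notation pi := (@trigo.pi R).
Local Notation schwartz := (@Pilot.Defs.schwartz R).
Implicit Types f g h : R -> C.

Definition twopii : C := Complex 0 (2 * pi).

Lemma twopii_neq0 : twopii != 0.
Proof.
by rewrite eq_complex /= eqxx /= mulf_neq0 ?gt_eqF ?pi_gt0.
Qed.

Lemma schwartz_cmeasurable f : schwartz f -> cmeasurable f.
Proof. by move=> /schwartz_decaying[]. Qed.

(** Covers two uses: [u x = x] for the integral operators, and [u x = x ^+ 2] for the Gaussian
    integral as a function of its chirp. *)
Lemma cderiv_cint_phase (u v : R -> R) f (K : R) :
  (forall y, decaying (fun x => f x * e_ (y * u x + v x))) ->
  (forall y, decaying (fun x => rc (u x) * f x * e_ (y * u x + v x))) ->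
  decay_le (fun x => rc (u x ^+ 2) * f x) K ->
  cderiv (fun y => cintegral (fun x => f x * e_ (y * u x + v x)))
         (fun y => twopii * cintegral (fun x => rc (u x) * f x * e_ (y * u x + v x))).
Proof.
move=> df duf Ku; apply: cderiv_of_quadratic => y.
exists (cintK R * (8 * pi ^+ 2 * K)) => d _.
rewrite mulrCA -cintZ// -cintB//; last first.
rewrite -cintZ//; last exact: decayingZ.
rewrite -cintB; last 2 first.
- exact: (decayingD (df _) (decayingN (df _))).
- by do 2 apply: decayingZ.
rewrite -mulrA.
apply: cint_le.
  apply: decayingD; first exact: (decayingD (df _) (decayingN (df _))).
  by apply: decayingN; do 2 apply: decayingZ.
move=> x.
have -> : f x * e_ ((y + d) * u x + v x) - f x * e_ (y * u x + v x) -
    twopii * (rc d * (rc (u x) * f x * e_ (y * u x + v x))) =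
  f x * (e_ ((y * u x + v x) + d * u x) - e_ (y * u x + v x) -
    rc (d * u x) * (twopii * e_ (y * u x + v x))).
  have -> : (y + d) * u x + v x = y * u x + v x + d * u x by ring.
  by rewrite rmorphM /=; ring.
rewrite cabsM; have := e_taylor (y * u x + v x) (d * u x); rewrite -/twopii.
move=> /(ler_wpM2l (cabs_ge0 (f x))) /(ler_wpM2l (oneDsqr_ge0 x)) h; apply: le_trans h _.
have := Ku x; rewrite cabsM cabs_real (ger0_norm (sqr_ge0 (u x))) => h.
have -> : (1 + x ^+ 2) * (cabs (f x) * (8 * pi ^+ 2 * (d * u x) ^+ 2)) =
  8 * pi ^+ 2 * d ^+ 2 * ((1 + x ^+ 2) * (u x ^+ 2 * cabs (f x))) by ring.
have -> : 8 * pi ^+ 2 * K * d ^+ 2 = 8 * pi ^+ 2 * d ^+ 2 * K by ring.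
by apply: ler_wpM2l => //; apply: mulr_ge0; [apply: mulr_ge0|]; rewrite ?sqr_ge0.
Qed.

(** Fourier transform of [f] times a chirp. The parameter -1/2 gives W, and 0 gives W^2, up to
    unimodular factors. *)
Definition fresnel (q : R) f : R -> C :=
  fun t => cintegral (fun x => f x * e_ (t * x + q * x ^+ 2)).

Lemma schwartz_kernel q t f : schwartz f -> schwartz (fun x => f x * e_ (t * x + q * x ^+ 2)).
Proof.
move=> /(schwartz_e_quad q)/(schwartz_e_affine t 0); apply: eq_schwartz => x.
by rewrite addr0 [in RHS]e_D; ring.
Qed.

Lemma cderiv_fresnel q f : schwartz f ->
  cderiv (fresnel q f) (fun t => twopii * fresnel q (mulX f) t).
Proof.
move=> Sf; have [K KP] := schwartz_decay (schwartz_mulX (schwartz_mulX Sf)).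
apply: (@cderiv_cint_phase id (fun x => q * x ^+ 2) f K) => [y|y|x].
- exact/schwartz_decaying/schwartz_kernel.
- exact/schwartz_decaying/schwartz_kernel/schwartz_mulX.
- by have := KP x; rewrite /mulX rmorphXn expr2 mulrA.
Qed.

Lemma fresnelD q f g : schwartz f -> schwartz g ->
  fresnel q (fun t => f t + g t) = (fun t => fresnel q f t + fresnel q g t).
Proof.
move=> Sf Sg; apply/funext => t; rewrite /fresnel -cintD;
  try exact/schwartz_decaying/schwartz_kernel.
by apply: eq_cint => x; rewrite mulrDl.
Qed.

Lemma fresnelZ q c f : schwartz f ->
  fresnel q (fun t => c * f t) = (fun t => c * fresnel q f t).
Proof.
move=> Sf; apply/funext => t; rewrite /fresnel -cintZ;
  last exact/schwartz_decaying/schwartz_kernel.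
by apply: eq_cint => x; rewrite mulrA.
Qed.

(** Integration by parts: the logarithmic derivative of the kernel is affine in t and x, which
    yields multiplication by t outside the integral and [mulX] inside. *)
Lemma fresnel_deriv q f f' : schwartz f -> cderiv f f' -> forall t,
  fresnel q f' t = - twopii * (rc t * fresnel q f t) - 2 * rc q * twopii * fresnel q (mulX f) t.
Proof.
move=> Sf df t; have Sf' := schwartz_cderiv Sf df.
have dk : cderiv (fun x => e_ (t * x + q * x ^+ 2))
    (fun x => (twopii * rc t + 2 * rc q * twopii * rc x) * e_ (t * x + q * x ^+ 2)).
  apply: eq_cderiv (cderivM (cderiv_e_affine t 0) (cderiv_e_quad q)) => x.
    by rewrite -e_D addr0.
  rewrite addr0 e_D /twopii; set A := e_ _; set B := e_ _.
  have -> : Complex 0 (2 * pi * t) = Complex 0 (2 * pi) * rc t.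
    by apply: complex_eq; rewrite ?cReM ?cImM /=; ring.
  have -> : Complex 0 (4 * pi * q) = 2 * rc q * Complex 0 (2 * pi).
    by apply: complex_eq; rewrite ?cReM ?cImM /=; ring.
  by ring.
have := cint_deriv (schwartz_kernel q t Sf) (cderivM df dk).
have Sk := schwartz_kernel q t Sf; have SXk := schwartz_kernel q t (schwartz_mulX Sf).
rewrite cintD; last 2 first.
- exact/schwartz_decaying/schwartz_kernel.
- apply/schwartz_decaying; have := schwartzD (schwartzZ (twopii * rc t) Sk) (schwartzZ (2 * rc q
    * twopii) SXk).
  by apply: eq_schwartz => x; rewrite /mulX; ring.
rewrite -/(fresnel q f' t) => /eqP; rewrite addr_eq0 => /eqP ->.
have -> : cintegral (fun x => f x * ((twopii * rc t + 2 * rc q * twopii * rc x) * e_ (t * x + q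
  * x ^+ 2)))
  = cintegral (fun x => twopii * rc t * (f x * e_ (t * x + q * x ^+ 2)) +
     2 * rc q * twopii * (mulX f x * e_ (t * x + q * x ^+ 2))).
  by apply: eq_cint => x; rewrite /mulX; ring.
rewrite cintD; [|exact/decayingZ/schwartz_decaying..].
rewrite !cintZ; [|exact/schwartz_decaying..].
by rewrite /fresnel; ring.
Qed.

(** Differentiation puts [mulX] under the integral, and [fresnel_deriv], solved for the term with t,
    expresses multiplication by t; so the transforms of Schwartz functions are a stable family. *)
Lemma schwartz_fresnel q f : schwartz f -> schwartz (fresnel q f).
Proof.
pose G (h : R -> C) := exists2 f, schwartz f & h = fresnel q f.
move=> Sf; apply: (schwartz_span (G := G)); last by apply: lspan_in; exists f.
- move=> _ [g Sg ->]; have [K KP] := schwartz_decay Sg.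
  exists (cintK R * K) => t; apply: cint_le; first exact/schwartz_decaying/schwartz_kernel.
  by move=> x; rewrite cabsM cabs_e mulr1; exact: KP.
- move=> _ [g Sg ->]; exists (fun t => twopii * fresnel q (mulX g) t); last exact: cderiv_fresnel.
  by apply/lspanZ/lspan_in; exists (mulX g) => //; exact: schwartz_mulX.
- move=> _ [g Sg ->]; have [g' Sg' dg] := schwartz_derivable Sg.
  rewrite (_ : mulX _ = fun t => - twopii^-1 * fresnel q g' t + - (2 * rc q) * fresnel q (mulX
    g) t).
    apply: lspanD; apply: lspanZ; apply: lspan_in; first by exists g'.
    by exists (mulX g) => //; exact: schwartz_mulX.
  apply/funext => t; rewrite (fresnel_deriv q Sg dg) /mulX.
  by field; exact: twopii_neq0.
Qed.

Lemma opWE f : opW f = fun t => e_ (1 / 24) * fresnel (- (1 / 2)) f t.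
Proof.
apply/funext => t; rewrite /opW /fresnel; congr (_ * _); apply: eq_cint => x.
by congr (_ * e_ _); field.
Qed.

Lemma opW2E f : opW2 f = fun t => e_ (- (1 / 24)) * (e_ (1 / 2 * t ^+ 2) * fresnel 0 f t).
Proof.
apply/funext => t; rewrite /opW2 /fresnel -mulrA; congr (_ * (e_ _ * _)); first by field.
by apply: eq_cint => x; congr (_ * e_ _); ring.
Qed.

Lemma schwartz_opW f : schwartz f -> schwartz (opW f).
Proof. by move=> Sf; rewrite opWE; apply/schwartzZ/schwartz_fresnel. Qed.

Lemma schwartz_opW2 f : schwartz f -> schwartz (opW2 f).
Proof. by move=> Sf; rewrite opW2E; apply/schwartzZ/schwartz_e_quad/schwartz_fresnel. Qed.

Lemma opWD f g : schwartz f -> schwartz g ->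
  opW (fun t => f t + g t) = (fun t => opW f t + opW g t).
Proof. by move=> Sf Sg; rewrite !opWE fresnelD//; apply/funext => t; rewrite mulrDr. Qed.

Lemma opWZ c f : schwartz f -> opW (fun t => c * f t) = (fun t => c * opW f t).
Proof. by move=> Sf; rewrite !opWE fresnelZ//; apply/funext => t; rewrite mulrCA. Qed.

Lemma opW2D f g : schwartz f -> schwartz g ->
  opW2 (fun t => f t + g t) = (fun t => opW2 f t + opW2 g t).
Proof. by move=> Sf Sg; rewrite !opW2E fresnelD//; apply/funext => t; rewrite !mulrDr. Qed.

Lemma opW2Z c f : schwartz f -> opW2 (fun t => c * f t) = (fun t => c * opW2 f t).
Proof. by move=> Sf; rewrite !opW2E fresnelZ//; apply/funext => t; ring. Qed.

Lemma opW_mulX f : schwartz f -> cderiv (opW f) (fun t => twopii * opW (mulX f) t).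
Proof.
move=> Sf; rewrite !opWE; have := cderiv_scale (e_ (1 / 24)) (cderiv_fresnel (- (1 / 2)) Sf).
by apply: eq_cderiv => // t; ring.
Qed.

Lemma opW_deriv f f' : schwartz f -> cderiv f f' ->
  opW f' = (fun t => twopii * opW (mulX f) t - twopii * mulX (opW f) t).
Proof.
move=> Sf df; rewrite !opWE; apply/funext => t.
by rewrite (fresnel_deriv _ Sf df) /mulX rmorphN rmorphM rmorphV ?unitfE// rmorph1 rmorph_nat;
  field.
Qed.

Lemma opW2_mulX f : schwartz f ->
  cderiv (opW2 f) (fun t => twopii * mulX (opW2 f) t + twopii * opW2 (mulX f) t).
Proof.
move=> Sf; rewrite !opW2E.
have := cderiv_scale (e_ (- (1 / 24))) (cderivM (cderiv_e_quad (1 / 2)) (cderiv_fresnel 0 Sf)).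
apply: eq_cderiv => // t; rewrite /mulX.
have -> : Complex 0 (4 * pi * (1 / 2)) = twopii by rewrite /twopii; congr Complex; field.
by ring.
Qed.

Lemma opW2_deriv f f' : schwartz f -> cderiv f f' ->
  opW2 f' = (fun t => - twopii * mulX (opW2 f) t).
Proof.
move=> Sf df; rewrite !opW2E; apply/funext => t.
by rewrite (fresnel_deriv _ Sf df) /mulX rmorph0; ring.
Qed.

End OscillatoryIntegral.

(** * Hadamard division and operators commuting with t *)

Section Hadamard.
Variable R : realType.
Local Notation C := R[i].
Local Notation rc := (real_complex R).
Local Notation schwartz := (@Pilot.Defs.schwartz R).
Local Notation mu := (@lebesgue_measure R).
Implicit Types f g h : R -> C.

Definition cD f : R -> C := fun t =>
  Complex (derive1 (fun t => complex.Re (f t)) t) (derive1 (fun t => complex.Im (f t)) t).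

Lemma cDP f : schwartz f -> cderiv f (cD f).
Proof.
move=> /schwartz_derivable[f' _ df]; rewrite (_ : cD f = f')//; apply/funext => t.
by have [[_ a] [_ b]] := df t; apply: complex_eq; rewrite /= derive1E.
Qed.

Lemma schwartz_cD f : schwartz f -> schwartz (cD f).
Proof. by move=> Sf; exact: schwartz_cderiv (cDP Sf). Qed.

Lemma Rintegral_FTC (F F' : R -> R) a b : a < b -> continuous F' ->
  (forall x : R, is_derive x 1 F (F' x)) -> \int[mu]_(x in `[a, b]) F' x = F b - F a.
Proof.
move=> ab cF' dF; rewrite /Rintegral (continuous_FTC2 (F := F))//.
- exact: continuous_subspaceT.
- split; first by move=> x _; case: (dF x).
  + by apply: cvg_at_right_filter; exact: (is_derive_continuous dF).
  + by apply: cvg_at_left_filter; exact: (is_derive_continuous dF).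
- by move=> x _; rewrite derive1E; case: (dF x).
Qed.

(** The indicator turns an integral over a segment into a [cintegral] over the line, to which the
    decay estimates apply. *)
Definition unit_ind (u : R) : C := if (0 <= u <= 1) then 1 else 0.

Lemma cmeasurable_unit_ind : cmeasurable unit_ind.
Proof.
have -> : unit_ind = fun u => rc (\1_`[0, 1]%classic u).
  apply/funext => u; rewrite /unit_ind indicE mem_setE in_itv /=.
  by case: ifP => _; rewrite ?rmorph1 ?rmorph0.
by split; [exact: measurable_indic|exact: measurable_cst].
Qed.

Lemma Rintegral_unit_ind (g : R -> R) :
  \int[mu]_u complex.Re (unit_ind u * rc (g u)) = \int[mu]_(u in `[0, 1]) g u.
Proof.
rewrite [RHS]Rintegral_mkcond; apply: eq_Rintegral => u _.
rewrite patchE mem_setE in_itv /= /unit_ind cReM /= mulr0 subr0.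
by case: ifP; rewrite /= ?mul1r ?mul0r.
Qed.

(* Averages of f along the segment from 0 to x, the derivatives of Hadamard's quotient. *)
Definition segment_mean (l : nat) f : R -> C :=
  fun x => cintegral (fun u => unit_ind u * rc u ^+ l * f (x * u)).

Lemma segment_mean_decay l (K : R) f x : cmeasurable f -> (forall t, cabs (f t) <= K) ->
  decay_le (fun u => unit_ind u * rc u ^+ l * f (x * u)) (2 * K).
Proof.
move=> mf fK u; have K0 : 0 <= K := le_trans (cabs_ge0 _) (fK 0).
rewrite /unit_ind; case: ifP => [/andP[u0 u1]|_]; last first.
  by rewrite !mul0r cabs0 mulr0 mulr_ge0.
rewrite mul1r cabsM cabsX cabs_real ger0_norm// mulrA ler_pM ?cabs_ge0//.
  by rewrite mulr_ge0 ?oneDsqr_ge0 ?exprn_ge0.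
have -> : 2 = (1 + 1) * 1 :> R by rewrite mulr1.
by rewrite ler_pM ?oneDsqr_ge0 ?exprn_ge0 ?exprn_ile1// lerD2l exprn_ile1.
Qed.

Lemma segment_mean_decaying l f f' x : schwartz f -> cderiv f f' ->
  decaying (fun u => unit_ind u * rc u ^+ l * f (x * u)).
Proof.
move=> Sf df; have mf := schwartz_cmeasurable Sf; split; last first.
  have [K KP] := schwartz_bounded0 Sf.
  by exists (2 * K); exact: segment_mean_decay.
apply: cmeasurableM.
  apply: cmeasurableM; first exact: cmeasurable_unit_ind.
  have := cderiv_Xn l (cderiv_cst (1 : C)).
  by move/cderiv_cmeasurable; under eq_fun do rewrite mulr1.
have := cderiv_affine x 0 df; move/cderiv_cmeasurable.
by under eq_fun do rewrite addr0.
Qed.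

Lemma cderiv_segment_mean l f f' : schwartz f -> cderiv f f' ->
  cderiv (segment_mean l f) (segment_mean l.+1 f').
Proof.
move=> Sf df; have Sf' := schwartz_cderiv Sf df; have [f'' Sf'' df'] := schwartz_derivable Sf'.
have [K KP] := schwartz_bounded0 Sf''; have K0 : 0 <= K := le_trans (cabs_ge0 _) (KP 0).
(* The 4 is the Taylor factor 2 times the bound 2 for 1 + u^2 on the unit segment. *)
apply: cderiv_of_quadratic => x; exists (cintK R * (4 * K)) => d _.
have D1 y := segment_mean_decaying l y Sf df.
have D2 := segment_mean_decaying l.+1 x Sf' df'.
rewrite -cintB// -cintZ// -cintB;
  [|exact: (decayingD (D1 _) (decayingN (D1 _)))|exact: decayingZ].
rewrite -mulrA; apply: cint_le.
  by apply: decayingD; [exact: (decayingD (D1 _) (decayingN (D1 _)))|exact/decayingN/decayingZ].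
move=> u; rewrite /unit_ind; case: ifP => [/andP[u0 u1]|_]; last first.
  rewrite !mul0r mulr0 !subr0 cabs0 mulr0; apply: mulr_ge0; last exact: sqr_ge0.
  exact: mulr_ge0.
have -> : 1 * rc u ^+ l * f ((x + d) * u) - 1 * rc u ^+ l * f (x * u) -
     rc d * (1 * rc u ^+ l.+1 * f' (x * u)) =
  rc u ^+ l * (f (x * u + d * u) - f (x * u) - rc (d * u) * f' (x * u)).
  by rewrite mulrDl rmorphM exprS /=; ring.
rewrite cabsM cabsX cabs_real ger0_norm//.
have h := cderiv_taylor (t := x * u) (d := d * u) df df' (fun c _ => KP c).
have u2 : u ^+ 2 <= 1 by rewrite exprn_ile1.
apply: (@le_trans _ _ (2 * (1 * (2 * K * (d ^+ 2 * 1))))); last by rewrite le_eqVlt; apply/orP;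
  left; apply/eqP; ring.
apply: ler_pM; rewrite ?oneDsqr_ge0 ?mulr_ge0 ?exprn_ge0 ?cabs_ge0//.
  by rewrite (_ : 2 = 1 + 1)// lerD2l.
apply: ler_pM; rewrite ?exprn_ge0 ?cabs_ge0 ?exprn_ile1//.
apply: le_trans h _; rewrite exprMn; apply: ler_wpM2l; first exact: mulr_ge0.
by apply: ler_wpM2l; first exact: sqr_ge0.
Qed.

Lemma segment_mean_quotient f f' : schwartz f -> cderiv f f' ->
  forall x, rc x * segment_mean 0 f' x = f x - f 0.
Proof.
move=> Sf df x; have Sf' := schwartz_cderiv Sf df; have [f'' Sf'' df'] := schwartz_derivable Sf'.
have D := segment_mean_decaying 0 x Sf' df'.
rewrite /segment_mean -cintZ//.
have E u : rc x * (unit_ind u * rc u ^+ 0 * f' (x * u)) =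
    unit_ind u * (rc x * f' (x * u)) by rewrite expr0; ring.
under eq_cint do rewrite E.
have du : cderiv (fun u => f (x * u)) (fun u => rc x * f' (x * u)).
  by apply: eq_cderiv (cderiv_affine x 0 df) => u; rewrite addr0.
have du' : cderiv (fun u => rc x * f' (x * u)) (fun u => rc x * (rc x * f'' (x * u))).
  by apply: eq_cderiv (cderiv_scale (rc x) (cderiv_affine x 0 df')) => u; rewrite addr0.
have [c1 c2] := cderiv_continuous du'.
have i1 := Rintegral_FTC (@ltr01 R) c1 (fun u => (du u).1).
have i2 := Rintegral_FTC (@ltr01 R) c2 (fun u => (du u).2).
apply: complex_eq; rewrite ?cReD ?cImD ?cReN ?cImN /=.
  rewrite mulr1 mulr0 in i1; rewrite -i1 -Rintegral_unit_ind.
  apply: eq_Rintegral => u _; rewrite /unit_ind; case: ifP => _; rewrite ?mul1r ?mul0r//.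
rewrite mulr1 mulr0 in i2; rewrite -i2 -Rintegral_unit_ind.
by apply: eq_Rintegral => u _; rewrite /unit_ind; case: ifP => _; rewrite ?mul1r ?mul0r.
Qed.

(** Leibniz: the derivative of order l + 1 of x h is x h^(l+1) + (l + 1) h^(l). It expresses t times
    a derivative of the quotient without dividing by t again. *)
Lemma quotient_derivatives (F h : nat -> R -> C) :
  (forall l, cderiv (F l) (F l.+1)) -> (forall l, cderiv (h l) (h l.+1)) ->
  mulX (h 0%N) = F 0%N ->
  forall l, mulX (h l.+1) = fun x => F l.+1 x - l.+1%:R * h l x.
Proof.
move=> dF dh X0; elim=> [|l IH].
  have := cderiv_mulX (dh 0%N); rewrite X0 => dX.
  by apply/funext => x; rewrite (cderiv_unique (dF 0%N) dX) mul1r addrC addKr.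
have := cderiv_mulX (dh l.+1); rewrite IH => dX.
have dX' := cderivD (dF l.+1) (cderivN (cderiv_scale l.+1%:R (dh l))).
apply/funext => x; have := congr1 (fun k => k x) (cderiv_unique dX dX').
move=> /(canRL (addKr _)) ->.
by rewrite -[l.+2%:R]natr1; ring.
Qed.

(** The quotient is the mean of f' along segments from 0, which is smooth across 0. Its derivatives
    and all Schwartz functions together span a space stable under multiplication by t, by the
    Leibniz relation, so decay at infinity needs no separate estimate. *)
Lemma hadamard_quotient f : schwartz f -> f 0 = 0 ->
  exists2 g, schwartz g & f = mulX g.
Proof.
move=> Sf f0; pose F l := iter l cD f.
have SF l : schwartz (F l) by elim: l => [//|l IH]; exact: schwartz_cD.
have dF l : cderiv (F l) (F l.+1) by exact: cDP.
pose h l := segment_mean l (F l.+1).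
have dh l : cderiv (h l) (h l.+1) by exact: cderiv_segment_mean.
have X0 : mulX (h 0%N) = f.
  by apply/funext => x; rewrite /mulX (segment_mean_quotient Sf (dF 0%N)) f0 subr0.
have Xh := quotient_derivatives dF dh X0.
exists (h 0%N) => //.
pose G (k : R -> C) := schwartz k \/ exists l, k = h l.
apply: (schwartz_span (G := G)); last by apply: lspan_in; right; exists 0%N.
- move=> k [/schwartz_bounded0//|[l ->]].
  have [K KP] := schwartz_bounded0 (SF l.+1).
  exists (cintK R * (2 * K)) => x; apply: cint_le.
    exact: segment_mean_decaying (SF l.+1) (dF l.+1).
  exact: segment_mean_decay (schwartz_cmeasurable (SF l.+1)) KP.
- move=> k [Sk|[l ->]].
    by have [k' Sk' dk] := schwartz_derivable Sk; exists k' => //; apply: lspan_in; left.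
  by exists (h l.+1) => //; apply: lspan_in; right; exists l.+1.
- move=> k [Sk|[[|l] ->]]; first by apply: lspan_in; left; exact: schwartz_mulX.
    by rewrite X0; apply: lspan_in; left.
  rewrite Xh; have := lspanA 1 (or_introl (SF l.+1) : G (F l.+1))
     (lspanZ (- l.+1%:R) (lspan_in (or_intror (ex_intro _ l erefl) : G (h l)))).
  by rewrite (_ : (fun t => _) = fun x => F l.+1 x - l.+1%:R * h l x)//;
    apply/funext => t; rewrite mul1r mulNr.
Qed.

Lemma hadamard_quotient_at a f : schwartz f -> f a = 0 ->
  exists2 g, schwartz g & f = fun t => rc (t - a) * g t.
Proof.
move=> Sf fa; have [||g Sg gE] := @hadamard_quotient (fun t => f (t + a)).
- exact: schwartz_shift.
- by rewrite add0r.
exists (fun t => g (t + - a)); first exact: schwartz_shift.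
by apply/funext => t; have := congr1 (fun k => k (t - a)) gE; rewrite /= subrK.
Qed.

(* If T commutes with multiplication by the variable then f a = 0 implies (T f) a = 0, so T is
   itself a multiplication operator. *)
Lemma commutes_mulX_id (T : (R -> C) -> R -> C) G :
  (forall f, schwartz f -> schwartz (T f)) ->
  (forall f g, schwartz f -> schwartz g -> T (fun t => f t + g t) = (fun t => T f t + T g t)) ->
  (forall c f, schwartz f -> T (fun t => c * f t) = (fun t => c * T f t)) ->
  (forall f, schwartz f -> T (mulX f) = mulX (T f)) ->
  schwartz G -> (forall t, G t != 0) -> T G = G ->
  forall f, schwartz f -> T f = f.
Proof.
move=> TS TD TZ TX SG G0 TG f Sf; apply/funext => a.
(* The multiple of [G] is chosen to cancel [f] at [a]; the difference is then (t - a) g, and [T]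
   sends it to a function vanishing at [a]. *)
have [||g Sg gE] := @hadamard_quotient_at a (fun t => f t + (- (f a / G a)) * G t).
- by apply: schwartzD => //; exact: schwartzZ.
- by rewrite mulNr divfK// subrr.
have : T (fun t => f t + (- (f a / G a)) * G t) a = 0.
  rewrite gE (_ : (fun t => _) = fun t => mulX g t + (- rc a) * g t); last first.
    by apply/funext => t; rewrite /mulX rmorphB mulrBl mulNr.
  by rewrite TD ?TX ?TZ//; [rewrite /mulX mulNr subrr|exact: schwartz_mulX|exact: schwartzZ].
rewrite TD ?TZ// ?TG; last exact: schwartzZ.
by rewrite mulNr divfK// => /eqP; rewrite subr_eq0 => /eqP.
Qed.

End Hadamard.

(** * Gaussians and their integrals *)

Section Gaussian.
Variable R : realType.
Local Notation C := R[i].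
Local Notation rc := (real_complex R).
Local Notation pi := (@trigo.pi R).
Local Notation schwartz := (@Pilot.Defs.schwartz R).
Implicit Types f g h : R -> C.

Definition gauss (r : R) : R -> C := fun t => rc (expR (- (r * t ^+ 2))).

Lemma cderiv_expR_quad (r : R) :
  cderiv (fun t => rc (expR (r * t ^+ 2))) (fun t => 2 * rc r * rc t * rc (expR (r * t ^+ 2))).
Proof.
move=> t; split; last first.
  have -> : complex.Im (2 * rc r * rc t * rc (expR (r * t ^+ 2))) = 0.
    by rewrite !cImM /=; ring.
  exact: is_derive_cst.
have da : is_derive t 1 (fun t : R => r * t ^+ 2) (2 * r * t).
  apply: (is_derive_eq (is_deriveM (is_derive_cst r t 1)
     (is_deriveM (is_derive_id t 1) (is_derive_id t 1)))).
  by rewrite /GRing.scale/=; ring.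
apply: (is_derive_eq (is_derive1_comp (g := fun t =>
  r * t ^+ 2) (is_derive_expR (r * t ^+ 2)) da)).
by rewrite !cReM !cImM /= /GRing.scale/=; ring.
Qed.

Lemma cderiv_gauss r : cderiv (gauss r) (fun t => - (2 * rc r) * (rc t * gauss r t)).
Proof.
apply: eq_cderiv (cderiv_expR_quad (- r)) => t; rewrite /gauss mulNr//.
by rewrite rmorphN; ring.
Qed.

Lemma gauss_power_bounded r k : 0 < r ->
  exists K, forall t, cabs (rc t ^+ k * gauss r t) <= K.
Proof.
(* For |t| > 1 the estimate y^n <= n! e^y is taken at y = r t^2, and |t|^k <= t^(2 n); the summand 1
   covers |t| <= 1. *)
move=> r0; pose n := k.+1; exists (1 + n`!%:R / r ^+ n) => t.
rewrite cabsM cabsX !cabs_real (ger0_norm (expR_ge0 _)).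
have rn : 0 <= n`!%:R / r ^+ n by rewrite divr_ge0// exprn_ge0// ltW.
have [t1|t1] := leP `|t| 1.
  apply: (@le_trans _ _ 1); last by rewrite lerDl.
  rewrite -[leRHS]mulr1 ler_pM ?exprn_ge0 ?expR_ge0 ?exprn_ile1//.
  by rewrite expR_le1 oppr_le0 mulr_ge0 ?sqr_ge0 ?ltW.
apply: (@le_trans _ _ (n`!%:R / r ^+ n)); last by rewrite lerDr.
have x0 : 0 <= r * t ^+ 2 by rewrite mulr_ge0 ?sqr_ge0// ltW.
rewrite expRN ler_pdivrMr ?expR_gt0//.
have h1 : (r * t ^+ 2) ^+ n <= n`!%:R * expR (r * t ^+ 2).
  rewrite -ler_pdivrMl ?ltr0n ?fact_gt0// mulrC.
  have h0 := @expR_ge1Dxn R (r * t ^+ 2) k x0.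
  by apply: le_trans h0; rewrite lerDr.
rewrite mulrAC ler_pdivlMr ?exprn_gt0//; apply: le_trans h1.
rewrite exprMn [leRHS]mulrC; apply: ler_wpM2r; first by rewrite exprn_ge0// ltW.
rewrite -[t ^+ 2]real_normK ?num_real// -exprM; apply: ler_weXn2l; first exact: ltW.
by rewrite /n; lia.
Qed.

Lemma schwartz_gauss r : 0 < r -> schwartz (gauss r).
Proof.
move=> r0; pose G (h : R -> C) := exists k, h = (fun t => rc t ^+ k * gauss r t).
apply: (schwartz_span (G := G)); last first.
- by apply: lspan_in; exists 0%N; apply/funext => t; rewrite mul1r.
- move=> _ [k ->]; apply: lspan_in; exists k.+1.
  by apply/funext => t; rewrite /mulX exprS mulrA.
- move=> _ [k ->].
  exists (fun t => k%:R * (rc t ^+ k.-1 * gauss r t) + - (2 * rc r) * (rc t ^+ k.+1 * gauss r t)).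
    by apply: lspanD; apply: lspanZ; apply: lspan_in; [exists k.-1|exists k.+1].
  apply: eq_cderiv (cderiv_Xn k (cderiv_gauss r)) => // t.
  by rewrite exprS; ring.
- by move=> _ [k ->]; exact: gauss_power_bounded.
Qed.

Lemma integral_gauss r : 0 < r -> cintegral (gauss r) = rc (Num.sqrt (pi / r)).
Proof.
move=> r0; have s0 : 0 < Num.sqrt (2 * r) by rewrite sqrtr_gt0 mulr_gt0.
(* The standard deviation for which the Gaussian is a multiple of the normal density. *)
pose s := (Num.sqrt (2 * r))^-1.
have sn : s != 0 by rewrite invr_eq0 gt_eqF.
have s2 : s ^+ 2 * 2 = r^-1.
  by rewrite /s exprVn sqr_sqrtr ?mulr_ge0 ?ltW//; field; rewrite gt_eqF.
have := integral_normal_pdf 0 s; rewrite /= => N1.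
have E x : expR (- (r * x ^+ 2)) = Num.sqrt (pi / r) * normal_pdf 0 s x.
  rewrite normal_pdfE// -[RHS]/(Num.sqrt (pi / r) * (normal_peak s * normal_fun 0 s x)).
  rewrite /normal_peak /normal_fun subr0.
  have -> : - x ^+ 2 / (s ^+ 2 *+ 2) = - (r * x ^+ 2).
    by rewrite -mulr_natr s2 invrK mulNr mulrC.
  have -> : s ^+ 2 * pi *+ 2 = pi / r by rewrite -mulr_natr mulrAC s2 mulrC.
  by rewrite mulVKf// gt_eqF// sqrtr_gt0 divr_gt0 ?pi_gt0.
rewrite /cintegral /gauss /=; apply: complex_eq => /=; last first.
  by rewrite (Rintegral_cst _ measurableT) mul0r.
under eq_Rintegral do rewrite E.
rewrite RintegralZl//; last exact: integrable_normal_pdf.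
by rewrite /Rintegral N1 mulr1.
Qed.

Section ComplexGaussian.
Variable r : R.
Hypothesis r0 : 0 < r.

Definition chirp_gauss (y : R) : R -> C := fun x => gauss r x * e_ (y * x ^+ 2).
Definition chirp_int (y : R) : C := cintegral (chirp_gauss y).
(** The complex rate: [chirp_gauss y] is exp(- b x^2). *)
Let b (y : R) : C := rc r - twopii R * rc y.

Lemma schwartz_chirp_gauss y : schwartz (chirp_gauss y).
Proof.
by apply: eq_schwartz (schwartz_e_quad y (schwartz_gauss r0)) => x; rewrite mulrC.
Qed.

Lemma cderiv_chirp_gauss y :
  cderiv (chirp_gauss y) (fun x => - (2 * b y) * (rc x * chirp_gauss y x)).
Proof.
apply: eq_cderiv (cderivM (cderiv_gauss r) (cderiv_e_quad y)) => // x.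
have -> : Complex 0 (4 * pi * y) = 2 * twopii R * rc y.
  by apply: complex_eq; rewrite ?cReM ?cImM /=; ring.
by rewrite /chirp_gauss /b; ring.
Qed.

Lemma chirp_int_by_parts y :
  chirp_int y = 2 * b y * cintegral (fun x => rc (x ^+ 2) * gauss r x * e_ (y * x ^+ 2)).
Proof.
have S := schwartz_chirp_gauss y; have dg := cderiv_chirp_gauss y.
have := cint_deriv (schwartz_mulX S) (cderiv_mulX dg).
rewrite cintD; [|exact: schwartz_decaying|].
  move=> /eqP; rewrite addr_eq0 => /eqP E; rewrite /chirp_int E.
  rewrite -cintN -?cintZ.
  - apply: eq_cint => x; rewrite /mulX /chirp_gauss rmorphXn; ring.
  - apply: schwartz_decaying; apply: eq_schwartz (schwartz_mulX (schwartz_mulX S)) => x.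
    by rewrite /mulX /chirp_gauss rmorphXn; ring.
  - apply: schwartz_decaying; apply: eq_schwartz (schwartzZ (- (2 * b y)) (schwartz_mulX
      (schwartz_mulX S))) => x.
    by rewrite /mulX /chirp_gauss; ring.
apply: schwartz_decaying; apply: eq_schwartz (schwartzZ (- (2 * b y)) (schwartz_mulX
  (schwartz_mulX S))) => x.
by rewrite /mulX /chirp_gauss; ring.
Qed.

Lemma cderiv_chirp_int :
  cderiv chirp_int
    (fun y => twopii R * cintegral (fun x => rc (x ^+ 2) * gauss r x * e_ (y * x ^+ 2))).
Proof.
have SG := schwartz_gauss r0.
have S2 := schwartz_mulX (schwartz_mulX SG).
have [K KP] := schwartz_decay (schwartz_mulX (schwartz_mulX S2)).
have := @cderiv_cint_phase R (fun x => x ^+ 2) (fun=> 0) (gauss r) K.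
have E y x : y * x ^+ 2 + 0 = y * x ^+ 2 :> R by rewrite addr0.
move=> H; apply: eq_cderiv (H _ _ _) => y; rewrite ?/chirp_int.
- by apply: eq_cint => x; rewrite E.
- by congr (_ * _); apply: eq_cint => x; rewrite E.
- apply: schwartz_decaying; apply: eq_schwartz (schwartz_chirp_gauss y) => x.
  by rewrite E.
- apply: schwartz_decaying; apply: eq_schwartz (schwartz_e_quad y S2) => x.
  by rewrite E /mulX rmorphXn /=; ring.
- have -> : rc ((y ^+ 2) ^+ 2) * gauss r y = mulX (mulX (mulX (mulX (gauss r)))) y.
    by rewrite /mulX !rmorphXn; ring.
  exact: KP.
Qed.

(** I^2 b is constant in y, since by parts I' is a constant multiple of I / b; at y = 0 the real
    Gaussian integral gives its value. Squaring avoids choosing a complex square root. *)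
Lemma chirp_int_sqr y : chirp_int y ^+ 2 * b y = rc pi.
Proof.
have db : cderiv b (fun=> - twopii R).
  apply: eq_cderiv (cderivD (cderiv_cst (rc r)) (cderivN (cderiv_scale (twopii R) (@cderiv_id
    R)))) => t //.
  by rewrite add0r mulr1.
have dI := cderiv_chirp_int.
have d0 : cderiv (fun y => chirp_int y * chirp_int y * b y) (fun=> 0).
  apply: eq_cderiv (cderivM (cderivM dI dI) db) => // t.
  by rewrite (chirp_int_by_parts t); ring.
have := cderiv0_cst d0 y 0; rewrite -expr2 => ->.
have -> : chirp_int 0 = rc (Num.sqrt (pi / r)).
  by rewrite -integral_gauss//; apply: eq_cint => x; rewrite /chirp_gauss mul0r e_0 mulr1.
rewrite /b rmorph0 mulr0 subr0 -!rmorphM /=; congr (_%:C)%C.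
by rewrite -expr2 sqr_sqrtr ?divr_ge0 ?pi_ge0 ?ltW// divfK// gt_eqF.
Qed.

(** This fixes the branch of the square root. The real part is positive at y = 0 and never vanishes,
    because a purely imaginary I would give I^2 b a nonpositive real part instead of pi. *)
Lemma Re_chirp_int_gt0 y : 0 < complex.Re (chirp_int y).
Proof.
have nz t : complex.Re (chirp_int t) != 0.
  apply/negP => /eqP; have := chirp_int_sqr t; case: (chirp_int t) => x v + /= x0.
  rewrite x0 /b /twopii => /(congr1 (@complex.Re R)); rewrite /= => h.
  have : - (v ^+ 2) * r = pi by rewrite -h; ring.
  have := mulr_ge0 (sqr_ge0 v) (ltW r0); have := @pi_gt0 R; lra.
have I0 : 0 < complex.Re (chirp_int 0).
  have -> : chirp_int 0 = rc (Num.sqrt (pi / r)).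
    by rewrite -integral_gauss//; apply: eq_cint => x; rewrite /chirp_gauss mul0r e_0 mulr1.
  by rewrite /= sqrtr_gt0 divr_gt0 ?pi_gt0.
have [c _] := cderiv_continuous cderiv_chirp_int.
rewrite ltNge; apply/negP => yle.
have [y0|y0] := leP 0 y.
  have [|x _ /eqP] := @IVT R _ 0 y 0 y0 (continuous_subspaceT c).
    by rewrite ge_min le_max yle (ltW I0) orbT.
  by apply/negP.
have [|x _ /eqP] := @IVT R _ y 0 0 (ltW y0) (continuous_subspaceT c).
  by rewrite ge_min le_max yle (ltW I0) orbT.
by apply/negP.
Qed.

End ComplexGaussian.

End Gaussian.

(** * The order six operator and its square *)

Section OrderSix.
Variable R : realType.
Local Notation C := R[i].
Local Notation rc := (real_complex R).
Local Notation pi := (@trigo.pi R).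
Local Notation schwartz := (@Pilot.Defs.schwartz R).
Local Notation c := (twopii R).
Implicit Types f g h : R -> C.

Let s3 : R := Num.sqrt 3.
Let s3K : s3 ^+ 2 = 3. Proof. by rewrite sqr_sqrtr. Qed.
Let s3_gt0 : 0 < s3. Proof. by rewrite sqrtr_gt0. Qed.
Let r : R := pi * s3 / 2.
Let r_gt0 : 0 < r. Proof. by rewrite divr_gt0// mulr_gt0 ?pi_gt0. Qed.

(* e^(- i pi / 6) *)
Let a : C := Complex (s3 / 2) (- (1 / 2)).

(** The condition under which W maps exp(- pi a t^2) to a multiple of itself. *)
Let a_root : a ^+ 2 + 'i%C * a - 1 = 0.
Proof.
rewrite expr2 /a; apply: complex_eq; rewrite !(cReD, cImD, cReN, cImN, cReM, cImM) /=;
  last by field.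
have := s3K; rewrite expr2 => h; have : s3 / 2 * (s3 / 2) = 3 / 4 by rewrite -h; field.
by move=> ->; field.
Qed.

Let a_cube : a ^+ 3 = - 'i%C.
Proof.
have E : a ^+ 3 + 'i%C = (a ^+ 2 + 'i%C * a - 1) * (a - 'i%C) + ('i%C ^+ 2 + 1) * a.
  by ring.
apply/eqP; rewrite -subr_eq0 opprK E a_root mul0r add0r.
by rewrite sqr_i addNr mul0r.
Qed.

Let a_neq0 : a != 0.
Proof. by rewrite eq_complex /= gt_eqF// divr_gt0. Qed.

Lemma e_twelfth : e_ (1 / 12) = Complex (s3 / 2) (1 / 2) :> C.
Proof.
(* e(1/12) is the cube root x + i y of i with x > 0: the real part of the cube gives x^2 = 3 y^2,
   and modulus 1 then leaves only the signs. *)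
have E : e_ (1 / 12) * (e_ (1 / 12) * e_ (1 / 12)) = 'i%C :> C.
  rewrite -!e_D [LHS]/e_ (_ : 2 * pi * _ = pi / 2); last by field.
  by rewrite cos_pihalf sin_pihalf.
have x0 : 0 < complex.Re (e_ (1 / 12) : C).
  by rewrite /= cos_gt0_pihalf//; have := @pi_gt0 R; move=> p0; apply/andP; split; lra.
have n1 : complex.Re (e_ (1 / 12) : C) ^+ 2 + complex.Im (e_ (1 / 12) : C) ^+ 2 = 1.
  by rewrite -cabs_sqr cabs_e expr1n.
move: E x0 n1; case: (e_ _) => x y /= [E1 E2] x0 n1.
have E3 : x ^+ 2 = 3 * y ^+ 2.
  apply: (mulfI (lt0r_neq0 x0)); apply/eqP; rewrite -subr_eq0; apply/eqP.
  by rewrite -[RHS]E1; ring.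
have y2 : y ^+ 2 = 1 / 4 by lra.
have y1 : y = 1 / 2.
  have : (y - 1 / 2) * (y + 1 / 2) = 0 by rewrite -[RHS](subrr (1 / 4)) -{1}y2; field.
  move=> /eqP; rewrite mulf_eq0 => /orP[/eqP h|/eqP h]; first by lra.
  have yE : y = - (1 / 2) by lra.
  by move: E2; rewrite yE; nra.
congr Complex => //; have x2 : x ^+ 2 = (s3 / 2) ^+ 2.
  by rewrite E3 y2 exprMn s3K; field.
have : (x - s3 / 2) * (x + s3 / 2) = 0 by rewrite -[RHS](subrr ((s3 / 2) ^+ 2)) -{1}x2; ring.
move=> /eqP; rewrite mulf_eq0 => /orP[/eqP h|/eqP h]; first by lra.
by have := divr_gt0 s3_gt0 (@ltr0n R 2); lra.
Qed.

(** This is exp(- pi a t^2); its value 1 at 0 is what singles it out among the solutions of its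
    differential equation. *)
Definition fixed_gauss : R -> C := chirp_gauss r (1 / 4).
Local Notation G := fixed_gauss.

Lemma schwartz_fixed_gauss : schwartz G.
Proof. exact: schwartz_chirp_gauss. Qed.

Lemma fixed_gauss_neq0 t : G t != 0.
Proof.
rewrite /fixed_gauss /chirp_gauss mulf_neq0 ?e_neq0// /gauss.
by rewrite fmorph_eq0 expR_eq0.
Qed.

Lemma fixed_gauss0 : G 0 = 1.
Proof. by rewrite /fixed_gauss /chirp_gauss /gauss expr0n /= !mulr0 oppr0 expR0 e_0 mulr1. Qed.

Let k : C := - (2 * rc pi * a).

Let kE : k = c / a ^+ 2.
Proof.
apply: (mulIf (expf_neq0 2 a_neq0)); rewrite divfK ?expf_neq0//.
have -> : k * a ^+ 2 = - (2 * rc pi) * a ^+ 3 by rewrite /k; ring.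
by rewrite a_cube /twopii; apply: complex_eq; rewrite !(cReN, cImN, cReM, cImM) /=; ring.
Qed.

Lemma cderiv_fixed_gauss : cderiv G (fun t => k * mulX G t).
Proof.
apply: eq_cderiv (cderiv_chirp_gauss r (1 / 4)) => // t.
rewrite /mulX /fixed_gauss mulrA mulrA; congr (_ * _ * _).
by rewrite /k /a /r /twopii; apply: complex_eq;
  rewrite !(cReD, cImD, cReN, cImN, cReM, cImM) /=; field.
Qed.

(** The product of [f] with the reciprocal Gaussian has derivative zero. W G is thereby identified
    by a differential equation and one value. *)
Lemma gauss_ode f : cderiv f (fun t => k * mulX f t) -> f = fun t => f 0 * G t.
Proof.
move=> df.
pose Gi t : C := rc (expR (r * t ^+ 2)) * e_ (- (1 / 4) * t ^+ 2).
have GGi t : G t * Gi t = 1.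
  rewrite /fixed_gauss /chirp_gauss /gauss /Gi mulrACA -rmorphM -expRD addNr expR0.
  by rewrite -e_D mulNr subrr e_0 mulr1.
have dGi : cderiv Gi (fun t => - k * rc t * Gi t).
  apply: eq_cderiv (cderivM (cderiv_expR_quad r) (cderiv_e_quad (- (1 / 4)))) => // t.
  rewrite /Gi; set A := rc (expR _); set B := e_ _.
  have -> : Complex 0 (4 * pi * - (1 / 4)) = - k - 2 * rc r.
    by rewrite /k /a /r; apply: complex_eq; rewrite !(cReD, cImD, cReN, cImN, cReM, cImM) /=;
      field.
  by ring.
have d0 : cderiv (fun t => f t * Gi t) (fun=> 0).
  by apply: eq_cderiv (cderivM df dGi) => // t; rewrite /mulX; ring.
apply/funext => t; have := cderiv0_cst d0 t 0.
have Gi0 : Gi 0 = 1 by have := GGi 0; rewrite fixed_gauss0 mul1r.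
by rewrite Gi0 mulr1 => <-; rewrite -mulrA [Gi t * _]mulrC GGi mulr1.
Qed.

(** Here the constant i^(1/6) enters: the Gaussian integral squares to e(-1/12), so the product is 1
    or -1, and the positive real part excludes -1. *)
Let chirp_value : e_ (1 / 24) * chirp_int r (- (1 / 4)) = 1.
Proof.
set z := _ * _; have z2 : z ^+ 2 = 1.
  have := chirp_int_sqr r_gt0 (- (1 / 4)); set I := chirp_int _ _ => E.
  have bE : rc r - c * rc (- (1 / 4)) = rc pi * e_ (1 / 12).
    rewrite e_twelfth /r /twopii; apply: complex_eq;
      rewrite !(cReD, cImD, cReN, cImN, cReM, cImM) /=; by field.
  have p0 : rc pi != 0 by rewrite fmorph_eq0 gt_eqF ?pi_gt0.
  have : rc pi * z ^+ 2 = rc pi * 1; last by move/(mulfI p0).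
  rewrite mulr1 -[RHS]E bE /z exprMn -/I.
  have -> : e_ (1 / 24) ^+ 2 = e_ (1 / 12) :> C by rewrite expr2 -e_D; congr e_; field.
  by ring.
have E0 : (z - 1) * (z + 1) = z ^+ 2 - 1 by ring.
have : (z - 1) * (z + 1) = 0 by rewrite E0 z2 subrr.
move=> /eqP; rewrite mulf_eq0 subr_eq0 addr_eq0 => /orP[/eqP//|/eqP zE].
have IE : chirp_int r (- (1 / 4)) = - e_ (- (1 / 24)).
  by rewrite e_N -[LHS](mulKf (e_neq0 (1 / 24))) -/z zE mulrN1.
have := Re_chirp_int_gt0 r_gt0 (- (1 / 4)); rewrite IE cReN /=.
have : 0 < cos (2 * pi * - (1 / 24)).
  by apply: cos_gt0_pihalf; have p0 := @pi_gt0 R; apply/andP; split; lra.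
by move=> h1; rewrite oppr_gt0 => h2; have := lt_trans h1 h2; rewrite ltxx.
Qed.

Let a_fourth : a ^+ 4 = a ^+ 2 - 1.
Proof.
have := a_root; have -> : a ^+ 4 = a * a ^+ 3 by ring.
rewrite a_cube => h; apply/eqP; rewrite -subr_eq0; apply/eqP; rewrite -[RHS]oppr0 -h.
by ring.
Qed.

Lemma cint_conj f : decaying f -> cintegral (fun x => Num.conj (f x)) = Num.conj (cintegral f).
Proof.
move=> df; rewrite /cintegral; apply: complex_eq.
  by apply: eq_Rintegral => x _; case: (f x).
rewrite [RHS]/= -mulN1r -RintegralZl//; last exact: decaying_Im.
by apply: eq_Rintegral => x _; rewrite mulN1r; case: (f x).
Qed.

Lemma opW_fixed_gauss : opW G = G.
Proof.
have SG := schwartz_fixed_gauss; have dG := cderiv_fixed_gauss.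
have a2 : a ^+ 2 != 0 by rewrite expf_neq0.
have c0 := twopii_neq0 R.
(* W G satisfies the differential equation of G: applying W to G' = k t G relates x = W(t G) and y =
   t (W G), and a^4 = a^2 - 1 solves this relation. *)
have dH : cderiv (opW G) (fun t => k * mulX (opW G) t).
  apply: eq_cderiv (opW_mulX SG) => // t.
  have := congr1 (fun h => h t) (opW_deriv SG dG); rewrite opWZ; last exact: schwartz_mulX.
  rewrite kE; set x := opW (mulX _) t; set y := mulX _ t => h.
  have yE : y = x - x / a ^+ 2.
    by apply: (mulfI c0); rewrite mulrBr -[c * y](subKr (c * x)) -h; field.
  have xE : a ^+ 4 * x = a ^+ 2 * x - x by rewrite a_fourth; ring.
  by rewrite yE; apply: (mulfI (expf_neq0 4 a_neq0)); rewrite mulrCA xE; field.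
rewrite (gauss_ode dH).
have -> : opW G 0 = 1.
  rewrite opWE /fresnel -chirp_value; congr (_ * _); apply: eq_cint => x.
  by rewrite /fixed_gauss /chirp_gauss -mulrA -e_D; congr (_ * e_ _); field.
by apply/funext => t; rewrite mul1r.
Qed.

Lemma opW2_fixed_gauss : opW2 G = G.
Proof.
have SG := schwartz_fixed_gauss; have dG := cderiv_fixed_gauss.
have a2 : a ^+ 2 != 0 by rewrite expf_neq0.
have c0 := twopii_neq0 R.
have dH : cderiv (opW2 G) (fun t => k * mulX (opW2 G) t).
  apply: eq_cderiv (opW2_mulX SG) => // t.
  have := congr1 (fun h => h t) (opW2_deriv SG dG); rewrite opW2Z; last exact: schwartz_mulX.
  rewrite kE; set z := opW2 (mulX _) t; set y := mulX _ t => h.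
  have zE : z = - (a ^+ 2 * y).
    by apply: (mulfI c0); apply: (mulIf (invr_neq0 a2)); rewrite mulrAC h; field.
  have yE : a ^+ 4 * y = a ^+ 2 * y - y by rewrite a_fourth; ring.
  rewrite zE; apply: (mulfI a2).
  transitivity (c * (a ^+ 2 * y - a ^+ 4 * y)); first by ring.
  by rewrite yE; field.
rewrite (gauss_ode dH).
have -> : opW2 G 0 = 1.
  (* The value at 0 is e(-1/24) times the integral of G, the complex conjugate of the constant
     computed for W. *)
  have : Num.conj (e_ (1 / 24) * chirp_int r (- (1 / 4))) = 1 by rewrite chirp_value rmorph1.
  rewrite rmorphM /= => <-; rewrite -[X in _ = X * _]/(Num.conj (e_ (1 / 24))) e_conj.
  rewrite opW2E /fresnel expr0n mulr0 e_0 [1 * cintegral _]mul1r -cint_conj; last first.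
    exact/schwartz_decaying/schwartz_chirp_gauss.
  congr (_ * _). apply: eq_cint => x.
  rewrite mul0r mul0r addr0 e_0 mulr1 /fixed_gauss /chirp_gauss rmorphM /=.
  rewrite -[X in _ = _ * X]/(Num.conj (e_ (- (1 / 4) * x ^+ 2))) e_conj mulNr opprK.
  by congr (_ * _); rewrite /gauss /=; apply: complex_eq => //=; rewrite oppr0.
by apply/funext => t; rewrite mul1r.
Qed.

Lemma opW_opp f : schwartz f -> opW (fun t => - f t) = fun t => - opW f t.
Proof.
move=> Sf; rewrite (_ : (fun t => - f t) = fun t => (-1) * f t).
  by rewrite opWZ//; apply/funext => t; rewrite mulN1r.
by apply/funext => t; rewrite mulN1r.
Qed.

Lemma opW_sub f g : schwartz f -> schwartz g ->
  opW (fun t => f t - g t) = (fun t => opW f t - opW g t).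
Proof.
by move=> Sf Sg; rewrite (opWD Sf (schwartzN Sg)) opW_opp.
Qed.

(** The momentum operator. Conjugation by W acts on ([mulX], [P]) by an integer matrix of order six,
    with P W = W X and X W = W (X - P) for X = [mulX]; hence W^3 reverses the sign of X. *)
Let P f : R -> C := fun t => c^-1 * cD f t.

Let SP f : schwartz f -> schwartz (P f).
Proof. by move=> Sf; apply/schwartzZ/schwartz_cD. Qed.

Let P_opW f : schwartz f -> P (opW f) = opW (mulX f).
Proof.
move=> Sf; apply/funext => t.
rewrite /P (cderiv_unique (cDP (schwartz_opW Sf)) (opW_mulX Sf)) mulKf//.
exact: twopii_neq0.
Qed.

Let X_opW f : schwartz f -> mulX (opW f) = opW (fun t => mulX f t - P f t).
Proof.
move=> Sf; rewrite opW_sub; [|exact: schwartz_mulX|exact: SP].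
rewrite /P opWZ; last exact: schwartz_cD.
rewrite (opW_deriv Sf (cDP Sf)); apply/funext => t; rewrite -mulrBr mulKf;
  last exact: twopii_neq0.
by rewrite opprB addrC subrK.
Qed.

Let X_opW2 f : schwartz f -> mulX (opW2 f) = opW2 (fun t => - P f t).
Proof.
move=> Sf; apply/funext => t.
have -> : (fun t => - P f t) = (fun t => (- c^-1) * cD f t).
  by apply/funext => u; rewrite /P mulNr.
rewrite opW2Z; last exact: schwartz_cD.
rewrite (opW2_deriv Sf (cDP Sf)); set y := mulX _ t.
by field; exact: twopii_neq0.
Qed.

Let PX f : schwartz f -> P (opW (opW f)) = opW (opW (fun t => mulX f t - P f t)).
Proof. by move=> Sf; rewrite P_opW ?X_opW//; exact: schwartz_opW. Qed.

Let XX f : schwartz f -> mulX (opW (opW f)) = opW (opW (fun t => - P f t)).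
Proof.
move=> Sf; have SW := schwartz_opW Sf.
rewrite X_opW// P_opW// X_opW// -opW_sub; last exact: schwartz_mulX.
  by congr (opW (opW _)); apply/funext => t; ring.
by apply: schwartzB; [exact: schwartz_mulX|exact: SP].
Qed.

Definition opWn n : (R -> C) -> R -> C := iter n (@opW R).

Lemma schwartz_opWn n f : schwartz f -> schwartz (opWn n f).
Proof. by move=> Sf; elim: n => [//|n IH]; exact: schwartz_opW. Qed.

Lemma opWnD n f g : schwartz f -> schwartz g ->
  opWn n (fun t => f t + g t) = (fun t => opWn n f t + opWn n g t).
Proof.
by move=> Sf Sg; elim: n => [//|n IH]; rewrite /= IH opWD//; exact: schwartz_opWn.
Qed.

Lemma opWnZ n q f : schwartz f -> opWn n (fun t => q * f t) = (fun t => q * opWn n f t).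
Proof.
by move=> Sf; elim: n => [//|n IH]; rewrite /= IH opWZ//; exact: schwartz_opWn.
Qed.

Lemma opWn_opp n f : schwartz f -> opWn n (fun t => - f t) = (fun t => - opWn n f t).
Proof.
by move=> Sf; elim: n => [//|n IH]; rewrite /= IH opW_opp//; exact: schwartz_opWn.
Qed.

Lemma opWn_add m n f : opWn (m + n) f = opWn m (opWn n f).
Proof. exact: iterD. Qed.

Let X3 f : schwartz f -> mulX (opWn 3 f) = opWn 3 (fun t => - mulX f t).
Proof.
move=> Sf; have SW := schwartz_opW Sf.
have E : (fun t => - P (opW f) t) = opW (fun t => - mulX f t).
  by rewrite (P_opW Sf) opW_opp//; exact: schwartz_mulX.
by have := XX SW; rewrite E.
Qed.

Lemma opW6 f : schwartz f -> opWn 6 f = f.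
Proof.
move: f; apply: (@commutes_mulX_id R (opWn 6) G).
- by move=> f; exact: schwartz_opWn.
- by move=> f g; exact: opWnD.
- by move=> q f; exact: opWnZ.
- move=> f Sf; rewrite (opWn_add 3 3) (opWn_add 3 3) X3; last exact: schwartz_opWn.
  congr (opWn 3 _); rewrite (X3 Sf) opWn_opp; last exact: schwartz_mulX.
  by apply/funext => t; rewrite opprK.
- exact: schwartz_fixed_gauss.
- exact: fixed_gauss_neq0.
- by rewrite /opWn /= !opW_fixed_gauss.
Qed.

Let P4 g : schwartz g -> P (opWn 4 g) = opWn 4 (fun t => - mulX g t).
Proof.
move=> Sg; have S2 := schwartz_opWn 2 Sg.
rewrite (opWn_add 2 2) [LHS](PX S2) (opWn_add 2 2); congr (opW (opW _)).
rewrite -[opWn 2 g]/(opW (opW g)) (XX Sg) (PX Sg).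
have SX := schwartz_mulX Sg; have SPg := SP Sg.
rewrite -opW_sub; [|exact/schwartz_opW/schwartzN|exact/schwartz_opW/schwartzB].
rewrite -opW_sub; [|exact/schwartzN|exact/schwartzB].
by congr (opW (opW _)); apply/funext => t; ring.
Qed.

(** The double integral is not evaluated: [opW2] composed with W^4 commutes with [mulX] and fixes
    the Gaussian, so it is the identity; at W^2 f it gives the claim by W^6 = 1. *)
Lemma opW_opW f : schwartz f -> opW (opW f) = opW2 f.
Proof.
pose T g := opW2 (opWn 4 g).
have TE : forall g, schwartz g -> T g = g.
  apply: (@commutes_mulX_id R T G).
  - by move=> g Sg; exact/schwartz_opW2/schwartz_opWn.
  - by move=> g h Sg Sh; rewrite /T opWnD// opW2D//; exact: schwartz_opWn.
  - by move=> q g Sg; rewrite /T opWnZ// opW2Z//; exact: schwartz_opWn.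
  - move=> g Sg; rewrite /T X_opW2; last exact: schwartz_opWn.
    congr (opW2 _); rewrite (P4 Sg) opWn_opp; last exact: schwartz_mulX.
    by apply/funext => t; rewrite opprK.
  - exact: schwartz_fixed_gauss.
  - exact: fixed_gauss_neq0.
  - by rewrite /T /opWn /= !opW_fixed_gauss opW2_fixed_gauss.
move=> Sf; have := TE _ (schwartz_opWn 2 Sf).
by rewrite /T -opWn_add opW6.
Qed.

End OrderSix.

(** * Poisson summation *)

Section SmoothStep.
Variable R : realType.
Local Notation C := R[i].
Local Notation rc := (real_complex R).
Local Notation schwartz := (@Pilot.Defs.schwartz R).
Implicit Types f g h : R -> C.

Lemma is_derive_inv (w : R -> R) (x dw : R) : w x != 0 -> is_derive x 1 w dw ->
  is_derive x 1 (fun y => (w y)^-1) (- dw * (w x)^-1 ^+ 2).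
Proof.
move=> w0 [ex vl]; have dv := @deriveV R R w x 1 w0 ex.
apply: DeriveDef; first exact: (@derivableV R R w x 1 w0 ex).
by rewrite dv vl /GRing.scale/= exprVn; ring.
Qed.

Variable d : R.
Hypothesis d_gt0 : 0 < d.

Let v (x : R) := (x * (d - x))^-1.

(** The factor v^k makes the family closed under differentiation up to polynomial coefficients;
    [bump 0] is a smooth bump on ]0, d[. *)
Let bump (k : nat) (x : R) : R := if 0 < x < d then v x ^+ k * expR (- v x) else 0.

Let v_gt0 x : 0 < x < d -> 0 < v x.
Proof. by move=> /andP[x0 xd]; rewrite invr_gt0 mulr_gt0// subr_gt0. Qed.

Lemma pow_expR_le k (y : R) : 0 <= y -> y ^+ k * expR (- y) <= k`!%:R.
Proof.
move=> y0; rewrite expRN ler_pdivrMr ?expR_gt0//.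
case: k => [|k]; first by rewrite expr0 fact0 mul1r -[leLHS]expR0 ler_expR.
rewrite -ler_pdivrMl ?ltr0n ?fact_gt0// mulrC.
have h0 := @expR_ge1Dxn R y k y0.
by apply: le_trans h0; rewrite lerDr.
Qed.

Let bump_ge0 k x : 0 <= bump k x.
Proof.
rewrite /bump; case: ifP => // /v_gt0 h.
by rewrite mulr_ge0 ?expR_ge0// exprn_ge0// ltW.
Qed.

Let bump_le k x : bump k x <= k`!%:R.
Proof. by rewrite /bump; case: ifP => // /v_gt0/ltW/pow_expR_le. Qed.

(** Two spare powers of v give quadratic vanishing at both ends of the interval, so the derivative
    there is 0 by the quadratic criterion. *)
Let bump_flat k x : bump k x <= (k.+2)`!%:R * (x * (d - x)) ^+ 2.
Proof.
rewrite /bump; case: ifP => [h|_]; last by rewrite mulr_ge0 ?sqr_ge0.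
have := pow_expR_le k.+2 (ltW (v_gt0 h)); set w := x * (d - x).
have w0 : 0 < w by rewrite -invr_gt0; exact: v_gt0.
rewrite -addn2 exprD -mulrA [v x ^+ 2 * _]mulrC mulrA -[X in _ * X <= _]invrK.
by rewrite ler_pdivrMr ?invr_gt0 ?exprn_gt0 ?v_gt0// /v -exprVn invrK.
Qed.

Let is_derive_bump k (x : R) :
  is_derive x 1 (bump k) ((2 * x - d) * (k%:R * bump k.+1 x - bump k.+2 x)).
Proof.
have [xin|xout] := boolP (0 < x < d); last first.
  have E j : bump j x = 0 by rewrite /bump (negbTE xout).
  rewrite !E mulr0 subr0 mulr0.
  apply: (@is_derive_of_quadratic R _ _ _ ((k.+2)`!%:R * d ^+ 2)) => t _.
  rewrite E mulr0 !subr0 ger0_norm//.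
  have [h|h] := boolP (0 < x + t < d); last first.
    by rewrite /bump (negbTE h) mulr_ge0 ?sqr_ge0// mulr_ge0 ?sqr_ge0.
  apply: le_trans (bump_flat _ _) _; rewrite -mulrA ler_wpM2l// -exprMn.
  have /andP[h1 h2] := h.
  have w0 : 0 <= (x + t) * (d - (x + t)) by rewrite ltW// mulr_gt0// subr_gt0.
  rewrite -[(d * t) ^+ 2]real_normK ?num_real// lerXn2r ?nnegrE//.
  rewrite normrM (gtr0_norm d_gt0).
  move: xout; rewrite negb_and -!leNgt => /orP[x0|xd].
    have := ler_norm t; nra.
  have := ler_norm (- t); rewrite normrN; nra.
pose F (y : R) := v y ^+ k * expR (- v y).
have w0 : x * (d - x) != 0 by move/v_gt0: xin; rewrite invr_gt0 => /lt0r_neq0.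
have dw : is_derive x 1 (fun y : R => y * (d - y)) (d - 2 * x).
  apply: (is_derive_eq (is_deriveM (is_derive_id x 1) (is_deriveB (is_derive_cst d x 1)
    (is_derive_id x 1)))).
  by rewrite /GRing.scale/= !fctE /=; ring.
have dv : is_derive x 1 v ((2 * x - d) * v x ^+ 2).
  have := @is_derive_inv _ x _ w0 dw; rewrite -/v.
  by rewrite opprB.
have dF : is_derive x 1 F ((2 * x - d) * (k%:R * (v x ^+ k.+1 * expR (- v x)) - v x ^+ k.+2 *
  expR (- v x))).
  have dvk : is_derive x 1 (fun y => v y ^+ k) (k%:R * v x ^+ k.-1 * ((2 * x - d) * v x ^+ 2)).
    have := is_deriveX k dv; rewrite (_ : v ^+ k = fun y => v y ^+ k) //.
    by apply/funext => y; rewrite exprfctE.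
  apply: (is_derive_eq (is_deriveM dvk (is_derive1_comp (g := fun y =>
    - v y) (is_derive_expR (- v x)) (is_deriveN dv)))).
  rewrite /GRing.scale/=; clear; case: k => [|k] /=; rewrite ?expr0 ?exprS; ring.
have Ek j : bump j x = v x ^+ j * expR (- v x) by rewrite /bump xin.
have nE : {near x, F =1 bump k}.
  have : \forall y \near x, y \in `]0, d[ by apply: near_in_itvoo; rewrite in_itv.
  by apply: filterS => y; rewrite in_itv/= => yin; rewrite /F /bump yin.
by rewrite !Ek; exact: near_eq_is_derive nE dF.
Qed.

Let B j k : R -> C := fun x => rc x ^+ j * rc (bump k x).

Let cderiv_bump k : cderiv (fun x => rc (bump k x))
  (fun x => (2 * rc x - rc d) * (k%:R * rc (bump k.+1 x) - rc (bump k.+2 x))).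
Proof.
move=> x; split => /=; last first.
  by apply: (is_derive_eq (is_derive_cst 0 x 1));
    rewrite -!(rmorph_nat rc) !(cImM, cImD, cImN, cReM, cReD, cReN) /=; ring.
apply: (is_derive_eq (is_derive_bump k x)).
by rewrite -!(rmorph_nat rc) !(cReM, cReD, cReN, cImM, cImD, cImN) /=; ring.
Qed.

Let schwartz_bump : schwartz (fun x => rc (bump 0 x)).
Proof.
pose G (h : R -> C) := exists j k, h = B j k.
have GB j k : lspan G (B j k) by apply: lspan_in; exists j, k.
apply: (schwartz_span (G := G)); last first.
- rewrite (_ : (fun x => _) = B 0 0)//.
  by apply/funext => x; rewrite /B mul1r.
- move=> _ [j [k ->]]; rewrite (_ : mulX _ = B j.+1 k)//.
  by apply/funext => x; rewrite /mulX /B exprS mulrA.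
- move=> _ [j [k ->]].
  exists (fun x => j%:R * B j.-1 k x + (2 * k%:R * B j.+1 k.+1 x + (- (rc d * k%:R) * B j k.+1 x +
      (- 2 * B j.+1 k.+2 x + rc d * B j k.+2 x)))).
    by do 4 (apply: lspanD; first exact: lspanZ); exact: lspanZ.
  apply: eq_cderiv (cderiv_Xn j (cderiv_bump k)) => // x.
  by rewrite /B !exprS; ring.
- move=> _ [j [k ->]]; exists (d ^+ j * k`!%:R) => x.
  rewrite /B cabsM cabsX !cabs_real (ger0_norm (bump_ge0 _ _)).
  have [xin|xout] := boolP (0 < x < d).
    have /andP[x0 xd] := xin.
    apply: ler_pM; rewrite ?exprn_ge0 ?bump_ge0 ?bump_le//.
    by rewrite lerXn2r ?nnegrE ?(ltW d_gt0)// gtr0_norm// ltW.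
  by rewrite /bump (negbTE xout) mulr0 mulr_ge0 ?exprn_ge0 ?(ltW d_gt0).
Qed.

Lemma smooth_step : exists s b : R -> C, [/\ schwartz b, cderiv s b,
  forall t, t <= 0 -> s t = 0, forall t, d <= t -> s t = 1 & cintegral b = 1].
Proof.
pose b0 : R -> C := fun x => rc (bump 0 x).
have Sb : schwartz b0 by exact: schwartz_bump.
have [b0' Sb' db] := schwartz_derivable Sb.
have b0_out x : ~~ (0 < x < d) -> b0 x = 0 by rewrite /b0 /bump => /negbTE ->.
(* x times the mean of b0 over the segment from 0 to x is the primitive of b0, and the derivatives
   of such means are already known. *)
pose s0 x := rc x * segment_mean 0 b0 x.
have ds0 : cderiv s0 b0.
  have dX := cderiv_mulX db.
  (* The terms of the product rule for [s0] combine into the mean of (x b0)', which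
     [segment_mean_quotient] evaluates to b0 away from 0. *)
  have E : forall x, segment_mean 0 (fun t => b0 t + mulX b0' t) x =
      segment_mean 0 b0 x + rc x * segment_mean 1 b0' x.
    move=> x; rewrite /segment_mean -cintZ; last first.
      by have [b0'' _ db'] := schwartz_derivable Sb'; exact: segment_mean_decaying db'.
    rewrite -cintD; last 2 first.
    - exact: segment_mean_decaying db.
    - apply: decayingZ.
      by have [b0'' _ db'] := schwartz_derivable Sb'; exact: segment_mean_decaying db'.
    by apply: eq_cint => u; rewrite /mulX rmorphM /= expr0 expr1; ring.
  apply: eq_cderiv (cderivM (@cderiv_id R) (cderiv_segment_mean 0 Sb db)) => // x.
  rewrite mul1r -E.
  have [->|x0] := eqVneq x 0.
    rewrite b0_out ?ltxx//; rewrite -[RHS]cint0 /segment_mean; apply: eq_cint => u.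
    by rewrite mul0r /mulX rmorph0 mul0r addr0 b0_out ?ltxx// mulr0.
  have x0' : rc x != 0 by rewrite fmorph_eq0.
  apply: (mulfI x0'); rewrite (segment_mean_quotient (schwartz_mulX Sb) dX).
  by rewrite /mulX rmorph0 mul0r subr0.
have s0_le0 t : t <= 0 -> s0 t = 0.
  move=> t0; rewrite /s0 /segment_mean (_ : cintegral _ = 0) ?mulr0//.
  rewrite -[RHS]cint0; apply: eq_cint => u; rewrite /unit_ind.
  case: ifP => [/andP[u0 _]|_]; last by rewrite !mul0r.
  by rewrite b0_out ?mulr0//; rewrite negb_and -leNgt (mulr_le0_ge0 t0 u0).
have s0_ged t : d <= t -> s0 t = s0 d.
  move=> td; have b0c c : `|c - t| <= `|d - t| -> b0 c = 0.
    rewrite [leRHS]distrC [leRHS]ger0_norm ?subr_ge0// ler_norml => /andP[h _].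
    apply: b0_out; rewrite negb_and -!leNgt; apply/orP; right; lra.
  have [c1 h1] := mvt_everywhere (fun x => (ds0 x).1) t d.
  have [c2 h2] := mvt_everywhere (fun x => (ds0 x).2) t d.
  rewrite (b0c _ h1) (b0c _ h2) !mul0r => /eqP; rewrite subr_eq0 => /eqP e2 /eqP;
    rewrite subr_eq0 => /eqP e1.
  by apply: complex_eq; [exact: esym e1|exact: esym e2].
pose c0 := complex.Re (s0 d).
have c0_gt0 : 0 < c0.
  have [cR _] := cderiv_continuous ds0.
  have [||c] := @MVT R (fun t => complex.Re (s0 t)) (fun t => complex.Re (b0 t)) 0 d d_gt0.
  - by move=> x _; case: (ds0 x).
  - exact: continuous_subspaceT.
  move=> cin; rewrite (s0_le0 _ (lexx 0)) !subr0 => E; move: cin; rewrite in_itv/= => cin.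
  by rewrite /c0 E mulr_gt0// /b0 /bump cin /= mul1r expR_gt0.
have s0d : s0 d = rc c0.
  apply: complex_eq => //=.
  have [c _] := mvt_everywhere (fun x => (ds0 x).2) 0 d.
  by rewrite (s0_le0 0)// mul0r subr0.
have c0n : rc c0 != 0 by rewrite fmorph_eq0 gt_eqF.
exists (fun t => (rc c0)^-1 * s0 t), (fun t => (rc c0)^-1 * b0 t); split.
- exact: schwartzZ.
- exact: cderiv_scale.
- by move=> t /s0_le0 ->; rewrite mulr0.
- by move=> t /s0_ged ->; rewrite s0d mulVf.
rewrite cintZ; last exact: schwartz_decaying.
suff -> : cintegral b0 = rc c0 by rewrite mulVf.
have [cR _] := cderiv_continuous db.
have := Rintegral_FTC d_gt0 cR (fun u => (ds0 u).1); rewrite (s0_le0 0)// subr0 => E.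
rewrite /cintegral /=; apply: complex_eq => /=;
  last by rewrite (Rintegral_cst _ measurableT) mul0r.
rewrite /c0 -E [RHS]Rintegral_mkcond; apply: eq_Rintegral => x _.
rewrite patchE mem_setE in_itv /=; case: ifP => // h.
by rewrite /bump; case: ifP => // /andP[h1 h2]; move: h; rewrite (ltW h1) (ltW h2).
Qed.

End SmoothStep.

(** * Plateaus, oscillatory integrals and Poisson summation *)

Section Poisson.
Variable R : realType.
Local Notation C := R[i].
Local Notation rc := (real_complex R).
Local Notation pi := (@trigo.pi R).
Local Notation schwartz := (@Pilot.Defs.schwartz R).
Local Notation mu := (@lebesgue_measure R).
Implicit Types f g h : R -> C.

Section Plateau.
Variables (s b : R -> C) (d w : R).
Hypotheses (Sb : schwartz b) (sb : cderiv s b) (s0 : forall t, t <= 0 -> s t = 0)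
  (s1 : forall t, d <= t -> s t = 1) (b1 : cintegral b = 1) (d0 : 0 < d) (w0 : 0 < w).

(** Supported in [0, d + w] and equal to 1 on [d, w]. Its translates by multiples of w telescope,
    which gives partitions of unity without any division. *)
Definition plateau (t : R) := s t - s (t - w).

Lemma cderiv_plateau : cderiv plateau (fun t => b t - b (t - w)).
Proof. by apply: cderivD; [exact: sb|exact/cderivN/cderiv_shift]. Qed.

Lemma plateau_left t : t <= 0 -> plateau t = 0.
Proof.
move=> t0; have t1 : t - w <= 0 by move: w0; lra.
by rewrite /plateau !s0// subrr.
Qed.

Lemma plateau_right t : d + w <= t -> plateau t = 0.
Proof.
move=> t0; have t1 : d <= t by move: w0; lra.
have t2 : d <= t - w by lra.
by rewrite /plateau !s1// subrr.
Qed.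

Lemma plateau_mid t : d <= t -> t <= w -> plateau t = 1.
Proof. by move=> t1 t2; rewrite /plateau s1// s0 ?subr0//; lra. Qed.

Lemma schwartz_plateau : schwartz plateau.
Proof.
apply: (@schwartz_compact_support R (d + w) _ _ _ cderiv_plateau).
  move=> t; have [t0|t0] := leP t 0; first by rewrite plateau_left.
  by rewrite gtr0_norm// => /ltW/plateau_right.
by apply: schwartzB => //; exact: (schwartz_shift (- w)).
Qed.

Lemma cint_plateau : cintegral plateau = rc w.
Proof.
have Sp := schwartz_plateau.
have Sbw : schwartz (fun t => b (t - w)) by exact: (schwartz_shift (- w)).
have := cint_deriv (schwartz_mulX Sp) (cderiv_mulX cderiv_plateau).
rewrite cintD; [|exact: schwartz_decaying|exact/schwartz_decaying/schwartz_mulX/schwartzB].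
move=> /eqP; rewrite addr_eq0 => /eqP ->.
rewrite (_ : mulX _ = fun t => mulX b t - (mulX b (t - w) + rc w * b (t - w))); last first.
  by apply/funext => t; rewrite /mulX rmorphB /=; ring.
have S2 : schwartz (fun t => mulX b (t - w)) by exact: (schwartz_shift (- w) (schwartz_mulX Sb)).
rewrite cintB; [|exact/schwartz_decaying/schwartz_mulX|exact/schwartz_decaying/schwartzD/schwartzZ].
rewrite cintD; [|exact/schwartz_decaying|exact/schwartz_decaying/schwartzZ].
rewrite cintZ; last exact/schwartz_decaying.
rewrite (cint_shift (f := mulX b) (- w)); last exact/schwartz_decaying/schwartz_mulX.
by rewrite (cint_shift (f := b) (- w)) ?b1; [ring|exact: schwartz_decaying].
Qed.

(** The translates by w sum to a constant, so the nonzero frequencies vanish. Integration by parts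
    leaves two integrals of b against the character, which agree because e(nu w) = 1. *)
Lemma cint_plateau_char nu : nu != 0 -> e_ (nu * w) = 1 ->
  cintegral (fun t => plateau t * e_ (nu * t)) = 0.
Proof.
move=> nu0 nuw; have Sp := schwartz_plateau.
have Se f : schwartz f -> schwartz (fun t => f t * e_ (nu * t)).
  by move=> /(schwartz_e_affine nu 0); apply: eq_schwartz => t; rewrite addr0 mulrC.
have de : cderiv (fun t => e_ (nu * t)) (fun t => Complex 0 (2 * pi * nu) * e_ (nu * t)).
  by apply: eq_cderiv (cderiv_e_affine nu 0) => t; rewrite addr0.
have Sbw : schwartz (fun t => b (t - w)) by exact: (schwartz_shift (- w)).
have := cint_deriv (Se _ Sp) (cderivM cderiv_plateau de).
have -> : (fun t => (b t - b (t - w)) * e_ (nu * t) + plateau t * (Complex 0 (2 * pi * nu) * e_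
  (nu * t)))
  = (fun t => (b t * e_ (nu * t) - b (t - w) * e_ (nu * (t - w))) + Complex 0 (2 * pi * nu) *
    (plateau t * e_ (nu * t))).
  by apply/funext => t; rewrite mulrBr e_D e_N nuw invr1; ring.
rewrite cintD; last 2 first.
- apply/schwartz_decaying/schwartzB; first exact: Se.
  exact: (schwartz_shift (- w) (Se _ Sb)).
- exact/schwartz_decaying/schwartzZ/Se.
rewrite cintB; [|exact/schwartz_decaying/Se|exact/schwartz_decaying/(schwartz_shift (- w) (Se _
  Sb))].
rewrite (cint_shift (f := fun t => b t * e_ (nu * t)) (- w)); last exact/schwartz_decaying/Se.
rewrite subrr add0r cintZ; last exact/schwartz_decaying/Se.
move=> /eqP; rewrite mulf_eq0 => /orP[|/eqP//].
by rewrite eq_complex /= eqxx /= !mulf_eq0 pnatr_eq0 (gt_eqF (pi_gt0 R)) (negbTE nu0).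
Qed.

End Plateau.

(** On |x| <= 3/4 the only zero of e(x) - 1 is simple and at 0. The range is 3/4 because the
    function divided by e(al t) - 1 in Poisson summation reaches to 3/4 of a period. *)
Lemma e_sub1_ge : exists2 m : R, 0 < m & forall x, `|x| <= 3 / 4 -> m * `|x| <= cabs (e_ x - 1).
Proof.
have p0 := @pi_gt0 R; have p2 := @pi_ge2 R.
pose q : R := 1 / 4.
have q1 : cos q < 1.
  by rewrite -cos0 ltr_cos ?in_itv/= ?lexx ?pi_ge0//; rewrite /q; [lra|apply/andP; split; lra].
have q0 : 0 < cos q by apply: cos_gt0_pihalf; rewrite /q; apply/andP; split; lra.
(* Here the linear Taylor term 2 pi |x| is at least twice the remainder bound 8 pi^2 x^2. *)
have small x : `|x| <= (8 * pi)^-1 -> pi * `|x| <= cabs (e_ x - 1).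
  move=> xs; have := e_taylor 0 x; rewrite add0r e_0 mulr1 => H.
  have N : cabs (rc x * Complex 0 (2 * pi)) = 2 * pi * `|x|.
    rewrite cabsM cabs_real mulrC /cabs /= expr0n add0r sqrtr_sqr ger0_norm//.
    by rewrite mulr_ge0 ?pi_ge0.
  have := cabsB (e_ x - 1) (e_ x - 1 - rc x * Complex 0 (2 * pi)); rewrite subKr N => T.
  have x2 : x ^+ 2 <= `|x| * (8 * pi)^-1.
    by rewrite -[x ^+ 2]real_normK ?num_real// expr2 ler_wpM2l.
  have pn : pi != 0 by rewrite gt_eqF.
  have E : 8 * pi ^+ 2 * (`|x| * (8 * pi)^-1) = pi * `|x|.
    rewrite (_ : 8 * pi ^+ 2 = pi * (8 * pi)); last by ring.
    by rewrite -mulrA [8 * pi * _]mulrCA divff ?mulr1// mulf_neq0.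
  have := ler_wpM2l (_ : 0 <= 8 * pi ^+ 2) x2; rewrite E => /(_ _) h.
  have := h (mulr_ge0 (ler0n _ _) (sqr_ge0 _)); lra.
(* Away from 0 the angle 2 pi |x| lies in [1/4, 3 pi / 2], where the cosine is at most cos(1/4). *)
have large x : (8 * pi)^-1 <= `|x| -> `|x| <= 3 / 4 -> 1 - cos q <= cabs (e_ x - 1).
  move=> h1 h2; apply: le_trans (Re_le_cabs _); rewrite cReD cReN /=.
  suff : cos (2 * pi * x) <= cos q by move=> h; rewrite distrC; apply: le_trans (ler_norm _); lra.
  rewrite -(cos_norm (2 * pi * x)) normrM ger0_norm; last by rewrite mulr_ge0 ?pi_ge0.
  set y := `|x| in h1 h2 *.
  have y1 : q <= 2 * pi * y.
    have : 2 * pi * (8 * pi)^-1 <= 2 * pi * y by rewrite ler_wpM2l// mulr_ge0 ?pi_ge0.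
    have pn8 : 8 * pi != 0 by rewrite mulf_neq0// gt_eqF.
    have -> // : 2 * pi * (8 * pi)^-1 = q.
    by apply: (mulIf pn8); rewrite divfK// /q; lra.
  have y2 : 2 * pi * y <= 3 * pi / 2 by nra.
  have [y3|y3] := leP (2 * pi * y) pi.
    clear h1 h2; rewrite leNgt ltr_cos -?leNgt//; rewrite in_itv /=; apply/andP; split;
      move: y1; rewrite /q; lra.
  apply: (@le_trans _ _ 0); last exact: ltW.
  rewrite -(subrK pi (2 * pi * y)) cosDpi oppr_le0; apply: cos_ge0_pihalf.
  by apply/andP; split; lra.
exists (Num.min pi (1 - cos q)); first by rewrite lt_min p0 subr_gt0.
move=> x x1; have [xs|xl] := leP `|x| (8 * pi)^-1.
  by apply: le_trans (small x xs); rewrite ler_wpM2r// ge_min lexx.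
apply: le_trans (large x (ltW xl) x1).
apply: (@le_trans _ _ ((1 - cos q) * 1)); last by rewrite mulr1.
apply: ler_pM => //; first by rewrite le_min (ltW p0) subr_ge0 ltW.
- by rewrite ge_min lexx orbT.
- lra.
Qed.

Lemma measurable_continuous_off0 (g : R -> R) :
  (forall x, x != 0 -> {for x, continuous g}) -> measurable_fun setT g.
Proof.
move=> cg; rewrite -(setUv [set 0]); apply/measurable_funU => //.
  exact: measurableC.
split; first exact: measurable_fun_set1.
apply: open_continuous_measurable_fun;
  first exact/closed_openC/accessible_closed_set1/hausdorff_accessible.
by move=> x; rewrite inE /= => /eqP x0; exact: cg.
Qed.

Lemma cint_L1 (u e : R -> C) K : cmeasurable u -> decay_le u K -> cmeasurable e ->
  (forall x, cabs (e x) <= 1) ->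
  cabs (cintegral (fun x => u x * e x)) <=
    2 * \int[mu]_x (`|complex.Re (u x)| + `|complex.Im (u x)|).
Proof.
move=> mu_ uK me e1.
have dec : decaying (fun x => u x * e x).
  have : decaying (fun x => e x * u x) by apply: decaying_mul => //; [exists 1|split => //;
    exists K].
  by under eq_fun do rewrite mulrC.
have du : decaying u by split => //; exists K.
have ir := integrable_norm (decaying_Re du); have ii := integrable_norm (decaying_Im du).
have isum : mu.-integrable setT (EFin \o (fun x => `|complex.Re (u x)| + `|complex.Im (u x)|)).
  exact: (integrableD measurableT ir ii).
have ue x : cabs (u x * e x) <= `|complex.Re (u x)| + `|complex.Im (u x)|.
  rewrite cabsM; apply: le_trans (cabs_le (u x)); by rewrite ler_piMr ?cabs_ge0.
apply: le_trans (cabs_le _) _; rewrite mulrDl !mul1r /cintegral /=; apply: lerD.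
  apply: le_trans (le_normr_Rintegral measurableT (decaying_Re dec)) _.
  apply: le_Rintegral => //; first exact: (integrable_norm (decaying_Re dec)).
  by move=> x _; apply: le_trans (Re_le_cabs _) (ue x).
apply: le_trans (le_normr_Rintegral measurableT (decaying_Im dec)) _.
apply: le_Rintegral => //; first exact: (integrable_norm (decaying_Im dec)).
by move=> x _; apply: le_trans (Im_le_cabs _) (ue x).
Qed.

(** A quotient by e(al t) - 1 takes the value 0 at t = 0 by convention, so continuity there cannot
    be expected. *)
Definition continuous_off0 f := forall x, x != 0 ->
  {for x, continuous (fun x => complex.Re (f x))} /\
  {for x, continuous (fun x => complex.Im (f x))}.

Lemma continuous_off0_cmeasurable f : continuous_off0 f -> cmeasurable f.
Proof. by move=> cf; split; apply: measurable_continuous_off0 => x /cf[]. Qed.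

(* Shifting by half a period, e(nu (x + h)) = - e(nu x) when nu h = 1/2, turns the oscillatory
   integral into one of f - f(. + h), to which dominated convergence applies. *)
Lemma riemann_lebesgue f (K c : R) : continuous_off0 f -> decay_le f K -> c != 0 ->
  cabs (cintegral (fun x => f x * e_ (c * n.+1%:R * x))) @[n --> \oo] --> (0 : R).
Proof.
move=> cf fK c0; have mf := continuous_off0_cmeasurable cf.
have df : decaying f by split => //; exists K.
pose h n : R := (2 * (c * n.+1%:R))^-1.
have hE n : h n = (2 * c)^-1 * n.+1%:R^-1 by rewrite /h mulrA invfM.
have h0 : h @ \oo --> (0 : R).
  rewrite (_ : h = fun n => (2 * c)^-1 * n.+1%:R^-1); last exact/funext.
  rewrite -[X in _ --> X](mulr0 (2 * c)^-1); apply: cvgM; first exact: cvg_cst.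
  exact: cvg_harmonic.
pose H := `|(2 * c)^-1|.
have hH n : `|h n| <= H.
  by rewrite hE normrM ler_piMr// ger0_norm ?invr_ge0// invf_le1// ler1n.
pose u n : R -> C := fun x => f x - f (x + h n).
have K0 : 0 <= K by apply: le_trans (fK 0); rewrite mulr_ge0 ?oneDsqr_ge0 ?cabs_ge0.
(* The shifts [h n] are bounded by [H], so one constant dominates every [u n]. *)
pose K' := K + 2 * (1 + H ^+ 2) * K.
have uK n : decay_le (u n) K'.
  move=> x; apply: (@le_trans _ _ ((1 + x ^+ 2) * (cabs (f x) + cabs (f (x + h n))))).
    by rewrite ler_wpM2l ?oneDsqr_ge0// cabsB.
  rewrite mulrDr lerD//; apply: le_trans (decay_shift (h n) (@cabs_ge0 R) fK x) _.
  rewrite ler_wpM2r// ler_wpM2l// lerD2l -[h n ^+ 2]real_normK ?num_real//.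
  by rewrite lerXn2r ?nnegrE /H.
have mu_n n : cmeasurable (u n).
  have [m1 _] := decaying_shift (h n) df.
  apply: cmeasurableD => //.
  have [] := decayingN (decaying_shift (h n) df); by [].
pose e n x : C := e_ (c * n.+1%:R * x).
have me n : cmeasurable (e n).
  have := cderiv_cmeasurable (cderiv_e_affine (c * n.+1%:R) 0).
  by under eq_fun do rewrite addr0.
pose G n x := `|complex.Re (u n x)| + `|complex.Im (u n x)|.
have half n : cabs (cintegral (fun x => f x * e n x)) <= \int[mu]_x G n x.
  have dfe : decaying (fun x => f x * e n x).
    have : decaying (fun x => e n x * f x).
      by apply: decaying_mul => //; exists 1 => x; rewrite /e cabs_e.
    by under eq_fun do rewrite mulrC.
  have E : cintegral (fun x => u n x * e n x) = 2 * cintegral (fun x => f x * e n x).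
    have Es : cintegral (fun x => - (f (x + h n) * e n x)) = cintegral (fun x => f x * e n x).
      rewrite -(cint_shift (h n) dfe); apply: eq_cint => x.
      rewrite /e mulrDr e_D (_ : c * n.+1%:R * h n = 1 / 2); last first.
        have cn : c * n.+1%:R != 0 by rewrite mulf_neq0// pnatr_eq0.
        by rewrite /h invfM mulrCA divff// mulr1 mul1r.
      rewrite (_ : e_ (1 / 2) = -1); first by rewrite mulrN1 mulrN.
      rewrite /e_ (_ : 2 * pi * (1 / 2) = pi); last by field.
      by rewrite cospi sinpi; apply: complex_eq => //=; rewrite oppr0.
    have dfe' : decaying (fun x => - (f (x + h n) * e n x)).
      apply: decayingN.
      have : decaying (fun x => e n x * f (x + h n)).
        by apply: decaying_mul => //; [exists 1 => x; rewrite /e cabs_e|exact: decaying_shift].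
      by under eq_fun do rewrite mulrC.
    rewrite mulrDl mul1r -{2}Es -cintD//; apply: eq_cint => x.
    by rewrite /u; ring.
  have e1 x : cabs (e n x) <= 1 by rewrite /e cabs_e.
  have := cint_L1 (mu_n n) (uK n) (me n) e1.
  rewrite E cabsM (_ : cabs 2 = 2);
    last by rewrite -(rmorph_nat (real_complex R)) cabs_real ger0_norm.
  by rewrite ler_pM2l.
apply: (squeeze_cvgr _ (@cvg_cst _ _ _ _ _) _ (h := fun n => \int[mu]_x G n x)).
  by apply: nearW => n; rewrite cabs_ge0 half.
have mG n : measurable_fun setT (G n).
  have [a b] := mu_n n; apply: measurable_funD; exact: measurableT_comp.
have [|||||_ _] := @dominated_convergence _ _ R mu setT measurableT (fun n x => (G n x)%:E)
   (cst 0%E) (fun x => (2 * K' * (1 + x ^+ 2)^-1)%:E).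
- by move=> n; apply/measurable_EFinP; exact: mG.
- exact: measurable_cst.
(* Convergence of f(x + h n) to f(x) uses continuity at x, hence the null set containing 0. *)
- exists [set 0]; split; [exact: measurable_set1|exact: lebesgue_measure_set1|].
  move=> x /= Hx; apply: contra_notP Hx => /eqP x0 _.
  apply: cvg_EFin; first by apply: nearW.
  have xh : x + h n @[n --> \oo] --> x.
    by rewrite -[X in _ --> X]addr0; apply: cvgD => //; exact: cvg_cst.
  have [cr ci] := cf _ x0.
  have gr : complex.Re (f (x + h n)) @[n --> \oo] --> complex.Re (f x).
    exact: (cvg_comp _ _ xh cr).
  have gi : complex.Im (f (x + h n)) @[n --> \oo] --> complex.Im (f x).
    exact: (cvg_comp _ _ xh ci).
  rewrite -[X in _ --> X]addr0; apply: cvgD.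
    rewrite -[X in _ --> X](normr0 R) -(subrr (complex.Re (f x))).
    under eq_fun do rewrite /u cReD cReN.
    by apply: cvg_norm; apply: cvgB => //; exact: cvg_cst.
  rewrite -[X in _ --> X](normr0 R) -(subrr (complex.Im (f x))).
  under eq_fun do rewrite /u cImD cImN.
  by apply: cvg_norm; apply: cvgB => //; exact: cvg_cst.
- exact: (integrableZl measurableT (2 * K') (integrable_oneDsqrV R)).
- apply: aeW => x n _ /=; rewrite lee_fin ger0_norm ?addr_ge0//.
  rewrite ler_pdivlMr ?(lt_le_trans ltr01) ?lerDl ?sqr_ge0// mulrC.
  rewrite /G mulrDr (_ : 2 * K' = K' + K'); last by ring.
  apply: lerD.
    exact: decay_Re (uK n) x.
  exact: decay_Im (uK n) x.
rewrite integral0 => /fine_cvg; exact.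
Qed.

(* Poisson summation reduces to a telescoping sum: if f 0 = 0 then f(t) = psi(t) (e(al t) - 1),
   so that the n-th Fourier coefficient of f is v (n + 1) - v n, v n being that of psi. *)
Lemma telescoping_sum (u v : int -> C) (S : C) : csums u S ->
  (forall n : int, u n = v (n + 1) - v n) ->
  cabs (v n.+1%:Z) @[n --> \oo] --> (0 : R) ->
  cabs (v (- n.+1%:Z)) @[n --> \oo] --> (0 : R) -> S = 0.
Proof.
move=> uS uv vp vn; apply: cabs_eq0; apply/eqP; rewrite eq_le cabs_ge0 andbT.
apply/ler_addgt0Pr => e e0; rewrite add0r; have e40 : 0 < e / 4 by rewrite divr_gt0.
have [F FP] := uS _ e40; have [m mP] := fsubset_int_box F.
have /cvgr0Pnorm_lt/(_ _ e40)[n1 _ n1P] := vp.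
have /cvgr0Pnorm_lt/(_ _ e40)[n2 _ n2P] := vn.
pose n := maxn m (maxn n1 n2).
have Fn : (F `<=` int_box n.+1)%fset by apply: mP; rewrite leqW// leq_maxl.
have := FP _ Fn; rewrite big_int_box.
have -> : \sum_(i < n.+1) u i = v n.+1%:Z - v 0.
  elim: n.+1 => [|k IH]; first by rewrite big_ord0 subrr.
  rewrite big_ord_recr/= IH uv -PoszD addn1 addrC; exact: subrKA.
have -> : \sum_(i < n.+1) u (Negz i) = v 0 - v (- n.+1%:Z).
  elim: n.+1 => [|k IH]; first by rewrite big_ord0 oppr0 subrr.
  rewrite big_ord_recr/= IH uv NegzE (_ : - k.+1%:Z + 1 = - k%:Z); last by lia.
  exact: subrKA.
rewrite subrKA => h.
have := n1P n; rewrite /= ger0_norm ?cabs_ge0// => /(_ _) h1.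
have := n2P n; rewrite /= ger0_norm ?cabs_ge0// => /(_ _) h2.
have {}h1 := h1 (leq_trans (leq_maxl n1 n2) (leq_maxr m _)).
have {}h2 := h2 (leq_trans (leq_maxr n1 n2) (leq_maxr m _)).
have := cabsB (v n.+1%:Z - v (- n.+1%:Z)) (v n.+1%:Z - v (- n.+1%:Z) - S).
rewrite subKr; have := cabsB (v n.+1%:Z) (v (- n.+1%:Z)); lra.
Qed.

Lemma cdiv_continuous f f' g g' x : cderiv f f' -> cderiv g g' -> g x != 0 ->
  {for x, continuous (fun x => complex.Re (f x / g x))} /\
  {for x, continuous (fun x => complex.Im (f x / g x))}.
Proof.
move=> df dg gx; have [fr fi] := cderiv_continuous df; have [gr gi] := cderiv_continuous dg.
pose D y := complex.Re (g y) ^+ 2 + complex.Im (g y) ^+ 2.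
have D0 : D x != 0.
  move: gx; rewrite /D; apply: contra; case: (g x) => a c /=.
  by rewrite paddr_eq0 ?sqr_ge0// !sqrf_eq0 eq_complex.
have Dc : {for x, continuous D} by apply: continuousD; apply: continuousM;
  [apply: gr|apply: gr|apply: gi|apply: gi].
have ir : {for x, continuous (fun x => complex.Re (g x)^-1)}.
  rewrite (_ : (fun x => _) = fun x => complex.Re (g x) / D x).
    by apply: continuousM; [exact: gr|exact: continuousV].
  by apply/funext => y; rewrite /D; case: (g y).
have ii : {for x, continuous (fun x => complex.Im (g x)^-1)}.
  rewrite (_ : (fun x => _) = fun x => - complex.Im (g x) / D x).
    by apply: continuousM; [apply: continuousN; exact: gi|exact: continuousV].
  by apply/funext => y; rewrite /D; case: (g y) => ? ? /=; rewrite mulNr.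
split.
  rewrite (_ : (fun x => _) = fun x =>
    complex.Re (f x) * complex.Re (g x)^-1 - complex.Im (f x) * complex.Im (g x)^-1).
    by apply: continuousB; apply: continuousM; [apply: fr| |apply: fi|].
  by apply/funext => y; rewrite cReM.
rewrite (_ : (fun x => _) = fun x =>
  complex.Re (f x) * complex.Im (g x)^-1 + complex.Im (f x) * complex.Re (g x)^-1).
  by apply: continuousD; apply: continuousM; [apply: fr| |apply: fi|].
by apply/funext => y; rewrite cImM.
Qed.

Lemma vanishing_continuous f x (r : R) : r < `|x| -> (forall t, r < `|t| -> f t = 0) ->
  {for x, continuous (fun x => complex.Re (f x))} /\
  {for x, continuous (fun x => complex.Im (f x))}.
Proof.
move=> rx fr; split; rewrite /prop_for /continuous_at fr//=; apply: cvg_near_cst; near=> y.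
  by rewrite fr//; near: y; exact: (cvgr_gt _ (@norm_continuous R R^o x) _ rx).
by rewrite fr//; near: y; exact: (cvgr_gt _ (@norm_continuous R R^o x) _ rx).
Unshelve. all: by end_near. Qed.

(** The support lies within half a period of 0, so the periodization of f has value f(0) at 0.
    Subtracting f(0) p, with p a plateau whose coefficient is 1 at n = 0 and 0 elsewhere, reduces to
    the case f(0) = 0, where the coefficients telescope. *)
Lemma poisson_compact (al : R) f : 0 < al -> schwartz f ->
  (forall t, (2 * al)^-1 < `|t| -> f t = 0) ->
  casums (fun n : int => rc al * cintegral (fun t => f t * e_ (al * n%:~R * t))) ->
  csum (fun n : int => rc al * cintegral (fun t => f t * e_ (al * n%:~R * t))) = f 0.
Proof.
move=> al0 Sf fsupp fS; pose L := al^-1.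
have L0 : 0 < L by rewrite invr_gt0.
have alL : al * L = 1 by rewrite divff// gt_eqF.
have d0 : 0 < L / 4 by rewrite divr_gt0.
have [s [b [Sb sb s0 s1 b1]]] := smooth_step d0.
(* Width L, transition L/4 and shift L/2 give p(0) = 1 and a support in [- L/2, 3 L/4], which
   contains no zero of e(al t) - 1 other than 0. *)
pose p t := plateau s L (t + L / 2).
have Sp : schwartz p := schwartz_shift (L / 2) (schwartz_plateau Sb sb s0 s1 L0).
pose co g (n : int) : C := rc al * cintegral (fun t => g t * e_ (al * n%:~R * t)).
have Se g n : schwartz g -> schwartz (fun t => g t * e_ (al * n%:~R * t)).
  by move=> /(schwartz_e_affine (al * n%:~R) 0); apply: eq_schwartz => t; rewrite addr0 mulrC.
have cop n : co p n = (n == 0)%:R.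
  have Spl := schwartz_plateau Sb sb s0 s1 L0.
  have -> : co p n = e_ (- (al * n%:~R * (L / 2))) * (rc al * cintegral (fun t =>
    plateau s L t * e_ (al * n%:~R * t))).
    rewrite /co mulrCA; congr (_ * _).
    rewrite -(cint_shift (f := fun t => plateau s L t * e_ (al * n%:~R * t)) (L / 2));
      last exact/schwartz_decaying/Se.
    rewrite -cintZ; last first.
      exact/(decaying_shift (f := fun t =>
        plateau s L t * e_ (al * n%:~R * t)))/schwartz_decaying/Se.
    apply: eq_cint => t; rewrite /p mulrDr e_D e_N.
    rewrite -[LHS]mul1r -(mulVf (e_neq0 (al * n%:~R * (L / 2)))); ring.
  have [->|n0] := eqVneq n 0.
    under eq_cint do rewrite mulr0 mul0r e_0 mulr1.
    rewrite (cint_plateau Sb sb s0 s1 b1 L0) mulr0 mul0r oppr0 e_0 mul1r -rmorphM alL.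
    by rewrite rmorph1.
  rewrite (cint_plateau_char Sb sb s0 s1 L0) ?mulr0//.
    by apply: mulf_neq0; [exact: lt0r_neq0|rewrite intr_eq0].
  by rewrite mulrAC alL mul1r e_int.
pose g t := f t - f 0 * p t.
have Sg : schwartz g by apply: schwartzB => //; exact: schwartzZ.
have cog n : co g n = co f n + (- f 0) * (n == 0)%:R.
  rewrite -cop /co mulrCA -mulrDr; congr (_ * _).
  rewrite -cintZ; last exact/schwartz_decaying/Se.
  rewrite -cintD; [|exact/schwartz_decaying/Se|exact/decayingZ/schwartz_decaying/Se].
  by apply: eq_cint => t; rewrite /g; ring.
have p0 : p 0 = 1.
  by rewrite /p add0r (plateau_mid s0 s1)//; lra.
have g0 : g 0 = 0 by rewrite /g p0 mulr1 subrr.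
have gsupp t : 3 * L / 4 < `|t| -> g t = 0.
  move=> ht; have ft : f t = 0 by apply: fsupp; rewrite invfM -/L; lra.
  suff pt : p t = 0 by rewrite /g ft pt mulr0 subrr.
  rewrite /p; have [t0|t0] := leP 0 t.
    by apply: (plateau_right s1 L0); move: ht; rewrite ger0_norm//; lra.
  by apply: (plateau_left s0 L0); move: ht; rewrite ltr0_norm//; lra.
pose E t : C := e_ (al * t) - 1.
have dE : cderiv E (fun t => Complex 0 (2 * pi * al) * e_ (al * t)).
  apply: eq_cderiv (cderivD (cderiv_e_affine al 0) (cderiv_cst (- 1))) => t.
    by rewrite addr0.
  by rewrite !addr0.
pose psi t := g t / E t.
have [m m0 mP] := e_sub1_ge.
have Ebound t : `|t| <= 3 * L / 4 -> m * al * `|t| <= cabs (E t).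
  move=> ht; have := mP (al * t); rewrite normrM (gtr0_norm al0) mulrA; apply.
  by have := ler_wpM2l (ltW al0) ht; rewrite mulrAC mulrCA alL; lra.
have E_neq0 t : t != 0 -> `|t| <= 3 * L / 4 -> E t != 0.
  move=> t0 /Ebound h; apply/negP => /eqP Et; move: h; rewrite Et cabs0 leNgt.
  by rewrite !mulr_gt0// normr_gt0.
have gE t : g t = psi t * E t.
  have [->|t0] := eqVneq t 0; first by rewrite /psi g0 mul0r mul0r.
  have [ht|ht] := leP `|t| (3 * L / 4); last by rewrite /psi gsupp// !mul0r.
  by rewrite /psi divfK// E_neq0.
have [g' Sg' dg] := schwartz_derivable Sg.
have [K KP] := schwartz_bounded0 Sg'; have K0 : 0 <= K := le_trans (cabs_ge0 _) (KP 0).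
(* [g] is Lipschitz and vanishes at 0 while [E] grows at least linearly on the support, so [psi] is
   bounded; its support in |t| <= L turns this into decay. *)
have psiK : decay_le psi ((1 + L ^+ 2) * (2 * K / (m * al))).
  move=> t; have B0 : 0 <= 2 * K / (m * al) by apply: divr_ge0; apply: mulr_ge0 => //; exact: ltW.
  have [ht|ht] := leP `|t| (3 * L / 4); last first.
    by rewrite /psi gsupp// mul0r cabs0 mulr0 mulr_ge0 ?oneDsqr_ge0.
  apply: ler_pM; rewrite ?oneDsqr_ge0 ?cabs_ge0//.
    rewrite lerD2l -[t ^+ 2]real_normK ?num_real// lerXn2r ?nnegrE ?(ltW L0)//.
    by apply: le_trans ht _; lra.
  have [->|t0] := eqVneq t 0; first by rewrite /psi g0 mul0r cabs0.
  rewrite /psi cabsM /cabs Normc.normcV -/(cabs _) -/(cabs _).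
  have tp : 0 < m * al * `|t| by rewrite !mulr_gt0// normr_gt0.
  have h1 := Ebound _ ht; have cE : 0 < cabs (E t) by exact: lt_le_trans h1.
  rewrite ler_pdivrMr//.
  have h2 := cderiv_lipschitz dg KP 0 t; rewrite g0 !subr0 in h2.
  apply: le_trans h2 _.
  have -> : 2 * K * `|t| = 2 * K / (m * al) * (m * al * `|t|).
    by rewrite mulrA divfK// gt_eqF// mulr_gt0.
  by rewrite ler_wpM2l.
have psic : continuous_off0 psi.
  move=> x x0; have [ht|ht] := leP `|x| (3 * L / 4); last first.
    by apply: (vanishing_continuous ht) => t /gsupp gt0; rewrite /psi gt0 mul0r.
  exact: (cdiv_continuous dg dE (E_neq0 _ x0 ht)).
pose v (n : int) : C := rc al * cintegral (fun t => psi t * e_ (al * n%:~R * t)).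
have dpsi : decaying psi by split;
  [exact: continuous_off0_cmeasurable|exists ((1 + L ^+ 2) * (2 * K / (m * al)))].
have dpe n : decaying (fun t => psi t * e_ (al * n%:~R * t)).
  have : decaying (fun t => e_ (al * n%:~R * t) * psi t).
    apply: decaying_mul => //; last by exists 1 => t; rewrite cabs_e.
    by have := cderiv_cmeasurable (cderiv_e_affine (al * n%:~R) 0); under eq_fun do rewrite addr0.
  by under eq_fun do rewrite mulrC.
have uv n : co g n = v (n + 1) - v n.
  rewrite /co /v -mulrBr -cintB//; congr (_ * _); apply: eq_cint => t.
  rewrite gE intrD mulr1z (_ : al * (n%:~R + 1) * t = al * n%:~R * t + al * t); last by ring.
  by rewrite e_D /E; ring.
have vlim (c : R) : c != 0 ->
    cabs (rc al * cintegral (fun x => psi x * e_ (c * n.+1%:R * x))) @[n --> \oo] --> (0 : R).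
  move=> c0; have := riemann_lebesgue psic psiK c0 => h.
  rewrite -[X in _ --> X](mulr0 (cabs (rc al))); under eq_fun do rewrite cabsM.
  by apply: cvgM => //; exact: cvg_cst.
have gS : csums (co g) (csum (co f) - f 0).
  have := sumsD (cabs_complete_norm R) (csumP fS)
     (@sums_delta R _ _ (cabs_complete_norm R) _ (fun n : int => (- f 0) * (n == 0)%:R) 0 _).
  rewrite eqxx mulr1 => h; apply: eq_sums (h _) => [n|n n0]; first by rewrite cog.
  by rewrite (negbTE n0) mulr0.
apply/eqP; rewrite -subr_eq0; apply/eqP; apply: (telescoping_sum gS uv).
  exact: (vlim al (lt0r_neq0 al0)).
rewrite /v; have := vlim (- al); rewrite oppr_eq0 => /(_ (lt0r_neq0 al0)).
by under [X in _ -> X @ _ --> _]eq_fun do rewrite rmorphN mulrN -mulNr.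
Qed.

End Poisson.

(** * Weyl operators and the dual basis *)

Section WeylOperators.
Variable R : realType.
Local Notation C := R[i].
Local Notation rc := (real_complex R).
Local Notation pi := (@trigo.pi R).
Local Notation schwartz := (@Pilot.Defs.schwartz R).
Variable al : R.
Hypothesis al_gt0 : 0 < al.
Implicit Types (f g h u : R -> C) (a : int * int -> C) (p q : int * int).

(* The action of the Weyl element e(theta m n / 2) U^m V^n, where theta = al ^ 2 and
   p = (m, n): this normalization makes it covariant under [hexa]. *)
Definition weyl_op p f : R -> C := fun t =>
  e_ (al ^+ 2 * (p.1 * p.2)%:~R / 2 - al * p.2%:~R * t) * f (t - al * p.1%:~R).

(** The symmetric normalization leaves only the determinant of (p, q) in the cocycle; hence it is 1
    on (p, - p) and invariant under [hexa]. *)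
Definition cocycle p q : C := e_ (al ^+ 2 * (p.2 * q.1 - p.1 * q.2)%:~R / 2).

(* the automorphism of Z^2 induced by conjugation by W *)
Definition hexa p : int * int := (- p.2, p.1 + p.2).
Definition hexa_inv p : int * int := (p.1 + p.2, - p.1).

Lemma hexaK : cancel hexa hexa_inv.
Proof. by case=> m n; rewrite /hexa /hexa_inv /=; congr pair; ring. Qed.

Lemma hexa_invK : cancel hexa_inv hexa.
Proof. by case=> m n; rewrite /hexa /hexa_inv /=; congr pair; ring. Qed.

Lemma weyl_weyl p q f : weyl_op q (weyl_op p f) = fun t => cocycle p q * weyl_op (p + q) f t.
Proof.
case: p => m n; case: q => m' n'; apply/funext => t; rewrite /weyl_op /cocycle /=.
rewrite !mulrA -!e_D; congr (e_ _ * f _); by rewrite !(intrD, intrM, intrN); field.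
Qed.

Lemma weyl0 f : weyl_op 0 f = f.
Proof.
apply/funext => t; rewrite /weyl_op /= mulr0 mul0r !mulr0 mul0r !subr0.
by rewrite e_0 mul1r.
Qed.

Lemma schwartz_weyl p f : schwartz f -> schwartz (weyl_op p f).
Proof.
move=> Sf; have := schwartz_e_affine (- (al * p.2%:~R)) (al ^+ 2 * (p.1 * p.2)%:~R / 2)
  (schwartz_shift (- (al * p.1%:~R)) Sf).
by apply: eq_schwartz => t; rewrite /weyl_op mulNr [_ + al ^+ 2 * _ / 2]addrC.
Qed.

Lemma weylD p f g : weyl_op p (fun t => f t + g t) = fun t => weyl_op p f t + weyl_op p g t.
Proof. by apply/funext => t; rewrite /weyl_op mulrDr. Qed.

Lemma weyl_mulX p f t : mulX (weyl_op p f) t = weyl_op p (mulX f) t + rc (al * p.1%:~R) *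
  weyl_op p f t.
Proof. by rewrite /mulX /weyl_op rmorphB /=; ring. Qed.

Definition weyl_freq p : C := Complex 0 (- (2 * pi * al * p.2%:~R)).

Lemma cderiv_weyl p f f' : cderiv f f' ->
  cderiv (weyl_op p f) (fun t => weyl_op p f' t + weyl_freq p * weyl_op p f t).
Proof.
move=> df; apply: eq_cderiv (cderivM (cderiv_e_affine (- (al * p.2%:~R))
  (al ^+ 2 * (p.1 * p.2)%:~R / 2)) (cderiv_shift (- (al * p.1%:~R)) df)) => t.
  by rewrite /weyl_op mulNr [_ + al ^+ 2 * _ / 2]addrC.
rewrite /weyl_op mulNr [_ + al ^+ 2 * _ / 2]addrC /weyl_freq.
rewrite (_ : 2 * pi * - (al * p.2%:~R) = - (2 * pi * al * p.2%:~R)); by ring.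
Qed.

Lemma cabs_weyl p f t : cabs (weyl_op p f t) = cabs (f (t - al * p.1%:~R)).
Proof. by rewrite cabsM cabs_e mul1r. Qed.

Lemma cabs_cocycle p q : cabs (cocycle p q) = 1.
Proof. exact: cabs_e. Qed.

(** With p = (m, n), the substitution x -> x + al n in the integral defining W turns one side into
    the other. *)
Lemma opW_weyl p f : schwartz f -> opW (weyl_op (hexa p) f) = weyl_op p (opW f).
Proof.
move=> Sf; case: p => m n; apply/funext => t; rewrite /opW /weyl_op /=.
rewrite mulrCA; congr (_ * _).
pose k x := f x * e_ ((t - al * m%:~R) * x - x ^+ 2 / 2).
have Sk : schwartz k.
  apply: eq_schwartz (schwartz_kernel (- (1 / 2)) (t - al * m%:~R) Sf) => x.
  by rewrite /k; congr (_ * e_ _); field.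
rewrite -(cint_shift (al * n%:~R) (schwartz_decaying Sk)) -cintZ; last first.
  exact/decaying_shift/schwartz_decaying.
apply: eq_cint => x; rewrite /k intrN mulrN opprK mulrAC -e_D mulrCA -e_D mulrC.
by congr (_ * e_ _); rewrite !(intrD, intrM, intrN); field.
Qed.

Lemma wt1 p : `|p.1%:~R : R| <= wt R p.
Proof.
rewrite /wt (_ : `|p.1%:~R| = `|p.1|%N%:R); first by rewrite -addrA addrCA lerDl addr_ge0.
by rewrite natr_absz intr_norm.
Qed.

Lemma wt2 p : `|p.2%:~R : R| <= wt R p.
Proof.
rewrite /wt (_ : `|p.2%:~R| = `|p.2|%N%:R); first by rewrite lerDr addr_ge0.
by rewrite natr_absz intr_norm.
Qed.

Lemma cabs_weyl_freq p : cabs (weyl_freq p) <= 2 * pi * al * wt R p.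
Proof.
rewrite /weyl_freq /cabs /= expr0n add0r sqrrN sqrtr_sqr normrM ger0_norm.
  by rewrite ler_wpM2l ?wt2// !mulr_ge0 ?pi_ge0 ?ltW.
by rewrite !mulr_ge0 ?pi_ge0 ?ltW.
Qed.

Definition weyl_series a f : R -> C := fun t => csum (fun p => a p * weyl_op p f t).

Section Series.
Variable a : int * int -> C.
Hypothesis ra : rapid a.

Lemma series_casums f t : schwartz f -> casums (fun p => a p * weyl_op p f t).
Proof.
move=> /schwartz_bounded0[K KP]; have K0 : 0 <= K := le_trans (cabs_ge0 _) (KP 0).
apply: casums_le K0 _ (rapid_casums ra) => p; rewrite cabsM cabs_weyl mulrC.
by rewrite ler_wpM2r ?cabs_ge0.
Qed.

Lemma seriesP f t : schwartz f -> csums (fun p => a p * weyl_op p f t) (weyl_series a f t).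
Proof. by move=> Sf; exact/csumP/series_casums. Qed.

Lemma seriesD f g : schwartz f -> schwartz g ->
  weyl_series a (fun t => f t + g t) = fun t => weyl_series a f t + weyl_series a g t.
Proof.
move=> Sf Sg; apply/funext => t; rewrite /weyl_series -csumD; try exact: series_casums.
by congr csum; apply/funext => p; rewrite weylD mulrDr.
Qed.

End Series.

Lemma series_bounded a f : rapid a -> schwartz f -> cbounded (weyl_series a f).
Proof.
move=> ra Sf; have [K KP] := schwartz_bounded0 Sf.
have K0 : 0 <= K := le_trans (cabs_ge0 _) (KP 0).
have [M MP] := rapid_casums ra; exists (M * K) => t; apply: csum_le => F.
apply: (@le_trans _ _ (\sum_(p <- F) cabs (a p) * K)).
  by apply: ler_sum => p _; rewrite cabsM cabs_weyl ler_wpM2l ?cabs_ge0.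
by rewrite -mulr_suml ler_wpM2r.
Qed.

Lemma rapid_freq a : rapid a -> rapid (fun p => weyl_freq p * a p).
Proof.
apply: (@rapid_mul _ _ _ (2 * pi * al) 1) => [|p]; first by rewrite !mulr_ge0 ?pi_ge0 ?ltW.
by rewrite expr1 cabs_weyl_freq.
Qed.

Lemma rapid_shift a : rapid a -> rapid (fun p => rc (al * p.1%:~R) * a p).
Proof.
apply: (@rapid_mul _ _ _ al 1) => [|p]; first exact: ltW.
by rewrite expr1 cabs_real normrM (gtr0_norm al_gt0) ler_wpM2l ?wt1 ?ltW.
Qed.

Lemma cderiv_series a f f' : rapid a -> schwartz f -> cderiv f f' ->
  cderiv (weyl_series a f) (fun t => weyl_series a f' t + weyl_series (fun p =>
    weyl_freq p * a p) f t).
Proof.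
move=> ra Sf df; have Sf' := schwartz_cderiv Sf df.
have [f'' Sf'' df'] := schwartz_derivable Sf'.
have [K0 B0] := schwartz_bounded0 Sf; have [K1 B1] := schwartz_bounded0 Sf'.
have [K2 B2] := schwartz_bounded0 Sf''.
have P0 : 0 <= K0 := le_trans (cabs_ge0 _) (B0 0).
have P1 : 0 <= K1 := le_trans (cabs_ge0 _) (B1 0).
have P2 : 0 <= K2 := le_trans (cabs_ge0 _) (B2 0).
pose c := 2 * pi * al; have c0 : 0 <= c by rewrite /c !mulr_ge0 ?pi_ge0 ?ltW.
(* Differentiating [weyl_op p f] twice gives the Weyl transform of f'' + 2 w f' + w^2 f with w =
   [weyl_freq p] of modulus at most c wt p; [K] collects the three bounds. *)
pose K := K2 + c * K1 + c * (K1 + c * K0).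
have KP : 0 <= K by exact: addr_ge0 (addr_ge0 P2 (mulr_ge0 c0 P1)) (mulr_ge0 c0 (addr_ge0 P1
  (mulr_ge0 c0 P0))).
have [M MP] := rapid_weighted 2 ra.
apply: cderiv_of_quadratic => t; exists (2 * K * M) => d _.
have rf := rapid_freq ra.
have S1 := seriesP ra t Sf'; have S2 := seriesP rf t Sf.
have S3 := seriesP ra t Sf; have S4 := seriesP ra (t + d) Sf.
have S := sumsD (cabs_complete_norm R) (sumsD (cabs_complete_norm R) S4 (sumsN
  (cabs_complete_norm R) S3))
  (csums_scale (- rc d) (sumsD (cabs_complete_norm R) S1 S2)).
rewrite -mulNr; apply: (sums_bound (cabs_complete_norm R) S) => F.
apply: (@le_trans _ _ (\sum_(p <- F) 2 * K * d ^+ 2 * (cabs (a p) * wt R p ^+ 2))); last first.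
  rewrite -mulr_sumr (_ : 2 * K * M * d ^+ 2 = 2 * K * d ^+ 2 * M); last by ring.
  exact: ler_wpM2l (mulr_ge0 (mulr_ge0 (ler0n _ 2) KP) (sqr_ge0 d)) _ _ (MP F).
apply: ler_sum => p _.
rewrite (_ : _ + _ = a p * (weyl_op p f (t + d) - weyl_op p f t - rc d * (weyl_op p f' t +
  weyl_freq p * weyl_op p f t))); last by ring.
rewrite cabsM (_ : 2 * K * d ^+ 2 * (cabs (a p) * wt R p ^+ 2) = cabs (a p) * (2 * (K * wt R p
  ^+ 2) * d ^+ 2)); last by ring.
rewrite ler_wpM2l ?cabs_ge0//.
have dw := cderiv_weyl p df; have dw' := cderivD (cderiv_weyl p df') (cderiv_scale (weyl_freq p)
  dw).
apply: (cderiv_taylor dw dw') => x _.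
have w1 := wt_ge1 R p; have w0 := wt_ge0 R p.
have fq := cabs_weyl_freq p; rewrite -/c in fq.
have E0 : cabs (weyl_op p f x) <= K0 by rewrite cabs_weyl.
have E1 : cabs (weyl_op p f' x) <= K1 by rewrite cabs_weyl.
have E2 : cabs (weyl_op p f'' x) <= K2 by rewrite cabs_weyl.
have L y k : cabs y <= k -> cabs (weyl_freq p * y) <= c * wt R p * k.
  by move=> yk; rewrite cabsM; apply: ler_pM; rewrite ?cabs_ge0.
have ww : wt R p <= wt R p ^+ 2 by rewrite expr2 ler_peMr.
have w21 : 1 <= wt R p ^+ 2 by exact: le_trans ww.
apply: le_trans (cabsD _ _) _.
apply: (@le_trans _ _ ((K2 + c * wt R p * K1) + c * wt R p * (K1 + c * wt R p * K0))).
  apply: lerD; first by apply: le_trans (cabsD _ _) _; apply: lerD => //; exact: (L _ _ _).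
  apply: (L _ _ _); apply: le_trans (cabsD _ _) _; apply: lerD => //; exact: (L _ _ _).
rewrite (_ : _ + _ = K2 * 1 + (2 * c * K1) * wt R p + c ^+ 2 * K0 * wt R p ^+ 2); last by ring.
rewrite (_ : K * wt R p ^+ 2 = K2 * wt R p ^+ 2 + (2 * c * K1) * wt R p ^+ 2 + c ^+ 2 * K0 * wt
  R p ^+ 2); last by rewrite /K; ring.
rewrite lerD2r; apply: lerD; first by rewrite ler_wpM2l.
exact: ler_wpM2l (mulr_ge0 (mulr_ge0 (ler0n _ 2) c0) P1) _ _ ww.
Qed.

(** Derivatives and multiples by t of a series are sums of such series: either f is changed, or the
    coefficients are multiplied by a factor linear in p, which preserves rapid decay. *)
Lemma schwartz_series a f : rapid a -> schwartz f -> schwartz (weyl_series a f).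
Proof.
move=> ra Sf.
apply: (@schwartz_span _ (fun g => exists a f, [/\ rapid a, schwartz f & g = weyl_series a f])).
- by move=> _ [b [g [rb Sg ->]]]; exact: series_bounded.
- move=> _ [b [g [rb Sg ->]]]; have [g' Sg' dg] := schwartz_derivable Sg.
  exists (fun t => weyl_series b g' t + weyl_series (fun p => weyl_freq p * b p) g t).
    apply: lspanD; apply: lspan_in; [by exists b, g'|].
    by exists (fun p => weyl_freq p * b p), g; split => //; exact: rapid_freq.
  exact: cderiv_series.
- move=> _ [b [g [rb Sg ->]]].
  have -> : mulX (weyl_series b g) = fun t => weyl_series b (mulX g) t + weyl_series (fun p =>
    rc (al * p.1%:~R) * b p) g t.
    apply/funext => t; rewrite /mulX /weyl_series -csum_scale; last exact: series_casums.
    rewrite -csumD; [|exact/series_casums/schwartz_mulX|exact/series_casums/Sg/rapid_shift].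
    congr csum; apply/funext => p; rewrite mulrCA -/(mulX _ t) weyl_mulX; ring.
  apply: lspanD; apply: lspan_in; first by exists b, (mulX g); split => //; exact: schwartz_mulX.
  by exists (fun p => rc (al * p.1%:~R) * b p), g; split => //; exact: rapid_shift.
by apply: lspan_in; exists a, f.
Qed.

Lemma weyl_decay f K p t : (forall t, (1 + t ^+ 2) * cabs (f t) <= K) ->
  (1 + t ^+ 2) * cabs (weyl_op p f t) <= 2 * (1 + al ^+ 2) * K * wt R p ^+ 2.
Proof.
move=> fK; rewrite cabs_weyl; have K0 : 0 <= K.
  by apply: le_trans (fK 0); rewrite mulr_ge0 ?oneDsqr_ge0 ?cabs_ge0.
apply: le_trans (decay_shift (- (al * p.1%:~R)) (@cabs_ge0 R) fK t) _.
rewrite (_ : 2 * (1 + al ^+ 2) * K * wt R p ^+ 2 = 2 * (wt R p ^+ 2 + al ^+ 2 * wt R p ^+ 2) *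
  K); last by ring.
rewrite ler_wpM2r// ler_wpM2l//; apply: lerD; first by rewrite exprn_ege1 ?wt_ge1.
rewrite sqrrN exprMn ler_wpM2l ?sqr_ge0// -[_ ^+ 2]real_normK ?num_real//.
by rewrite lerXn2r ?nnegrE ?wt_ge0 ?wt1.
Qed.

Lemma casums_cint_weyl a f u : rapid a -> schwartz f -> cmeasurable u ->
  (forall t, cabs (u t) <= 1) -> casums (fun p => a p * cintegral (fun t => u t * weyl_op p f t)).
Proof.
move=> ra Sf mu_ u1; have [K KP] := schwartz_decay Sf.
have [M MP] := rapid_weighted 2 ra; pose K' := 2 * (1 + al ^+ 2) * K.
have K0 : 0 <= K by apply: le_trans (KP 0); rewrite mulr_ge0 ?oneDsqr_ge0 ?cabs_ge0.
exists (cintK R * K' * M) => F.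
apply: (@le_trans _ _ (\sum_(p <- F) cintK R * K' * (cabs (a p) * wt R p ^+ 2))); last first.
  have K'0 : 0 <= K' by rewrite !mulr_ge0 ?oneDsqr_ge0.
  rewrite -mulr_sumr; exact: ler_wpM2l (mulr_ge0 (cintK_ge0 R) K'0) _ _ (MP F).
apply: ler_sum => p _; rewrite cabsM mulrCA ler_wpM2l ?cabs_ge0// -mulrA; apply: cint_le.
  by apply: decaying_mul => //; [exists 1|exact/schwartz_decaying/schwartz_weyl].
move=> t; rewrite cabsM mulrCA; apply: le_trans (weyl_decay p t KP).
by rewrite ler_piMl// mulr_ge0 ?oneDsqr_ge0 ?cabs_ge0.
Qed.

(* After multiplication by 1 + t ^ 2 the tail of the series is dominated, uniformly in t, by a
   multiple of the tail of \sum |a p| (wt p) ^ 2. *)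
Lemma cint_series a f u : rapid a -> schwartz f -> cmeasurable u -> (forall t, cabs (u t) <= 1) ->
  csums (fun p => a p * cintegral (fun t => u t * weyl_op p f t)) (cintegral (fun t =>
    u t * weyl_series a f t)).
Proof.
move=> ra Sf mu_ u1; have [K KP] := schwartz_decay Sf.
have K0 : 0 <= K by apply: le_trans (KP 0); rewrite mulr_ge0 ?oneDsqr_ge0 ?cabs_ge0.
have [M MP] := rapid_weighted 2 ra; pose K' := 2 * (1 + al ^+ 2) * K.
have K'0 : 0 <= K' by rewrite !mulr_ge0 ?oneDsqr_ge0.
have dec g : schwartz g -> decaying (fun t => u t * g t).
  by move=> /schwartz_decaying; apply: decaying_mul => //; exists 1.
refine (sums_approx (b := fun p => cabs (a p) * wt R p ^+ 2) (K := cintK R * K') _ MP _ _).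
- by move=> p; rewrite mulr_ge0 ?cabs_ge0 ?exprn_ge0 ?wt_ge0.
- by rewrite mulr_ge0 ?cintK_ge0.
move=> G T TP.
have SG : schwartz (fun t => \sum_(p <- G) a p * weyl_op p f t).
  by apply: schwartz_sum => p; exact/schwartzZ/schwartz_weyl.
have Ss := schwartz_series ra Sf.
have -> : \sum_(p <- G) a p * cintegral (fun t => u t * weyl_op p f t) - cintegral (fun t =>
  u t * weyl_series a f t)
   = cintegral (fun t => u t * (\sum_(p <- G) a p * weyl_op p f t - weyl_series a f t)).
  have -> : cintegral (fun t => u t * (\sum_(p <- G) a p * weyl_op p f t - weyl_series a f t)) =
      cintegral (fun t => u t * (\sum_(p <- G) a p * weyl_op p f t) - u t * weyl_series a f t).
    by apply: eq_cint => t; rewrite mulrBr.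
  rewrite cintB; [|exact: dec|exact: dec]; congr (_ - _).
  have -> : cintegral (fun t => u t * (\sum_(p <- G) a p * weyl_op p f t)) =
      cintegral (fun t => \sum_(p <- G) a p * (u t * weyl_op p f t)).
    by apply: eq_cint => t; rewrite mulr_sumr; apply: eq_bigr => p _; rewrite mulrCA.
  rewrite cint_sum; last by move=> p; apply/decayingZ/dec/schwartz_weyl.
  by apply: eq_bigr => p _; rewrite cintZ//; exact/dec/schwartz_weyl.
rewrite -mulrA; apply: cint_le; first exact/dec/schwartzB.
move=> t; have t1 := oneDsqr_ge0 t;
  have tp : 0 < 1 + t ^+ 2 by rewrite (lt_le_trans ltr01)// lerDl sqr_ge0.
rewrite cabsM mulrCA; apply: (@le_trans _ _ (1 * ((1 + t ^+ 2) * cabs (\sum_(p <- G) a p *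
  weyl_op p f t - weyl_series a f t)))).
  by rewrite ler_wpM2r// mulr_ge0 ?cabs_ge0.
rewrite mul1r cabs_dist mulrC -ler_pdivlMr//.
apply: (sums_tail (cabs_complete_norm R) (seriesP ra t Sf)) => H GH.
apply: le_trans (cabs_sum _ _) _; rewrite ler_pdivlMr// mulr_suml.
apply: le_trans (ler_wpM2l K'0 (TP _ GH)); rewrite mulr_sumr; apply: ler_sum => p _.
rewrite cabsM -mulrA [K' * _]mulrCA; apply: ler_wpM2l; first exact: cabs_ge0.
rewrite mulrC; exact: weyl_decay KP.
Qed.

Lemma wt_hexa_inv p : wt R p <= 2 * wt R (hexa p).
Proof.
have wE q : wt R q = (1 + `|q.1| + `|q.2|)%N%:R by rewrite !natrD.
by rewrite !wE -natrM ler_nat; case: p => m n /=; lia.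
Qed.

Lemma rapid_hexa a : rapid a -> rapid (a \o hexa).
Proof. by apply: (@rapid_reindex _ _ _ 2) => //; exact: wt_hexa_inv. Qed.

(** The integral passes through the sum by [cint_series] with the kernel as weight; then [opW_weyl]
    moves each term, and [hexa] reindexes. *)
Lemma opW_series a f : rapid a -> schwartz f -> opW (weyl_series a f) = weyl_series (a \o hexa)
  (opW f).
Proof.
move=> ra Sf; apply/funext => t.
have me : cmeasurable (fun x : R => e_ (t * x - x ^+ 2 / 2) : C).
  have := cderiv_cmeasurable (cderivM (cderiv_e_affine t 0) (cderiv_e_quad (- (1 / 2)))).
  rewrite (_ : (fun t0 => _) = (fun x : R => e_ (t * x - x ^+ 2 / 2) : C))//.
  by apply/funext => x; rewrite -e_D; congr e_; field.
have e1 (x : R) : cabs (e_ (t * x - x ^+ 2 / 2)) <= 1 by rewrite cabs_e.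
have E := csum_eq (cint_series ra Sf me e1).
rewrite {1}/opW (eq_cint (g := fun x => e_ (t * x - x ^+ 2 / 2) * weyl_series a f x)); last first.
  by move=> x; rewrite mulrC.
rewrite -E.
have ca := casums_cint_weyl ra Sf me e1.
rewrite -csum_scale// -(csum_bij hexaK hexa_invK); last first.
  by apply: (casums_le (K := 1)) ca => // p; rewrite mul1r cabsM cabs_e mul1r.
congr csum; apply/funext => p /=; rewrite -opW_weyl// /opW mulrCA; congr (_ * (_ * _)).
by apply: eq_cint => x; rewrite mulrC.
Qed.

End WeylOperators.

(** * The inner product and the Weyl frame *)

Section DualBasis.
Variable R : realType.
Local Notation C := R[i].
Local Notation rc := (real_complex R).
Local Notation pi := (@trigo.pi R).
Local Notation schwartz := (@Pilot.Defs.schwartz R).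
Variable al : R.
Hypothesis al_gt0 : 0 < al.
Implicit Types (f g h u : R -> C) (a b : int * int -> C) (p q : int * int).
Local Notation weyl := (weyl_op al).
Local Notation series := (weyl_series al).

(** Twisted convolution: the Weyl coefficients of the product of \sum a_p w_p and \sum b_q w_q. *)
Definition twisted a b p := csum (fun q => b q * (cocycle al (p - q) q * a (p - q))).

Lemma series_series a b f t : rapid a -> rapid b -> schwartz f ->
  series b (series a f) t = series (twisted a b) f t.
Proof.
move=> ra rb Sf; have [K KP] := schwartz_bounded0 Sf.
have K0 : 0 <= K := le_trans (cabs_ge0 _) (KP 0).
have Sab : casums (fun z : (int * int) * (int * int) => a z.1 * b z.2).
  apply: (@casums_prod _ _ _ _ a b) (rapid_casums ra) (rapid_casums rb) => z.
  by rewrite cabsM.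
(* The shear (p, q) -> (p - q, q) reduces absolute summability of the double series to that of a
   product. *)
pose G (z : (int * int) * (int * int)) := (z.1 - z.2, z.2).
have Ginj : injective G.
  move=> [x y] [x' y'] E; have /= E1 := congr1 fst E; have /= E2 := congr1 snd E.
  by rewrite -E2 in E1 *; rewrite (addIr _ E1).
pose v p q := b q * (cocycle al (p - q) q * a (p - q)) * weyl p f t.
have Sv : casums (fun z : (int * int) * (int * int) => v z.1 z.2).
  apply: casums_le K0 _ (casums_inj Ginj Sab) => -[p q] /=.
  rewrite /v cabsM cabs_weyl cabsM (cabsM (cocycle _ _ _)) cabs_cocycle mul1r cabsM mulrC [cabs
    (b q) * _]mulrC.
  by rewrite ler_wpM2r// mulr_ge0 ?cabs_ge0.
transitivity (csum (fun q => csum (fun p => v p q))).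
  rewrite {1}/weyl_series; congr csum; apply/funext => q.
  rewrite {1}/weyl_op /weyl_series mulrA -csum_scale; last exact: series_casums.
  have Sq : casums (v^~ q) by apply: (casums_inj (g := fun p => (p, q))) Sv => ? ? [].
  rewrite -(@csum_bij _ _ _ (v^~ q) (fun p => p + q) (fun p => p - q) (addrK q) (subrK q) Sq).
  congr csum; apply/funext => p; rewrite /v /= addrK.
  transitivity (b q * a p * weyl q (weyl p f) t); first by rewrite {2}/weyl_op; ring.
  by rewrite weyl_weyl; ring.
rewrite csum_exchange; last first.
  by apply: (casums_inj (g := fun z : (int * int) * (int * int) => (z.2, z.1))) Sv =>
    -[? ?] [? ?] [-> ->].
congr csum; apply/funext => p; rewrite mulrC -csum_scale; last first.
  have gi : injective (fun q => (p, q)) by move=> ? ? [].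
  apply: casums_le ler01 _ (casums_inj gi (casums_inj Ginj Sab)) => q /=.
  by rewrite mul1r !cabsM cabs_cocycle mul1r mulrC.
by congr csum; apply/funext => q; rewrite mulrC.
Qed.

Definition pair h f p := cintegral (fun t => h t * weyl p f t).

Lemma pair_decaying h f p : schwartz h -> schwartz f -> decaying (fun t => h t * weyl p f t).
Proof. by move=> Sh Sf; exact/schwartz_decaying/schwartzM/schwartz_weyl. Qed.

Lemma pair_mulX h f p : schwartz h -> schwartz f ->
  rc (al * p.1%:~R) * pair h f p = pair (mulX h) f p - pair h (mulX f) p.
Proof.
move=> Sh Sf; have SXh := schwartz_mulX Sh; have SXf := schwartz_mulX Sf.
rewrite /pair -cintB; try exact: pair_decaying.
rewrite -cintZ; last exact: pair_decaying.
apply: eq_cint => t; have := weyl_mulX al p f t; rewrite /mulX => E.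
transitivity (h t * (rc (al * p.1%:~R) * weyl p f t)); first by ring.
by rewrite [rc (al * _) * _](_ : _ = rc t * weyl p f t - weyl p (fun t => rc t * f t) t);
  [ring|rewrite E; ring].
Qed.

Lemma pair_deriv h h' f f' p : schwartz h -> schwartz f -> cderiv h h' -> cderiv f f' ->
  weyl_freq al p * pair h f p = - pair h' f p - pair h f' p.
Proof.
move=> Sh Sf dh df; have Sh' := schwartz_cderiv Sh dh; have Sf' := schwartz_cderiv Sf df.
have := cint_deriv (schwartzM Sh (schwartz_weyl al p Sf)) (cderivM dh (cderiv_weyl al p df)).
rewrite (eq_cint (g := fun t => h' t * weyl p f t + (h t * weyl p f' t + weyl_freq al p * (h t *
  weyl p f t)))); last first.
  by move=> t; ring.
rewrite cintD; [|exact: pair_decaying|exact/decayingD/decayingZ/pair_decaying/Sf/Sh/pair_decaying].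
rewrite cintD; [|exact: pair_decaying|exact/decayingZ/pair_decaying].
rewrite cintZ; last exact: pair_decaying.
move=> H; apply/eqP; rewrite -subr_eq0 opprB opprK -H /pair; apply/eqP; ring.
Qed.

(** Multiplication by p.1 is traded for [mulX], and by p.2 for differentiation, on [h] or on [f]; so
    the induction on the power must let both functions vary. *)
Lemma pair_rapid h f : schwartz h -> schwartz f -> rapid (pair h f).
Proof.
move=> Sh Sf; apply/rapidP => k; elim: k h f Sh Sf => [|k IH] h f Sh Sf.
  have [K1 B1] := schwartz_decay Sh; have [K2 B2] := schwartz_bounded0 Sf.
  exists (cintK R * (K1 * K2)) => p; rewrite expr0 mulr1.
  apply: cint_le; first exact: pair_decaying.
  move=> t; rewrite cabsM mulrA; apply: ler_pM;
    rewrite ?cabs_ge0 ?mulr_ge0 ?oneDsqr_ge0 ?cabs_ge0//.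
  by rewrite cabs_weyl.
have [h' Sh' dh] := schwartz_derivable Sh; have [f' Sf' df] := schwartz_derivable Sf.
have [K0 B0] := IH _ _ Sh Sf.
have [K1 B1] := IH _ _ (schwartz_mulX Sh) Sf; have [K2 B2] := IH _ _ Sh (schwartz_mulX Sf).
have [K3 B3] := IH _ _ Sh' Sf; have [K4 B4] := IH _ _ Sh Sf'.
exists (K0 + al^-1 * (K1 + K2) + (2 * pi * al)^-1 * (K3 + K4)) => p.
pose w := wt R p ^+ k; have w0 : 0 <= w by rewrite exprn_ge0 ?wt_ge0.
pose I := cabs (pair h f p).
have A1 : al * `|p.1|%N%:R * I <= cabs (pair (mulX h) f p) + cabs (pair h (mulX f) p).
  apply: le_trans (cabsB _ _); rewrite -pair_mulX// cabsM cabs_real normrM gtr0_norm//.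
  by rewrite natr_absz intr_norm.
have A2 : 2 * pi * al * `|p.2|%N%:R * I <= cabs (pair h' f p) + cabs (pair h f' p).
  rewrite -[X in _ <= X + _]cabsN; apply: le_trans (cabsB _ _).
  rewrite -(pair_deriv p Sh Sf dh df) cabsM /weyl_freq [cabs (Complex _ _)]/cabs /=.
  rewrite expr0n add0r sqrrN sqrtr_sqr normrM ger0_norm ?natr_absz ?intr_norm//.
  by rewrite !mulr_ge0 ?pi_ge0 ?ltW.
have c0 : 0 < 2 * pi * al by rewrite !mulr_gt0 ?pi_gt0.
have A1' : `|p.1|%N%:R * I * w <= al^-1 * (K1 + K2).
  rewrite ler_pdivlMl//.
  apply: le_trans (lerD (B1 p) (B2 p)); rewrite -mulrDl mulrA; apply: ler_wpM2r w0 _ _ _.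
  by rewrite mulrA.
have A2' : `|p.2|%N%:R * I * w <= (2 * pi * al)^-1 * (K3 + K4).
  rewrite ler_pdivlMl//.
  apply: le_trans (lerD (B3 p) (B4 p)); rewrite -mulrDl mulrA; apply: ler_wpM2r w0 _ _ _.
  by rewrite mulrA.
rewrite exprS -/w /wt -/I (_ : _ * _ = I * w + `|p.1|%N%:R * I * w + `|p.2|%N%:R * I * w);
  last by ring.
by apply: lerD A2'; apply: lerD A1'; exact: B0.
Qed.

(* the coefficients of the A_theta-valued inner product of h and f *)
Definition bracket h f p : C := rc al * pair h f (- p).

Lemma bracket_rapid h f : schwartz h -> schwartz f -> rapid (bracket h f).
Proof.
move=> Sh Sf; apply: rapid_scale; apply: (@rapid_reindex _ _ -%R 1 ler01 _ (pair_rapid Sh Sf)).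
by move=> p; rewrite mul1r /wt /= !abszN.
Qed.

(** For fixed m the sum over n is a Poisson sum of F(y) = g(s) h(s + y) u(t + y) with s = t - al m.
    The support condition on h leaves the single value F(0) = g(s) u(t). *)
Lemma series_bracket h g u t : schwartz h -> schwartz g -> schwartz u ->
  (forall s, g s != 0 -> h s = 1) ->
  (forall s y, g s != 0 -> (2 * al)^-1 < `|y| -> h (s + y) = 0) ->
  csums (fun m : int => g (t - al * m%:~R) * u t) (series (bracket h u) g t).
Proof.
move=> Sh Sg Su h1 h0; have rb := bracket_rapid Sh Su.
have Sw := series_casums al rb t Sg.
rewrite /weyl_series -(csum_fubini Sw).
have E (m : int) : csum (fun n =>
  bracket h u (m, n) * weyl (m, n) g t) = g (t - al * m%:~R) * u t.
  pose s := t - al * m%:~R; pose F y := g s * (h (y + s) * u (y + t)).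
  have SF : schwartz F by apply: schwartzZ; apply: schwartzM; exact: schwartz_shift.
  have T n : bracket h u (m, n) * weyl (m, n) g t = rc al * cintegral (fun y =>
    F y * e_ (al * n%:~R * y)).
    rewrite /bracket -mulrA; congr (_ * _).
    rewrite /pair -(cint_shift s (pair_decaying _ Sh Su)) mulrC -cintZ;
      last exact: (decaying_shift s (pair_decaying _ Sh Su)).
    apply: eq_cint => y; rewrite /weyl_op /F /= -/s.
    rewrite (_ : y + s - al * (- m)%:~R = y + t); last by rewrite /s intrN; ring.
    rewrite (_ : e_ (al * n%:~R * y) = e_ (al ^+ 2 * (m * n)%:~R / 2 - al * n%:~R * t) *
       e_ (al ^+ 2 * (- m * - n)%:~R / 2 - al * (- n)%:~R * (y + s))); first by ring.
    by rewrite -e_D; congr e_; rewrite /s !(intrM, intrN); field.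
  under eq_fun do rewrite T.
  rewrite (poisson_compact al_gt0 SF).
  - rewrite /F !add0r; have [->|/h1 ->] := eqVneq (g s) 0; first by rewrite !mul0r.
    by rewrite mul1r.
  - move=> y hy; rewrite /F; have [->|gs] := eqVneq (g s) 0; first by rewrite mul0r.
    by rewrite addrC (h0 _ _ gs hy) mul0r mulr0.
  by have := casums_section Sw m; under eq_fun do rewrite T.
have := csumP (casums_iter Sw); under eq_fun do rewrite E; done.
Qed.

Lemma weyl_frame : exists (N : nat) (g h : 'I_N -> R -> C),
  [/\ forall i, schwartz (g i), forall i, schwartz (h i),
      forall u t, schwartz u -> \sum_i series (bracket (h i) u) (g i) t = u t &
      \sum_i rc al * cintegral (fun t => h i t * g i t) = rc (al ^+ 2)].
Proof.
(* N >= 6 al^2 steps of length d = al / N give 3 d <= 1 / (2 al), the half period allowed by Poisson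
   summation. *)
pose N := (Num.bound (6 * al ^+ 2)).+1.
have NP : 6 * al ^+ 2 <= N%:R.
  apply: le_trans (ltW (archi_boundP _)) _; first by rewrite mulr_ge0 ?sqr_ge0.
  by rewrite ler_nat.
have N0 : 0 < N%:R :> R by rewrite ltr0n.
pose d := al / N%:R; have d0 : 0 < d by rewrite divr_gt0.
have Nd : N%:R * d = al by rewrite mulrC divfK// gt_eqF.
have d3 : 3 * d <= (2 * al)^-1.
  rewrite -[leRHS]mul1r ler_pdivlMr ?mulr_gt0// (_ : 3 * d * (2 * al) = 6 * al ^+ 2 / N%:R);
    last by rewrite /d; ring.
  by rewrite ler_pdivrMr// mul1r.
have [s [b [Sb sb s0 s1 b1]]] := smooth_step d0.
(* With transition d, [pl] is supported in [0, 2 d]; [ph], moved left by d, is 1 on [0, 2 d] and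
   supported in [- d, 3 d]. *)
pose pl := plateau s d; pose ph := plateau s (3 * d).
have d30 : 0 < 3 * d by rewrite mulr_gt0.
have Spl : schwartz pl := schwartz_plateau Sb sb s0 s1 d0.
have Sph : schwartz ph := schwartz_plateau Sb sb s0 s1 d30.
pose g (i : 'I_N) t := pl (t - i%:R * d).
pose h (i : 'I_N) t := ph (t - i%:R * d + d).
have Sg i : schwartz (g i) by exact: (schwartz_shift (- (i%:R * d)) Spl).
have Sh i : schwartz (h i).
  by exact: (schwartz_shift (- (i%:R * d)) (schwartz_shift d Sph)).
have gsupp i t : g i t != 0 -> 0 <= t - i%:R * d <= 2 * d.
  move=> gt; apply/andP; split; rewrite leNgt; apply/negP => /ltW tl; move/eqP: gt; apply.
    exact: (plateau_left s0 d0).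
  by apply: (plateau_right s1 d0); lra.
have h1 i t : g i t != 0 -> h i t = 1.
  by move=> /gsupp/andP[t0 t1]; apply: (plateau_mid s0 s1); lra.
have h0 i t y : g i t != 0 -> (2 * al)^-1 < `|y| -> h i (t + y) = 0.
  move=> /gsupp/andP[t0 t1] hy; have {}hy : 3 * d < `|y| by exact: le_lt_trans hy.
  rewrite /h; have [y0|y0] := leP 0 y.
    by rewrite ger0_norm// in hy; apply: (plateau_right s1 d30); lra.
  by rewrite ltr0_norm// in hy; apply: (plateau_left s0 d30); lra.
exists N, g, h; split => //.
- move=> u t Su.
  have gsum x : \sum_i g i x = s x - s (x - al).
    rewrite -Nd; rewrite /g /pl /plateau.
    transitivity (\sum_(i < N) ((fun k : nat => - s (x - k%:R * d)) i.+1 - (fun k : nat =>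
      - s (x - k%:R * d)) i)).
      apply: eq_bigr => i _ /=; rewrite opprK [RHS]addrC; congr (_ - s _).
      by rewrite -natr1; ring.
    rewrite -(big_mkord xpredT (fun i => (fun k : nat =>
      - s (x - k%:R * d)) i.+1 - (fun k : nat => - s (x - k%:R * d)) i)).
    by rewrite telescope_sumr// mul0r subr0 opprK addrC.
  have S1 := sums_sum (cabs_complete_norm R) (index_enum 'I_N)
    (fun i => series_bracket t (Sh i) (Sg i) Su (@h1 i) (@h0 i)).
  have S2 := sums_delta (cabs_complete_norm R) (u := fun m : int =>
    (- u t) * (m == 0)%:R) (j := 0).
  have {}S2 := S2 _; rewrite eqxx mulr1 in S2.
  have S := sumsD (cabs_complete_norm R) S1 (S2 _).
  apply/eqP; rewrite -subr_eq0; apply/eqP.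
  (* The sum of the g_i is s(x) - s(x - al), so the sum over m telescopes; the step in m absorbs the
     term u(t) at m = 0 and makes v vanish far out at both ends. *)
  pose v (m : int) := u t * (((m : int) <= 0)%R%:R - s (t - al * m%:~R)).
  have lim0 (w : nat -> C) (B : R) : (forall n : nat,
    B <= al * n.+1%:R -> w n = 0) -> cabs (w n) @[n --> \oo] --> (0 : R).
    move=> wB; apply: cvg_near_cst; near=> n; rewrite wB ?cabs0//.
    rewrite -ler_pdivrMl//; apply: le_trans (_ : n%:R <= _); last by rewrite ler_nat.
    by near: n; exact: nbhs_infty_ger.
  apply: (telescoping_sum (v := v) (S _)).
  - by move=> m m0; rewrite (negbTE m0) mulr0.
  - move=> m; rewrite -mulr_suml gsum /v -mulrBr (_ : t - al * (m + 1)%:~R = t - al * m%:~R -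
      al); last first.
      by rewrite intrD mulr1z; ring.
    rewrite (_ : (m + 1 <= 0)%R = (m <= 0)%R && (m != 0)); last by lia.
    have [->|m0] := eqVneq m 0; first by rewrite lexx /=; ring.
    by rewrite andbT mulr0; ring.
  - apply: (lim0 _ t) => n tn; rewrite /v s0 ?subr0; last by rewrite subr_le0.
    by rewrite mulr0.
  - apply: (lim0 _ (d - t)) => n tn; rewrite /v s1; last by rewrite mulrNz mulrN opprK -pmulrn;
      lra.
    by rewrite (_ : (- n.+1%:Z <= 0)%R) ?subrr ?mulr0//; lia.
(* h_i is 1 on the support of g_i, so each integral is the width d of the plateau, and al N d =
   al^2. *)
- have -> : \sum_i rc al * cintegral (fun t => h i t * g i t) = \sum_(i < N) rc (al * d).
    apply: eq_bigr => i _; rewrite (rmorphM (real_complex R) al d); congr (_ * _).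
    transitivity (cintegral pl); last exact: (cint_plateau Sb sb s0 s1 b1 d0).
    rewrite -(cint_shift (- (i%:R * d)) (schwartz_decaying Spl)).
    apply: eq_cint => t; have [gt|/h1 ->] := eqVneq (g i t) 0; last by rewrite mul1r.
    by rewrite gt mulr0.
  by rewrite sumr_const card_ord -rmorphMn -mulr_natr -mulrA [d * _]mulrC Nd.
Unshelve. all: by end_near. Qed.

End DualBasis.

(** * Smooth elements of the rotation algebra *)

Section RotationElements.
Variable R : realType.
Local Notation C := R[i].
Variable al : R.
Variable B : cstarAlgType R.
Implicit Types (x y z : B) (a b : int * int -> C) (p q : int * int).

Lemma cnorm0 : cnorm (0 : B) = 0.
Proof. by rewrite -(scale0r (0 : B)) cnormZ normr0 /= mul0r. Qed.

Lemma cnormN x : cnorm (- x) = cnorm x.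
Proof. by rewrite -scaleN1r cnormZ normrN1 /= mul1r. Qed.

Lemma cnorm_ge0 x : 0 <= cnorm x.
Proof. by have := cnormD x (- x); rewrite subrr cnorm0 cnormN; lra. Qed.

Lemma cnorm_complete_norm : complete_norm (@cnorm R B).
Proof.
split; [exact: cnorm0|exact: cnormN|exact: cnormD|exact: cnorm0_eq0|exact: cnorm_complete].
Qed.

Lemma cnormZE (c : C) x : cnorm (c *: x) = cabs c * cnorm x.
Proof. by rewrite cnormZ cabsE. Qed.

Lemma star1 : star (1 : B) = 1.
Proof.
by rewrite -[LHS]mulr1 -[X in _ * X](starK 1) -starM mulr1 starK.
Qed.

Lemma cnorm_unitary x : unitary x -> cnorm x <= 1.
Proof.
move=> [xx _]; have h1 : cnorm (1 : B) <= 1.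
  have := cnorm_cstar (1 : B); rewrite star1 mulr1 expr2 => h.
  have [->|n1] := eqVneq (cnorm (1 : B)) 0; first exact: ler01.
  by rewrite -[leRHS](divff n1) {2}h mulfK.
by rewrite -(@expr_le1 _ 2) ?cnorm_ge0// -cnorm_cstar xx.
Qed.

Lemma unitary1 : unitary (1 : B).
Proof. by rewrite /unitary star1 mulr1. Qed.

Lemma unitaryM x y : unitary x -> unitary y -> unitary (x * y).
Proof.
move=> [x1 x2] [y1 y2]; rewrite /unitary starM; split.
  by rewrite mulrA -[_ * star x * x]mulrA x1 mulr1.
by rewrite mulrA -[x * y * star y]mulrA y2 mulr1.
Qed.

Lemma unitary_star x : unitary x -> unitary (star x).
Proof. by case=> x1 x2; rewrite /unitary starK. Qed.

Lemma unitaryX x n : unitary x -> unitary (x ^+ n).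
Proof.
move=> ux; elim: n => [|n IH]; first by rewrite expr0; exact: unitary1.
by rewrite exprS; exact: unitaryM.
Qed.

Lemma unitary_upow x m : unitary x -> unitary (upow x m).
Proof. by move=> ux; case: m => n; apply: unitaryX => //; exact: unitary_star. Qed.

Lemma unitaryZ (c : C) x : cabs c = 1 -> unitary x -> unitary (c *: x).
Proof.
move=> c1 [x1 x2]; rewrite /unitary starZ -!scalerAl -!scalerAr !scalerA x1 x2.
by rewrite mulr_conj_cabs1// mulrC mulr_conj_cabs1// scale1r.
Qed.

Lemma upow1 x : upow x 1 = x. Proof. exact: expr1. Qed.

Lemma upow_succ x m : unitary x -> upow x (m + 1) = upow x m * x.
Proof.
move=> [x1 _]; case: m => [n|[|n]]; first by rewrite -PoszD addn1 /= exprSr.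
  by rewrite /= expr1 x1.
rewrite (_ : (Negz n.+1 + 1)%R = Negz n); last by rewrite !NegzE; lia.
by rewrite /= [in RHS]exprSr -[RHS]mulrA x1 mulr1.
Qed.

Lemma upow_pred x m : unitary x -> upow x (m - 1) = upow x m * star x.
Proof.
move=> ux; have := upow_succ (m - 1) ux; rewrite subrK => ->.
by case: ux => _ x2; rewrite -mulrA x2 mulr1.
Qed.

Lemma upow_ind (P : int -> Prop) : P 0 -> (forall m, P m -> P (m + 1)) ->
  (forall m, P m -> P (m - 1)) -> forall m, P m.
Proof.
move=> P0 Ps Pp; elim/int_rect => [//|n IH|n IH]; first by rewrite -addn1 PoszD; exact: Ps.
by rewrite -addn1 PoszD opprD; exact: Pp.
Qed.

Lemma upowD x m n : unitary x -> upow x (m + n) = upow x m * upow x n.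
Proof.
move=> ux; elim/upow_ind: n => [|n IH|n IH]; first by rewrite addr0 mulr1.
  by rewrite addrA !upow_succ// IH mulrA.
by rewrite addrA !upow_pred// IH mulrA.
Qed.

Section Twist.
Variables (x y : B).
Hypothesis ux : unitary x.

Lemma twist_star (c c' : C) : c' * c = 1 -> y * x = c *: (x * y) ->
  y * star x = c' *: (star x * y).
Proof.
case: ux => x1 x2 cc yx.
have E : x * (y * star x) = c' *: (x * (star x * y)).
  by rewrite !mulrA x2 mul1r -[y in RHS]mulr1 -x2 mulrA yx -scalerAl scalerA cc scale1r.
by rewrite -[LHS]mul1r -x1 -mulrA E -scalerAr !mulrA x1 mul1r.
Qed.

Lemma twist_upow_r t : y * x = e_ t *: (x * y) ->
  forall m : int, y * upow x m = e_ (t * m%:~R) *: (upow x m * y).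
Proof.
move=> yx m; have yx' : y * star x = e_ (- t) *: (star x * y).
  by apply: twist_star yx; rewrite -e_D addNr e_0.
elim/upow_ind: m => [|m IH|m IH]; first by rewrite mulr0 e_0 scale1r mulr1 mul1r.
  rewrite upow_succ// mulrA IH -scalerAl -(mulrA _ y x) yx -scalerAr scalerA -e_D mulrA.
  by congr (e_ _ *: _); rewrite intrD mulr1z; ring.
rewrite upow_pred// mulrA IH -scalerAl -(mulrA _ y (star x)) yx' -scalerAr scalerA -e_D mulrA.
by congr (e_ _ *: _); rewrite intrD mulrNz mulr1z; ring.
Qed.

End Twist.

(** The relation is first raised to a power of x, then read with the roles of the two sides
    exchanged and raised to a power of y. *)
Lemma twist_upow x y t : unitary x -> unitary y -> y * x = e_ t *: (x * y) ->
  forall m n : int, upow y n * upow x m = e_ (t * (n * m)%:~R) *: (upow x m * upow y n).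
Proof.
move=> ux uy yx m n; have h := twist_upow_r ux yx m.
have h' : upow x m * y = e_ (- (t * m%:~R)) *: (y * upow x m).
  by rewrite h scalerA -e_D addNr e_0 scale1r.
rewrite (_ : upow x m * upow y n = e_ (- (t * m%:~R) * n%:~R) *: (upow y n * upow x m));
  last exact: twist_upow_r.
by rewrite scalerA -e_D intrM mulNr mulrA [_ * n%:~R * _]mulrAC subrr e_0 scale1r.
Qed.

Variables U V W : B.
Hypothesis rel : rel6 (al ^+ 2) U V W.

Let uU : unitary U. Proof. by case: rel => -[]. Qed.
Let uV : unitary V. Proof. by case: rel => -[]. Qed.
Let uW : unitary W. Proof. by case: rel => -[]. Qed.

Definition wel p : B := e_ (al ^+ 2 * (p.1 * p.2)%:~R / 2) *: mono U V p.

Lemma unitary_wel p : unitary (wel p).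
Proof.
by apply: unitaryZ; [exact: cabs_e|apply: unitaryM; exact: unitary_upow].
Qed.

Lemma mono_wel p : mono U V p = e_ (- (al ^+ 2 * (p.1 * p.2)%:~R / 2)) *: wel p.
Proof. by rewrite scalerA -e_D addNr e_0 scale1r. Qed.

Lemma welM p q : wel p * wel q = cocycle al p q *: wel (p + q).
Proof.
have [_ VU _ _ _] := rel; case: p => m n; case: q => m' n'.
rewrite /wel /mono /cocycle /= -scalerAl -scalerAr !scalerA !upowD//.
rewrite -(mulrA (upow U m) (upow V n)) [upow V n * (upow U m' * _)]mulrA (twist_upow uU uV VU).
  rewrite -(scalerAl _ (upow U m' * upow V n)) -scalerAr scalerA !mulrA.
by rewrite -!e_D; congr (e_ _ *: _); rewrite !(intrD, intrM, intrN); field.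
Qed.

Lemma wel0 : wel 0 = 1.
Proof. by rewrite /wel /mono /= !mulr0 mul0r e_0 scale1r mulr1. Qed.

Lemma wel_U m : wel (m, 0) = upow U m.
Proof. by rewrite /wel /mono mulr0 mulr0z mulr0 mul0r e_0 scale1r mulr1. Qed.

Lemma wel_V n : wel (0, n) = upow V n.
Proof. by rewrite /wel /mono mul0r mulr0z mulr0 mul0r e_0 scale1r mul1r. Qed.

Lemma cocycleN p : cocycle al (- p) p = 1.
Proof. by rewrite /cocycle /= (_ : - p.2 * p.1 - - p.1 * p.2 = 0) ?mulr0 ?mul0r ?e_0//; ring. Qed.

Lemma cocycleNr p : cocycle al p (- p) = 1.
Proof. by rewrite /cocycle /= (_ : p.2 * - p.1 - p.1 * - p.2 = 0) ?mulr0 ?mul0r ?e_0//; ring. Qed.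

Lemma welNl p : wel (- p) * wel p = 1.
Proof. by rewrite welM cocycleN addNr wel0 scale1r. Qed.

Lemma welNr p : wel p * wel (- p) = 1.
Proof. by rewrite welM cocycleNr addrN wel0 scale1r. Qed.

(** Induction over Z^2 as a group, so that a multiplicative relation between Weyl elements is
    checked on U and V only. *)
Lemma Z2_ind (P : int * int -> Prop) : P (1, 0) -> P (0, 1) ->
  (forall p q, P p -> P q -> P (p + q)) -> (forall p, P p -> P (- p)) -> forall p, P p.
Proof.
move=> P1 P2 PD PN; have P0 : P 0 by rewrite -(subrr (1, 0)); apply: PD => //; exact: PN.
have Pl m : P (m, 0).
  by elim/upow_ind: m => [|m IH|m IH]; [exact: P0|exact: PD IH P1|exact: PD IH (PN _ P1)].
have Pr m : P (0, m).
  by elim/upow_ind: m => [|m IH|m IH]; [exact: P0|exact: PD IH P2|exact: PD IH (PN _ P2)].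
by case=> m n; have := PD _ _ (Pl m) (Pr n);
  rewrite [(m, 0) + _](_ : _ = (m + 0, 0 + n))// addr0 add0r.
Qed.

Lemma hexaD p q : hexa p + hexa q = hexa (p + q).
Proof.
case: p q => m n [m' n'].
by change ((- n + - n', (m + n) + (m' + n')) = (- (n + n'), (m + m') + (n + n')));
  rewrite opprD addrACA.
Qed.

Lemma hexaN p : hexa (- p) = - hexa p.
Proof. by case: p => m n; change ((- - n, - m + - n) = (- - n, - (m + n))); rewrite opprD. Qed.

(** [hexa] preserves determinants, hence the cocycle, so the relation extends from the generators,
    where it is the defining relation of the crossed product. *)
Lemma W_wel p : W * wel p = wel (hexa p) * W.
Proof.
have [_ _ WU WV _] := rel; have [W1 _] := uW.
elim/Z2_ind: p => [||p q Ep Eq|p Ep].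
- change (W * wel (1, 0) = wel (0, 1) * W); rewrite wel_U wel_V !upow1.
  by rewrite -WU -mulrA W1 mulr1.
- have -> : wel (hexa (0, 1)) = e_ (- (al ^+ 2 / 2)) *: (star U * V).
    rewrite /wel /mono (_ : hexa (0, 1) = (-1, 1))//; congr (e_ _ *: (_ * _)).
    by rewrite /= mulr1 mulrN1z mulrN1 mulNr.
  by rewrite wel_V upow1 -WV -mulrA W1 mulr1.
- have E : W * (wel p * wel q) = wel (hexa p) * wel (hexa q) * W.
    by rewrite mulrA Ep -mulrA Eq mulrA.
  move: E; rewrite !welM -scalerAr -scalerAl.
  rewrite hexaD.
  have -> : cocycle al (hexa p) (hexa q) = cocycle al p q.
    by rewrite /cocycle /hexa /=; congr (e_ (_ * _%:~R / _)); ring.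
  move=> /(congr1 (fun z => (cocycle al p q)^-1 *: z)).
  by rewrite !scalerA mulVf ?e_neq0// !scale1r.
rewrite hexaN.
have := congr1 (fun z => wel (- hexa p) * z * wel (- p)) Ep => /=.
by rewrite -!mulrA welNr mulr1 mulrA welNl mul1r => ->.
Qed.

Lemma WX_wel k p : W ^+ k * wel p = wel (iter k hexa p) * W ^+ k.
Proof.
elim: k p => [|k IH] p; first by rewrite mul1r mulr1.
by rewrite exprS -mulrA IH mulrA W_wel -mulrA.
Qed.

Lemma partial_sumE (V' : zmodType) (I : choiceType) (u : I -> V') G :
  summability.partial_sum u G = \sum_(i <- G) u i.
Proof. by rewrite big_seq_fsetE. Qed.

Lemma has_sumE u x : has_sum u x <-> sums (@cnorm R B) u x.
Proof.
split.
  move=> H e e0; have tF : Filter (@summability.totally (int * int)%type) := @filter_filter _ _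
    (@summability.totally_filter (int * int)%type).
  have /cvgrPdist_lt/(_ _ e0)[F _ FP] := H; exists F => G FG.
  have := FP G FG; rewrite sub0r normrN ger0_norm ?cnorm_ge0//.
  by rewrite partial_sumE.
have tF : Filter (@summability.totally (int * int)%type) := @filter_filter _ _
  (@summability.totally_filter (int * int)%type).
move=> H; apply/cvgrPdist_lt => e e0; have [F FP] := H _ e0; exists F => // G FG.
rewrite sub0r normrN ger0_norm ?cnorm_ge0// partial_sumE.
exact: FP.
Qed.

Definition wel_series b y := rapid b /\ sums (@cnorm R B) (fun p => b p *: wel p) y.

Lemma rapid_phase a (t : int * int -> R) : rapid a -> rapid (fun p => a p * e_ (t p)).
Proof.
move=> /(@rapid_mul _ _ (fun p => e_ (t p)) 1 0 ler01 _) H.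
by under eq_fun do rewrite mulrC; apply: H => p; rewrite cabs_e expr0 mulr1.
Qed.

(** Passing from monomials to Weyl elements multiplies the coefficients by phases, which keeps rapid
    decay. *)
Lemma is_series_wseries a y : is_series U V a y ->
  wel_series (fun p => a p * e_ (- (al ^+ 2 * (p.1 * p.2)%:~R / 2))) y.
Proof.
move=> [ra /has_sumE H]; split; first exact: rapid_phase.
by apply: eq_sums H => p; rewrite mono_wel scalerA.
Qed.

Lemma wseries_is_series b y : wel_series b y ->
  is_series U V (fun p => b p * e_ (al ^+ 2 * (p.1 * p.2)%:~R / 2)) y.
Proof.
move=> [rb H]; split; first exact: rapid_phase.
by apply/has_sumE; apply: eq_sums H => p; rewrite /wel scalerA.
Qed.

Lemma smoothA_wseries y : smoothA U V y <-> exists b, wel_series b y.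
Proof.
split=> [[a /is_series_wseries H]|[b /wseries_is_series H]]; last by eexists; exact: H.
by eexists; exact: H.
Qed.

Lemma wseries_exists b : rapid b -> exists y, wel_series b y.
Proof.
move=> rb; have [M MP] := rapid_casums rb.
have [|y yP] := sums_exists cnorm_complete_norm (u := fun p => b p *: wel p).
  exists M; apply: bounded_sumsS MP => p.
  by rewrite cnormZE ler_piMr ?cabs_ge0 ?cnorm_unitary//; exact: unitary_wel.
by exists y.
Qed.

Lemma wseries_inj b y z : wel_series b y -> wel_series b z -> y = z.
Proof. by move=> [_ H1] [_ H2]; exact: (sums_unique cnorm_complete_norm H1 H2). Qed.

Lemma wseries0 : wel_series (fun=> 0) 0.
Proof.
split; first by apply: (rapid_supp1 (q := 0)).
by apply: eq_sums (sums0 cnorm_complete_norm _) => p; rewrite scale0r.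
Qed.

Lemma wseriesD b c y z : wel_series b y -> wel_series c z -> wel_series (fun p =>
  b p + c p) (y + z).
Proof.
move=> [rb Sb] [rc_ Sc]; split; first exact: rapidD.
by apply: eq_sums (sumsD cnorm_complete_norm Sb Sc) => p; rewrite scalerDl.
Qed.

Lemma wseriesZ (k : C) b y : wel_series b y -> wel_series (fun p => k * b p) (k *: y).
Proof.
move=> [rb Sb]; split; first exact: rapid_scale.
have := sums_morph (f := ( *:%R k : {additive B -> B})) (N' := @cnorm R B) (cabs_ge0 k) _ Sb.
move=> H; apply: eq_sums (H _) => [p|x]; first by rewrite /= scalerA.
by rewrite cnormZE.
Qed.

Lemma wseries_wel p : wel_series (fun q => (q == p)%:R) (wel p).
Proof.
split; first by apply: (rapid_supp1 (q := p)) => q /negbTE ->.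
have := sums_delta cnorm_complete_norm (u := fun q => ((q == p)%:R : C) *: wel q) (j := p).
by rewrite eqxx scale1r; apply => q /negbTE ->; rewrite scale0r.
Qed.

Lemma wseries1 : wel_series (fun q => (q == 0)%:R) 1.
Proof. by rewrite -wel0; exact: wseries_wel. Qed.

End RotationElements.

(** * Coefficients of smooth elements *)

Section Coefficients.
Variable R : realType.
Local Notation C := R[i].
Variable al : R.
Variable B : cstarAlgType R.
Implicit Types (x y z : B) (a b : int * int -> C) (p q : int * int).
Variables U V W : B.
Hypothesis rel : rel6 (al ^+ 2) U V W.
Variable tau : B -> C.
Hypothesis tauP : canonical_trace U V W tau.
Local Notation wel := (wel al U V).
Local Notation wseries := (wel_series al U V).

Local Notation sAw := (smoothA_wseries al U V).

Lemma tauZD (c : C) x y : tau (c *: x + y) = c * tau x + tau y.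
Proof. by case: tauP => -[]. Qed.

Lemma tau_0 : tau 0 = 0.
Proof. by have := tauZD (-1) 0 0; rewrite scaler0 addr0 mulN1r addNr. Qed.

Lemma tau_D x y : tau (x + y) = tau x + tau y.
Proof. by have := tauZD 1 x y; rewrite scale1r mul1r. Qed.

Lemma tau_Z (c : C) x : tau (c *: x) = c * tau x.
Proof. by have := tauZD c x 0; rewrite tau_0 !addr0. Qed.

Lemma tau_N x : tau (- x) = - tau x.
Proof. by rewrite -scaleN1r tau_Z mulN1r. Qed.

Lemma tau_sum (I : Type) (s : seq I) (F : I -> B) : tau (\sum_(i <- s) F i) = \sum_(i <- s) tau
  (F i).
Proof. exact: (big_morph tau tau_D tau_0). Qed.

Lemma tauC x y : tau (x * y) = tau (y * x).
Proof. by case: tauP => -[]. Qed.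

Lemma cabs_tau x : cabs (tau x) <= cnorm x.
Proof. by case: tauP => -[_ _ H _ _] _; rewrite -normC_le. Qed.

Lemma sums_tau (I : choiceType) (u : I -> B) s : sums (@cnorm R B) u s -> csums (tau \o u) (tau
  s).
Proof.
move=> H e e0; have [F FP] := H e e0; exists F => G /FP; apply: le_lt_trans.
by rewrite -tau_sum -tau_N -tau_D; exact: cabs_tau.
Qed.

Lemma W6 : W ^+ 6 = 1. Proof. by case: rel. Qed.

Lemma WX_mod m : W ^+ m = W ^+ (m %% 6).
Proof. by rewrite {1}(divn_eq m 6) exprD mulnC exprM W6 expr1n mul1r. Qed.

Lemma tau_expand (y : 'I_6 -> B) (b : 'I_6 -> int * int -> C) :
  (forall j, wseries (b j) (y j)) -> tau (\sum_j y j * W ^+ j) = b ord0 0.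
Proof.
move=> Hy; case: tauP => _ H; rewrite (H _ _ _ (wseries_is_series (Hy ord0))).
  by rewrite mul0r mulr0z mulr0 mul0r e_0 mulr1.
by move=> j; apply/sAw; exists (b j).
Qed.

Lemma tau_WX b y m : wseries b y -> tau (y * W ^+ m) = (6 %| m)%:R * b 0.
Proof.
move=> Hy; have m6 : (m %% 6 < 6)%N by rewrite ltn_mod.
rewrite WX_mod; pose i0 := Ordinal m6.
have H := @tau_expand (fun j => if j == i0 then y else 0)
  (fun j => if j == i0 then b else fun=> 0) _.
have E : \sum_j (if j == i0 then y else 0) * W ^+ j = y * W ^+ (m %% 6).
  rewrite (bigD1 i0)//= eqxx big1 ?addr0// => j /negbTE ->; exact: mul0r.
rewrite -E H; last by move=> j; case: ifP => // _; exact: wseries0.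
rewrite /dvdn -val_eqE /= eq_sym; case: ifP; rewrite ?mul1r ?mul0r//.
Qed.

(** Submultiplicativity of the weight: translating a rapidly decreasing family by q changes its
    bounds by powers of wt q only. *)
Lemma wtD p q : wt R (p + q) <= wt R p * wt R q.
Proof.
have wE r : wt R r = (1 + `|r.1| + `|r.2|)%N%:R by rewrite !natrD.
rewrite !wE -natrM ler_nat; case: p q => m n [m' n'] /=.
have h1 : (`|(m + m')%R| <= `|m| + `|m'|)%N by lia.
have h2 : (`|(n + n')%R| <= `|n| + `|n'|)%N by lia.
nia.
Qed.

Lemma wseries_mulr b y q : wseries b y ->
  wseries (fun p => b (p - q) * cocycle al (p - q) q) (y * wel q).
Proof.
move=> [rb Sb]; split.
  have rr : rapid (fun p => b (p - q)).
    apply: (rapid_reindex (wt_ge0 R q) _ rb) => p.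
    by rewrite -{1}(subrK q p) mulrC; exact: wtD.
  exact: rapid_phase.
have H : sums (@cnorm R B) (fun p => b p *: wel p * wel q) (y * wel q).
  move=> e e0; have [F FP] := Sb e e0; exists F => G /FP; apply: le_lt_trans.
  rewrite -mulr_suml -mulrBl; apply: le_trans (cnormM _ _) _.
  by rewrite ler_piMr ?cnorm_ge0 ?cnorm_unitary//; exact: (unitary_wel rel).
have := sums_bij (g := fun p => p - q) (h := fun p => p + q) (subrK q) (addrK q) H.
apply: eq_sums => p /=; rewrite -scalerAl (welM rel) scalerA subrK //.
Qed.

(** W^5 is the inverse of W, and W^5 w_(hexa p) W = w_p. *)
Lemma wseries_conj b y : wseries b y -> wseries (b \o hexa) (W ^+ 5 * y * W).
Proof.
move=> [rb Sb]; split; first exact: rapid_hexa.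
have H : sums (@cnorm R B) (fun p => W ^+ 5 * (b p *: wel p) * W) (W ^+ 5 * y * W).
  move=> e e0; have [F FP] := Sb e e0; exists F => G /FP; apply: le_lt_trans.
  rewrite -mulr_suml -mulr_sumr -mulrBl -mulrBr; apply: le_trans (cnormM _ _) _.
  have uW : unitary W by case: rel => -[].
  have n1 : cnorm W <= 1 by exact: cnorm_unitary.
  have n5 : cnorm (W ^+ 5) <= 1 by exact/cnorm_unitary/unitaryX.
  apply: le_trans (ler_piMr (cnorm_ge0 _) n1) _; apply: le_trans (cnormM _ _) _.
  by rewrite ler_piMl ?cnorm_ge0.
have := sums_bij hexaK hexa_invK H.
apply: eq_sums => p /=.
by rewrite -scalerAr -scalerAl -mulrA -(W_wel rel) mulrA -exprSr W6 mul1r.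
Qed.

Lemma wseries_conjX k b y : wseries b y ->
  wseries (b \o iter k hexa) (W ^+ (5 * k) * y * W ^+ k).
Proof.
move=> Hy; elim: k => [|k /wseries_conj IH]; first by rewrite !expr0 mul1r mulr1.
have -> : W ^+ (5 * k.+1) * y * W ^+ k.+1 = W ^+ 5 * (W ^+ (5 * k) * y * W ^+ k) * W.
  by rewrite mulnS exprD [W ^+ k.+1]exprSr !mulrA.
by move: IH; congr wel_series; apply/funext => p /=; rewrite -iterSr.
Qed.

Lemma smoothA_conjX k y : smoothA U V y -> smoothA U V (W ^+ (5 * k) * y * W ^+ k).
Proof.
move=> /sAw[b Hb]; apply/sAw.
by exists (b \o iter k hexa); exact: wseries_conjX.
Qed.

(* The coefficients of x = \sum_j W^j \sum_p c_jp w_p, since W^(5j) = W^(-j) and w_p is a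
   Weyl element. *)
Definition smooth_coef x (j : nat) p : C := tau (x * (wel (- p) * W ^+ (5 * j))).

Lemma coef_expand d n (z : 'I_n -> B) (b : 'I_n -> int * int -> C) j p :
  (forall k, wseries (b k) (z k)) ->
  smooth_coef (\sum_(k < n) W ^+ (d * k) * z k) j p = \sum_(k < n) (6 %| d * k + 5 * j)%:R * b k
    p.
Proof.
move=> Hz; rewrite /smooth_coef mulr_suml tau_sum; apply: eq_bigr => k _.
rewrite -mulrA tauC -!mulrA -exprD mulrA (tau_WX _ (wseries_mulr (- p) (Hz k))).
by rewrite sub0r opprK cocycleNr mulr1 addnC.
Qed.

(** One family for both crossed products: (d, n) = (1, 6) gives 6_theta and (2, 3) gives 3_theta. *)
Definition smoothG d n x := exists2 y : 'I_n -> B, forall j, smoothA U V (y j) &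
  x = \sum_j y j * W ^+ (d * j).

(** In a right module the leftmost factor acts first; with the powers of W in front, the action
    reads as [opWn] followed by a Weyl series. *)
Lemma smoothG_left d n x : smoothG d n x -> exists (b : 'I_n -> int * int -> C) (z : 'I_n -> B),
  (forall k, wseries (b k) (z k)) /\ x = \sum_(k < n) W ^+ (d * k) * z k.
Proof.
move=> [y yA ->].
have /choice[b bP] : forall k : 'I_n, exists b,
  wseries b (W ^+ (5 * (d * k)) * y k * W ^+ (d * k)).
  by move=> k; apply/sAw/smoothA_conjX.
exists b, (fun k : 'I_n => W ^+ (5 * (d * k)) * y k * W ^+ (d * k)); split => //.
apply: eq_bigr => k _; rewrite !mulrA -exprD (_ : d * k + 5 * (d * k) = 6 * (d * k))%N;
  last by lia.
by rewrite (exprM _ 6) W6 expr1n mul1r.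
Qed.

Lemma smoothA0 : smoothA U V 0.
Proof. by apply/sAw; exists (fun=> 0); exact: wseries0. Qed.

Lemma smoothAD x y : smoothA U V x -> smoothA U V y -> smoothA U V (x + y).
Proof.
move=> /sAw[b Hb] /sAw[c Hc]; apply/sAw.
by exists (fun p => b p + c p); exact: wseriesD.
Qed.

Lemma smoothAZ (k : C) x : smoothA U V x -> smoothA U V (k *: x).
Proof.
move=> /sAw[b Hb]; apply/sAw.
by exists (fun p => k * b p); exact: wseriesZ.
Qed.

Lemma smoothG0 d n : smoothG d n 0.
Proof.
exists (fun=> 0); first by move=> _; exact: smoothA0.
by rewrite big1// => i _; rewrite mul0r.
Qed.

Lemma smoothGD d n x y : smoothG d n x -> smoothG d n y -> smoothG d n (x + y).
Proof.
move=> [x' xA ->] [y' yA ->]; exists (fun j => x' j + y' j) => [j|]; first exact: smoothAD.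
by rewrite -big_split; apply: eq_bigr => j _; rewrite mulrDl.
Qed.

Lemma smoothGZ d n (k : C) x : smoothG d n x -> smoothG d n (k *: x).
Proof.
move=> [x' xA ->]; exists (fun j => k *: x' j) => [j|]; first exact: smoothAZ.
by rewrite scaler_sumr; apply: eq_bigr => j _; rewrite scalerAl.
Qed.

Lemma smoothG_sum d n (I : Type) (s : seq I) (F : I -> B) :
  (forall i, smoothG d n (F i)) -> smoothG d n (\sum_(i <- s) F i).
Proof. by move=> H; elim/big_ind: _ => //; [exact: smoothG0|move=> ? ?; exact: smoothGD]. Qed.

Lemma smoothG_mono d n y m : (d * n = 6)%N -> smoothA U V y -> smoothG d n (y * W ^+ (d * m)).
Proof.
move=> dn yA; have n0 : (0 < n)%N by case: n dn => //; rewrite muln0.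
have mn : (m %% n < n)%N by rewrite ltn_mod.
pose i0 := Ordinal mn; exists (fun j => if j == i0 then y else 0).
  by move=> j; case: ifP => // _; exact: smoothA0.
rewrite (bigD1 i0)//= eqxx big1 ?addr0 => [|j /negbTE ->]; last exact: mul0r.
by rewrite {1}(divn_eq m n) mulnDr exprD mulnCA dn mulnC exprM W6 expr1n mul1r.
Qed.

Lemma smoothG_A d n y : (d * n = 6)%N -> smoothA U V y -> smoothG d n y.
Proof. by move=> dn /(smoothG_mono 0 dn); rewrite muln0 mulr1. Qed.

Lemma smoothG_sub6 d n x : smoothG d n x -> smoothG 1 6 x.
Proof.
move=> [y yA ->]; apply: smoothG_sum => j.
by rewrite -[(d * j)%N]mul1n; exact: smoothG_mono.
Qed.

Lemma dvd6 d n (k l : 'I_n) : (d * n = 6)%N -> (6 %| d * k + 5 * (d * l))%N = (k == l).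
Proof.
move=> dn; have d0 : (0 < d)%N by case: d dn.
have small i j : (i < 6)%N -> (j < 6)%N -> (6 %| i + 5 * j)%N = (i == j) by lia.
have lt6 (i : 'I_n) : (d * i < 6)%N by have := ltn_ord i; rewrite -(ltn_pmul2l d0) dn.
by rewrite small// -val_eqE eqn_pmul2l.
Qed.

Lemma smoothG_expand d n x : (d * n = 6)%N -> smoothG d n x -> exists z : 'I_n -> B,
  (forall k : 'I_n, wseries (smooth_coef x (d * k)) (z k)) /\ x = \sum_(k < n) W ^+ (d * k) * z k.
Proof.
move=> dn /smoothG_left[b [z [Hz xE]]]; exists z; split => // k.
move: (Hz k); congr wel_series; apply/funext => p.
rewrite xE (coef_expand _ _ _ Hz) (bigD1 k)//= dvd6// eqxx mul1r big1 ?addr0// => l lk.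
by rewrite dvd6// (negbTE lk) mul0r.
Qed.

Lemma rapid_coef x j : smoothG 1 6 x -> rapid (smooth_coef x j).
Proof.
move=> /smoothG_left[b [z [Hz ->]]].
have -> : smooth_coef (\sum_(k < 6) W ^+ (1 * k) * z k) j = fun p =>
  \sum_(k < 6) (6 %| 1 * k + 5 * j)%:R * b k p.
  by apply/funext => p; exact: coef_expand.
elim: (index_enum _) => [|k s IH].
  by under eq_fun do rewrite big_nil; exact: (rapid_supp1 (q := 0)).
under eq_fun do rewrite big_cons; apply: rapidD IH.
by apply: rapid_scale; case: (Hz k).
Qed.

Lemma coefD x y j p : smooth_coef (x + y) j p = smooth_coef x j p + smooth_coef y j p.
Proof. by rewrite /smooth_coef mulrDl tau_D. Qed.

(** Pairing x with the elements w_(-p) W^(- d k) recovers all its coefficients, and these determine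
    x. *)
Lemma smoothG_nondeg d n x : (d * n = 6)%N -> smoothG d n x ->
  (forall z, smoothG d n z -> tau (x * z) = 0) -> x = 0.
Proof.
move=> dn xG H; have [z [Hz xE]] := smoothG_expand dn xG.
rewrite xE big1// => k _; suff -> : z k = 0 by rewrite mulr0.
apply: (wseries_inj (Hz k)); move: (wseries0 al U V); congr wel_series; apply/funext => p.
rewrite /smooth_coef H// mulnCA; apply: smoothG_mono => //.
by apply/sAw; eexists; exact: wseries_wel.
Qed.

End Coefficients.

(** * The action on Schwartz functions *)

Section SmoothAction.
Variable R : realType.
Local Notation C := R[i].
Local Notation schwartz := (@Pilot.Defs.schwartz R).
Variable al : R.
Hypothesis al_gt0 : 0 < al.
Variable B : cstarAlgType R.
Implicit Types (x y z : B) (a b : int * int -> C) (p q : int * int) (f g h : R -> C).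
Variables U V W : B.
Hypothesis rel : rel6 (al ^+ 2) U V W.
Variable tau : B -> C.
Hypothesis tauP : canonical_trace U V W tau.
Local Notation wel := (wel al U V).
Local Notation wseries := (wel_series al U V).
Local Notation coef := (smooth_coef al U V W tau).
Local Notation smoothG := (smoothG U V W).
Local Notation smooth := (smoothG 1 6).
Local Notation nC := (cabs_complete_norm R).

Lemma series_lincomb (I : Type) (s : seq I) (c : I -> C) (b : I -> int * int -> C) f t :
  (forall i, rapid (b i)) -> schwartz f ->
  weyl_series al (fun p => \sum_(i <- s) c i * b i p) f t = \sum_(i <- s) c i * weyl_series al
    (b i) f t.
Proof.
move=> rb Sf; apply: csum_eq.
have := sums_sum nC s (fun i => csums_scale (c i) (seriesP al (rb i) t Sf)).
by apply: eq_sums => p; rewrite mulr_suml; apply: eq_bigr => i _; rewrite mulrA.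
Qed.

Lemma schwartz_series_sum (I : Type) (s : seq I) (b : I -> int * int -> C) (f : I -> R -> C) :
  (forall i, rapid (b i)) -> (forall i, schwartz (f i)) ->
  schwartz (fun t => \sum_(i <- s) weyl_series al (b i) (f i) t).
Proof. by move=> rb Sf; apply: schwartz_sum => i; exact: schwartz_series. Qed.

Lemma series_sum b (I : Type) (s : seq I) (f : I -> R -> C) t : rapid b ->
  (forall i, schwartz (f i)) ->
  weyl_series al b (fun t => \sum_(i <- s) f i t) t = \sum_(i <- s) weyl_series al b (f i) t.
Proof.
move=> rb Sf; elim: s => [|i s IH].
  rewrite big_nil; under eq_fun do rewrite big_nil.
  apply: csum_eq; have := sums0 nC (int * int)%type; apply: eq_sums => p.
  by rewrite /weyl_op !mulr0.
under eq_fun do rewrite big_cons.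
have SF := schwartz_sum s Sf; rewrite (congr1 (@^~ t) (seriesD al rb (Sf i) SF)).
by rewrite big_cons IH.
Qed.

Lemma opWn_sum n (I : Type) (s : seq I) (f : I -> R -> C) t : (forall i, schwartz (f i)) ->
  opWn n (fun t => \sum_(i <- s) f i t) t = \sum_(i <- s) opWn n (f i) t.
Proof.
move=> Sf; elim: s => [|i s IH].
  rewrite big_nil; under eq_fun do rewrite big_nil.
  have /= H := congr1 (@^~ t) (opWnZ n 0 (schwartz0 R)).
  transitivity (0 * opWn n (fun=> 0) t); last exact: mul0r.
  by rewrite -H; congr opWn; apply/funext => u; rewrite mul0r.
under eq_fun do rewrite big_cons.
by rewrite big_cons opWnD// ?IH//; exact: schwartz_sum.
Qed.

(** Elements of 3_theta act by the same formula, their coefficients of odd index being zero. *)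
Definition smooth_act x f : R -> C := fun t =>
  \sum_(j < 6) weyl_series al (coef x j) (opWn j f) t.

Lemma act_expand d n (z : 'I_n -> B) (b : 'I_n -> int * int -> C) f :
  (d * n = 6)%N -> (forall k, wseries (b k) (z k)) -> schwartz f ->
  smooth_act (\sum_(k < n) W ^+ (d * k) * z k) f = fun t =>
    \sum_(k < n) weyl_series al (b k) (opWn (d * k) f) t.
Proof.
move=> dn Hz Sf; apply/funext => t.
have d0 : (0 < d)%N by case: d dn.
have rb k : rapid (b k) by case: (Hz k).
transitivity (\sum_(j < 6) \sum_(k < n) (6 %| d * k + 5 * j)%:R * weyl_series al (b k) (opWn j
  f) t).
  apply: eq_bigr => j _; rewrite -series_lincomb//; last exact: schwartz_opWn.
  by congr weyl_series; apply/funext => p; exact: (coef_expand rel tauP).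
rewrite exchange_big; apply: eq_bigr => k _ /=.
have lt6 : (d * k < 6)%N by have := ltn_ord k; rewrite -(ltn_pmul2l d0) dn.
have small i j : (i < 6)%N -> (j < 6)%N -> (6 %| i + 5 * j)%N = (i == j) by lia.
rewrite (bigD1 (Ordinal lt6))//= small// eqxx mul1r big1 ?addr0// => j jk.
by rewrite small//; move: jk; rewrite -val_eqE /= eq_sym => /negbTE ->; rewrite mul0r.
Qed.

Lemma act_A b y f : wseries b y -> schwartz f -> smooth_act y f = weyl_series al b f.
Proof.
move=> Hy Sf; have := @act_expand 6 1 (fun=> y) (fun=> b) f erefl (fun=> Hy) Sf.
rewrite big_ord1 muln0 mul1r => ->; apply/funext => t.
by rewrite big_ord1.
Qed.

Lemma act1 f : schwartz f -> smooth_act 1 f = f.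
Proof.
move=> Sf; rewrite (act_A (wseries1 al U V) Sf); apply/funext => t; apply: csum_eq.
have := sums_delta nC (u := fun p => ((p == 0)%:R : C) * weyl_op al p f t) (j := 0).
by rewrite eqxx mul1r weyl0; apply => p /negbTE ->; rewrite mul0r.
Qed.

Lemma act_schwartz x f : smooth x -> schwartz f -> schwartz (smooth_act x f).
Proof.
move=> xS Sf; apply: schwartz_series_sum => j; first exact: (rapid_coef rel tauP).
exact: schwartz_opWn.
Qed.

Lemma actD x y f : smooth x -> smooth y -> schwartz f ->
  smooth_act (x + y) f = fun t => smooth_act x f t + smooth_act y f t.
Proof.
move=> xS yS Sf; apply/funext => t; rewrite -big_split; apply: eq_bigr => j _ /=.
have rx := rapid_coef rel tauP j xS; have ry := rapid_coef rel tauP j yS.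
have So := schwartz_opWn j Sf.
apply: csum_eq; have := sumsD nC (seriesP al rx t So) (seriesP al ry t So).
by apply: eq_sums => p; rewrite (coefD al tauP) mulrDl.
Qed.

Lemma act_sum (I : Type) (s : seq I) (F : I -> B) f t : (forall i, smooth (F i)) -> schwartz f ->
  smooth_act (\sum_(i <- s) F i) f t = \sum_(i <- s) smooth_act (F i) f t.
Proof.
move=> FS Sf; elim: s => [|i s IH].
  rewrite !big_nil; apply: big1 => j _; apply: csum_eq.
  have := sums0 nC (int * int)%type; apply: eq_sums => p.
  by rewrite /smooth_coef mul0r (tau_0 tauP) mul0r.
rewrite !big_cons actD// ?IH//; exact: (smoothG_sum al).
Qed.

Lemma act_fD x f g : smooth x -> schwartz f -> schwartz g ->
  smooth_act x (fun t => f t + g t) = fun t => smooth_act x f t + smooth_act x g t.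
Proof.
move=> xS Sf Sg; apply/funext => t; rewrite -big_split; apply: eq_bigr => j _ /=.
by rewrite opWnD// seriesD//; [exact: (rapid_coef rel tauP)|exact: schwartz_opWn|exact:
  schwartz_opWn].
Qed.

Lemma smooth_mulW x : smooth x -> smooth (x * W).
Proof.
move=> [y yA ->]; rewrite mulr_suml; apply: (smoothG_sum al) => j.
by rewrite -mulrA -exprSr mul1n -[j.+1]mul1n; exact: (smoothG_mono rel).
Qed.

Lemma coef_mulW x j p : coef (x * W) j.+1 p = coef x j (hexa p).
Proof.
rewrite /smooth_coef; congr tau; rewrite -!mulrA; congr (x * _).
rewrite mulrA (W_wel rel) hexaN -mulrA; congr (_ * _).
rewrite -exprS (_ : (5 * j.+1).+1 = 5 * j + 6)%N; last by lia.
by rewrite exprD (W6 rel) mulr1.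
Qed.

Lemma coef_mod x j p : coef x (j + 6) p = coef x j p.
Proof.
rewrite /smooth_coef mulnDr exprD (_ : 5 * 6 = 6 * 5)%N; last by [].
by rewrite (exprM _ 6 5) (W6 rel) expr1n mulr1.
Qed.

Lemma act_mulW x f : smooth x -> schwartz f -> smooth_act (x * W) f = opW (smooth_act x f).
Proof.
move=> xS Sf; apply/funext => t; have rx j := rapid_coef rel tauP j xS.
have So j := schwartz_opWn j Sf.
have H : opW (smooth_act x f) t = \sum_(j < 6) opW (weyl_series al (coef x j) (opWn j f)) t.
  exact: (@opWn_sum 1 _ _ _ t (fun j : 'I_6 => schwartz_series al_gt0 (rx j) (So j))).
rewrite H.
have E j : opW (weyl_series al (coef x j) (opWn j f)) = weyl_series al (coef (x * W) j.+1) (opWn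
  j.+1 f).
  by rewrite opW_series//; congr weyl_series; apply/funext => p; rewrite coef_mulW.
transitivity (\sum_(j < 6) weyl_series al (coef (x * W) j.+1) (opWn j.+1 f) t); last first.
  by apply: eq_bigr => j _; rewrite -E.
(* The indices shift cyclically: the term of index 6 wraps around to index 0, because W has order
   six both in the algebra and on functions. *)
rewrite /smooth_act big_ord_recl [RHS]big_ord_recr /= addrC; congr (_ + _).
have E6 : weyl_series al (coef (x * W) 6) (opWn 6 f) = weyl_series al (coef (x * W) 0) (opWn 0 f).
  by rewrite opW6//; congr weyl_series; apply/funext => p; exact: (coef_mod _ 0).
exact: (congr1 (@^~ t) (esym E6)).
Qed.

Lemma smooth_mulWX x k : smooth x -> smooth (x * W ^+ k).
Proof.
by move=> xS; elim: k => [|k IH]; [rewrite mulr1|rewrite exprSr mulrA; exact: smooth_mulW].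
Qed.

Lemma act_mulWX x k f : smooth x -> schwartz f -> smooth_act (x * W ^+ k) f = opWn k (smooth_act
  x f).
Proof.
move=> xS Sf; elim: k => [|k IH]; first by rewrite mulr1.
by rewrite exprSr mulrA act_mulW ?IH//; exact: smooth_mulWX.
Qed.

(** By continuity of the trace, the coefficients of x y are sums over the Weyl series of y. As y
    stands on the right, w_q merges with the test element w_(-p), and the twisted convolution
    appears without moving anything past x. *)
Lemma act_mulA x b y f : smooth x -> wseries b y -> schwartz f ->
  smooth_act (x * y) f = weyl_series al b (smooth_act x f).
Proof.
move=> xS [rb Sb] Sf; apply/funext => t; have rx j := rapid_coef rel tauP j xS.
have So j := schwartz_opWn j Sf.
rewrite series_sum//; last by move=> j; exact: schwartz_series.
apply: eq_bigr => j _; rewrite series_series//; congr weyl_series; apply/funext => p.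
apply/esym/csum_eq.
have H := sums_tau tauP (u := fun q =>
  x * ((b q *: wel q) * (wel (- p) * W ^+ (5 * j)))) (s := x * y * (wel (- p) * W ^+ (5 * j))).
have {}H := H _; apply: eq_sums (H _) => [q|] /=.
  rewrite -scalerAl -scalerAr (tau_Z tauP) (mulrA (wel q)) (welM rel) -scalerAl -scalerAr (tau_Z
    tauP).
  rewrite /smooth_coef opprB; congr (_ * (_ * _)); rewrite /cocycle /=;
    congr (e_ (_ * _%:~R / _)); ring.
move=> e e0; pose K := cnorm x * cnorm (wel (- p) * W ^+ (5 * j)) + 1.
have K0 : 0 < K by rewrite ltr_wpDl// mulr_ge0 ?cnorm_ge0.
have [F FP] := Sb (e / K) (divr_gt0 e0 K0); exists F => G /FP.
rewrite ltr_pdivlMr// => h; apply: le_lt_trans h.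
rewrite -mulr_sumr -mulr_suml -mulrA -mulrBr -mulrBl.
apply: le_trans (cnormM _ _) _; rewrite mulrC.
apply: le_trans (ler_wpM2r (cnorm_ge0 _) (cnormM _ _)) _.
rewrite -mulrA ler_wpM2l ?cnorm_ge0// /K mulrC; lra.
Qed.

Hypothesis smoothM : forall x y, smooth x -> smooth y -> smooth (x * y).

(** Expanding y into the W^k z_k leaves the cases of a power of W and of a Weyl series. Closure
    under products ensures that every x W^k z_k has rapidly decreasing coefficients, so that the
    action is additive on them. *)
Lemma act_mul x y f : smooth x -> smooth y -> schwartz f -> smooth_act (x * y) f = smooth_act y
  (smooth_act x f).
Proof.
move=> xS yS Sf; have Sx := act_schwartz xS Sf.
have [z [Hz yE]] := smoothG_expand rel tauP (erefl : (1 * 6 = 6)%N) yS.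
have zS k : smooth (z k).
  by apply: (smoothG_A rel) => //; apply/smoothA_wseries; eexists; exact: Hz.
apply/funext => t; rewrite {1}yE mulr_sumr act_sum//; last first.
  by move=> k; rewrite mulrA; apply: smoothM => //; exact: smooth_mulWX.
rewrite [in RHS]yE (@act_expand 1 6 _ _ _ erefl Hz)//; apply: eq_bigr => k _.
by rewrite mulrA (act_mulA (smooth_mulWX _ xS) (Hz k))// act_mulWX.
Qed.

Lemma act_W f : schwartz f -> smooth_act W f = opW f.
Proof.
move=> Sf; have S1 : smooth 1.
  by apply: (smoothG_A rel) => //; apply/smoothA_wseries; eexists; exact: (wseries1 al).
by rewrite -[W]mul1r act_mulW// act1.
Qed.

Lemma act_wel p f : schwartz f -> smooth_act (wel p) f = weyl_op al p f.
Proof.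
move=> Sf; rewrite (act_A (wseries_wel _ _ _ p) Sf); apply/funext => t; apply: csum_eq.
have := sums_delta nC (u := fun q => ((q == p)%:R : C) * weyl_op al q f t) (j := p).
by rewrite eqxx mul1r; apply => q /negbTE ->; rewrite mul0r.
Qed.

End SmoothAction.

Lemma eq_modn_opp n j k : (j < n)%N -> (k < n)%N -> (j == (n - k) %% n)%N = (n %| j + k)%N.
Proof.
move=> jn kn; have [->|k0] := posnP k.
  by rewrite subn0 modnn addn0 /dvdn modn_small.
rewrite modn_small; last by rewrite ltn_subrL k0 (leq_ltn_trans _ jn).
have [->|jk] := eqVneq j (n - k)%N; first by rewrite subnK ?dvdnn// ltnW.
apply/esym/negP => /dvdnP[[|[|m]]]; [lia|lia|rewrite !mulSn; lia].
Qed.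

(** * Module maps into the crossed product *)

Section CoefficientMaps.
Variable R : realType.
Local Notation C := R[i].
Local Notation rc := (real_complex R).
Local Notation schwartz := (@Pilot.Defs.schwartz R).
Variable al : R.
Hypothesis al_gt0 : 0 < al.
Variable B : cstarAlgType R.
Implicit Types (x y z : B) (a b : int * int -> C) (p q : int * int) (f g h : R -> C).
Variables U V W : B.
Hypothesis rel : rel6 (al ^+ 2) U V W.
Variable tau : B -> C.
Hypothesis tauP : canonical_trace U V W tau.
Local Notation wel := (wel al U V).
Local Notation wseries := (wel_series al U V).
Local Notation coef := (smooth_coef al U V W tau).
Local Notation act := (smooth_act al U V W tau).
Local Notation smoothG := (smoothG U V W).
Local Notation smooth := (smoothG 1 6).
Local Notation nC := (cabs_complete_norm R).

Lemma csums_pair_series a h f : rapid a -> schwartz h -> schwartz f ->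
  csums (fun p => a p * pair al h f p) (cintegral (fun t => h t * weyl_series al a f t)).
Proof.
(* [cint_series] is stated for weights of modulus at most 1, so h is divided by a bound K. *)
move=> ra Sh Sf; have [K0 K0P] := schwartz_bounded0 Sh; pose K := `|K0| + 1.
have Kp : 0 < K by rewrite ltr_wpDl.
have Kn : rc K != 0 by rewrite fmorph_eq0 gt_eqF.
pose u t := (rc K)^-1 * h t.
have hu t : h t = rc K * u t by rewrite /u mulrA mulfV// mul1r.
have u1 t : cabs (u t) <= 1.
  have := congr1 (@cabs R) (hu t); rewrite cabsM cabs_real (gtr0_norm Kp) => E.
  rewrite -(ler_pM2l Kp) mulr1 -E; apply: le_trans (K0P t) _.
  by apply: le_trans (ler_norm _) _; rewrite lerDl ler01.
have Su : schwartz u by exact: schwartzZ.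
have mu_ := schwartz_cmeasurable Su.
have := csums_scale (rc K) (cint_series al_gt0 ra Sf mu_ u1).
rewrite -cintZ; last exact/schwartz_decaying/schwartzM/schwartz_series.
rewrite (eq_cint (g := fun t => h t * weyl_series al a f t)); last first.
  by move=> t; rewrite mulrA -hu.
apply: eq_sums => p; rewrite mulrCA -cintZ; last exact: pair_decaying.
by congr (_ * _); apply: eq_cint => t; rewrite mulrA -hu.
Qed.

Lemma actZ (c : C) x f t : smooth x -> schwartz f -> act (c *: x) f t = c * act x f t.
Proof.
move=> xS Sf; rewrite /smooth_act mulr_sumr; apply: eq_bigr => j _.
have rx := rapid_coef rel tauP j xS; have So := schwartz_opWn j Sf.
apply: csum_eq; have := csums_scale c (seriesP al rx t So); apply: eq_sums => p.
by rewrite mulrA /smooth_coef -(scalerAl c x) (tau_Z tauP).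
Qed.

Definition welt b : B := xget 0 [set y | wseries b y].

Lemma weltP b : rapid b -> wseries b (welt b).
Proof. by move=> /(wseries_exists rel)[y Hy];
  exact: (@xgetPex _ 0 [set y | wseries b y]) (ex_intro _ y Hy). Qed.

Variables d n : nat.
Hypothesis dn : (d * n = 6)%N.

Let n_neq0 : n%:R != 0 :> C.
Proof. by rewrite pnatr_eq0; case: n dn => //; rewrite muln0. Qed.

(* Averaging the A_theta-valued inner product over the group of order n generated by W^d gives a
   module map into the crossed product. *)
Definition coef_map h f : B :=
  (n%:R^-1 : C) *: \sum_(j < n) welt (bracket al h (opWn (6 - d * j) f)) * W ^+ (d * j).

Section CoefMap.
Variables h f : R -> C.
Hypotheses (Sh : schwartz h) (Sf : schwartz f).

Let c (j : 'I_n) := bracket al h (opWn (6 - d * j) f).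
Let Hc j : wseries (c j) (welt (c j)).
Proof. exact/weltP/bracket_rapid/schwartz_opWn. Qed.

Let sA j : smoothA U V (welt (c j)).
Proof. by apply/smoothA_wseries; eexists; exact: Hc. Qed.

Lemma smoothG_coef_map : smoothG d n (coef_map h f).
Proof.
apply: (smoothGZ al); apply: (smoothG_sum al) => j.
exact: (smoothG_mono rel _ dn (sA j)).
Qed.

(** Under the trace only the index j with d (j + k) divisible by 6 survives; for it 6 - d j equals d
    k modulo 6. *)
Lemma tau_coef_map_wel (k : 'I_n) q :
  tau (coef_map h f * (W ^+ (d * k) * wel q)) = n%:R^-1 * (rc al * pair al h (opWn (d * k) f) q).
Proof.
rewrite /coef_map -scalerAl (tau_Z tauP) mulr_suml (tau_sum tauP); congr (_ * _).
have d0 : (0 < d)%N by case: d dn.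
have lt6 (i : 'I_n) : (d * i < 6)%N by have := ltn_ord i; rewrite -(ltn_pmul2l d0) dn.
have n0 : (0 < n)%N by case: n dn => //; rewrite muln0.
have jP : ((n - k) %% n < n)%N by rewrite ltn_mod.
pose j0 := Ordinal jP.
have T j : tau (welt (c j) * W ^+ (d * j) * (W ^+ (d * k) * wel q)) =
   (j == j0)%:R * c j (- q).
  rewrite mulrA -[welt _ * _ * _]mulrA -exprD -mulrA.
  have jk : (j == j0) = (6 %| d * j + d * k)%N.
    by rewrite -mulnDr -dn dvdn_pmul2l// -val_eqE /= eq_modn_opp.
  rewrite jk; case: (boolP (6 %| d * j + d * k)%N) => [/dvdnP[m ->]|/negbTE nd].
    rewrite mulnC exprM (W6 rel) expr1n mul1r mul1r.
    have := tau_WX rel tauP 0 (wseries_mulr rel q (Hc j)).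
    by rewrite expr0 mulr1 => ->; rewrite dvdn0 mul1r sub0r cocycleN mulr1.
  rewrite (WX_wel rel) mulrA (tau_WX rel tauP _ (wseries_mulr rel _ (Hc j))) nd.
  by rewrite !mul0r.
under eq_bigr do rewrite T.
rewrite (bigD1 j0)//= eqxx mul1r big1 ?addr0 => [|j /negbTE ->]; last by rewrite mul0r.
suff Ek : opWn (6 - d * j0) f = opWn (d * k) f by rewrite /c /bracket opprK Ek.
(* For k = 0 the exponent is 6 rather than 0, and the order of W is used. *)
have [k0|k0] := eqVneq (k : nat) 0%N.
  by rewrite /= k0 subn0 modnn !muln0 subn0 opW6.
rewrite /= modn_small; last by rewrite ltn_subrL lt0n k0 n0.
by congr opWn; rewrite mulnBr dn subKn// ltnW.
Qed.

(** Continuity of the trace extends the values on the elements W^(d k) w_q to all z. By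
    nondegeneracy these values determine [coef_map h f]. *)
Lemma tau_coef_map z : smoothG d n z ->
  tau (coef_map h f * z) = rc al / n%:R * cintegral (fun t => h t * act z f t).
Proof.
move=> zG; have [y [Hy zE]] := smoothG_expand rel tauP dn zG.
have So k := schwartz_opWn k Sf.
have ry k : rapid (coef z (d * k)) by exact/(rapid_coef rel tauP)/(smoothG_sub6 rel)/zG.
have Ss (k : 'I_n) : schwartz (weyl_series al (coef z (d * k)) (opWn (d * k) f)).
  exact: schwartz_series.
have E : act z f = fun t => \sum_(k < n) weyl_series al (coef z (d * k)) (opWn (d * k) f) t.
  by rewrite {1}zE (act_expand al_gt0 rel tauP dn Hy Sf).
have -> : cintegral (fun t => h t * act z f t) =
    \sum_(k < n) cintegral (fun t => h t * weyl_series al (coef z (d * k)) (opWn (d * k) f) t).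
  rewrite -cint_sum; last by move=> k; exact/schwartz_decaying/schwartzM.
  by apply: eq_cint => t; rewrite E mulr_sumr.
rewrite {1}zE mulr_sumr (tau_sum tauP) mulr_sumr; apply: eq_bigr => k _.
have S1 := csums_scale (rc al / n%:R) (csums_pair_series (ry k) Sh (So (d * k)%N)).
have S2 : csums (fun q => tau (coef_map h f * (W ^+ (d * k) * (coef z (d * k) q *: wel q))))
    (tau (coef_map h f * (W ^+ (d * k) * y k))).
  have := Hy k => -[_ Sy].
  apply: (sums_tau tauP (u := fun q =>
    coef_map h f * (W ^+ (d * k) * (coef z (d * k) q *: wel q)))).
  move=> e e0; pose K := cnorm (coef_map h f * W ^+ (d * k)) + 1.
  have K0 : 0 < K by rewrite ltr_wpDl// cnorm_ge0.
  have [F FP] := Sy (e / K) (divr_gt0 e0 K0); exists F => G /FP.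
  rewrite ltr_pdivlMr// => H; apply: le_lt_trans H.
  rewrite -mulr_sumr -mulr_sumr -mulrBr -mulrBr mulrA.
  apply: le_trans (cnormM _ _) _; rewrite mulrC ler_wpM2l ?cnorm_ge0// /K; lra.
apply: (sums_unique nC S2); apply: eq_sums S1 => q.
rewrite -(scalerAr (coef z (d * k) q) (W ^+ (d * k))) -(scalerAr _ (coef_map h f)) (tau_Z tauP).
by rewrite tau_coef_map_wel; field.
Qed.

Lemma act_coef_map g t : schwartz g ->
  act (coef_map h f) g t = n%:R^-1 * \sum_(j < n) opWn (d * j) (weyl_series al (c j) g) t.
Proof.
move=> Sg; have S1 : smooth 1.
  by apply: (smoothG_A rel) => //; apply/smoothA_wseries; eexists; exact: (wseries1 al).
have sj j : smooth (welt (c j)) by exact: (smoothG_A rel).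
rewrite actZ//; last first.
  by apply: (smoothG_sum al) => j; exact: (smooth_mulWX rel _ (sj j)).
rewrite (act_sum rel tauP)//; last by move=> j; exact: (smooth_mulWX rel _ (sj j)).
congr (_ * _); apply: eq_bigr => j _; rewrite (act_mulWX al_gt0 rel tauP _ (sj j) Sg).
by rewrite (act_A al_gt0 rel tauP (Hc j) Sg).
Qed.

End CoefMap.

(** Term j applies the frame identity to W^(- d j) f and brings the result back by W^(d j); every
    term is thus f, and so is their mean. *)
Lemma reproducing (N : nat) (g h : 'I_N -> R -> C) f t :
  (forall i, schwartz (g i)) -> (forall i, schwartz (h i)) ->
  (forall u t, schwartz u -> \sum_i weyl_series al (bracket al (h i) u) (g i) t = u t) ->
  schwartz f -> \sum_i act (coef_map (h i) f) (g i) t = f t.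
Proof.
move=> Sg Sh H Sf.
transitivity (n%:R^-1 * \sum_(j < n) \sum_i opWn (d * j)
    (weyl_series al (bracket al (h i) (opWn (6 - d * j) f)) (g i)) t).
  rewrite [in RHS]exchange_big mulr_sumr; apply: eq_bigr => i _; exact: act_coef_map.
have d0 : (0 < d)%N by case: d dn.
have lt6 (i : 'I_n) : (d * i < 6)%N by have := ltn_ord i; rewrite -(ltn_pmul2l d0) dn.
transitivity (n%:R^-1 * \sum_(j < n) f t).
  congr (_ * _); apply: eq_bigr => j _.
  rewrite -opWn_sum; last first.
    by move=> i; apply: schwartz_series => //; apply: bracket_rapid => //; exact: schwartz_opWn.
  rewrite (_ : (fun t => _) = opWn (6 - d * j) f); last first.
    by apply/funext => u; rewrite H//; exact: schwartz_opWn.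
  by rewrite -opWn_add subnKC ?opW6// ltnW.
by rewrite sumr_const card_ord -(mulr_natl (f t)) mulrA mulVf// mul1r.
Qed.

End CoefficientMaps.

(** * The Schwartz module *)

Section FiniteDualBasis.
Variable A : nzRingType.
Variable M : lmodType A^c.
Variable N : nat.
Variables (g : 'I_N -> M) (c : 'I_N -> M -> A).
Hypothesis cD : forall i m m', c i (m + m') = c i m + c i m'.
Hypothesis cM : forall i m a, c i (ract m a) = c i m * a.
Hypothesis gc : forall m, \sum_i ract (g i) (c i m) = m.

Lemma ractM (P : lmodType A^c) (m : P) (a b : A) : ract m (a * b) = ract (ract m a) b.
Proof. by rewrite /ract scalerA. Qed.

Lemma ractDr (P : lmodType A^c) (m : P) (a b : A) : ract m (a + b) = ract m a + ract m b.
Proof. by rewrite /ract scalerDl. Qed.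

Lemma linear_ract (P Q : lmodType A^c) (f : {linear P -> Q}) (m : P) (a : A) :
  f (ract m a) = ract (f m) a.
Proof. exact: (linearZZ f a m). Qed.

Lemma dual_basis_fg : finitely_generated M.
Proof. by exists N, g => m; exists (fun i => c i m); rewrite gc. Qed.

Lemma dual_basis_projective : projective M.
Proof.
move=> P Q f h fsurj; have [y yE] := choice (fun i => fsurj (h (g i))).
pose k m := \sum_i ract (y i) (c i m).
have kL : linear k.
  move=> a m m'; rewrite /k scaler_sumr -big_split; apply: eq_bigr => i _ /=.
  by rewrite cD ractDr -[a *: m]/(ract m a) cM ractM.
pose K : {linear M -> P} := HB.pack k (GRing.isLinear.Build A^c M P *:%R k kL).
exists K => m; rewrite -[in RHS](gc m) /= /k !raddf_sum; apply: eq_bigr => i _.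
transitivity (ract (h (g i)) (c i m)); last exact/esym/linear_ract.
by rewrite -yE; exact: linear_ract.
Qed.

(** The matrix of the synthesis map v -> \sum_j g_j v_j followed by the coordinates c; it is
    idempotent because synthesis undoes c. *)
Definition dual_matrix : 'M[A]_N := \matrix_(i, j) c i (g j).

Lemma c_sum (I : Type) (s : seq I) (m : I -> M) i : c i (\sum_(j <- s) m j) = \sum_(j <- s) c i
  (m j).
Proof.
have c0 : c i 0 = 0 by apply: (addIr (c i 0)); rewrite -cD !add0r.
exact: (big_morph (c i) (cD i) c0).
Qed.

Lemma dual_matrix_mulmx (v : 'cV[A]_N) :
  dual_matrix *m v = \col_i c i (\sum_j ract (g j) (v j 0)).
Proof.
by apply/colP => i; rewrite !mxE c_sum; apply: eq_bigr => j _; rewrite mxE cM.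
Qed.

Lemma dual_matrix_coords m : dual_matrix *m (\col_i c i m) = \col_i c i m.
Proof.
rewrite dual_matrix_mulmx; congr (\col_i _); apply/funext => i.
by under eq_bigr do rewrite mxE; rewrite gc.
Qed.

Lemma dual_matrix_idem : dual_matrix *m dual_matrix = dual_matrix.
Proof.
apply/matrixP => i j; have := dual_matrix_coords (g j).
move/colP/(_ i); rewrite !mxE => <-; apply: eq_bigr => k _; by rewrite !mxE.
Qed.

Lemma dual_basis_represents : represents M (IdMx dual_matrix_idem).
Proof.
pose k m : 'cV[A]_N := \col_i c i m.
have kB : {morph k : x y / x - y}.
  move=> x y; apply/colP => i; rewrite !mxE; apply: (addIr (c i y)).
  by rewrite -cD !subrK.
pose K : {additive M -> 'cV[A]_N} := HB.pack k (GRing.isZmodMorphism.Build M 'cV[A]_N k kB).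
exists K; split => [m m' E|m a|].
- rewrite -(gc m) -(gc m'); apply: eq_bigr => i _.
  by have /colP/(_ i) := E; rewrite !mxE => ->.
- by apply/colP => i; rewrite !mxE big_ord1 !mxE cM mulr1n.
apply/seteqP; split => [_ [m _ <-]|v /= Ev]; first exact: dual_matrix_coords.
exists (\sum_j ract (g j) (v j 0)) => //.
by rewrite -[RHS]Ev dual_matrix_mulmx.
Qed.

Lemma dual_basis_trace (S : zmodType) (tau : A -> S) : {morph tau : a b / a + b} ->
  (forall a b, tau (a * b) = tau (b * a)) ->
  K0trace tau (K0class M) = \sum_i tau (c i (g i)).
Proof.
move=> tauD tauC; rewrite (K0classE dual_basis_represents) K0trace_idem//=.
have tau0 : tau 0 = 0 by apply: (addIr (tau 0)); rewrite -tauD !add0r.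
by rewrite /mxtrace (big_morph tau tauD tau0); apply: eq_bigr => i _; rewrite mxE.
Qed.

End FiniteDualBasis.

(** * The group of Schwartz functions *)

Section SchwartzFunctions.
Variable R : realType.
Local Notation C := R[i].
Local Notation schwartz := (@Pilot.Defs.schwartz R).

Record schwartz_fun := SchwartzFun { sfun :> R -> C; sfunP : schwartz sfun }.

HB.instance Definition _ := gen_eqMixin schwartz_fun.
HB.instance Definition _ := gen_choiceMixin schwartz_fun.

Lemma sfun_inj : injective sfun.
Proof. by case=> f fP [g gP] /= E; subst g; rewrite (Prop_irrelevance fP gP). Qed.

Definition sfun0 := SchwartzFun (schwartz0 R).
Definition sfunD (f g : schwartz_fun) := SchwartzFun (schwartzD (sfunP f) (sfunP g)).
Definition sfunN (f : schwartz_fun) := SchwartzFun (schwartzN (sfunP f)).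

Lemma sfunDA : associative sfunD.
Proof. by move=> f g h; apply/sfun_inj/funext => t; exact: addrA. Qed.

Lemma sfunDC : commutative sfunD.
Proof. by move=> f g; apply/sfun_inj/funext => t; exact: addrC. Qed.

Lemma sfun0D : left_id sfun0 sfunD.
Proof. by move=> f; apply/sfun_inj/funext => t; exact: add0r. Qed.

Lemma sfunND : left_inverse sfun0 sfunN sfunD.
Proof. by move=> f; apply/sfun_inj/funext => t; exact: addNr. Qed.

HB.instance Definition _ := GRing.isZmodule.Build schwartz_fun sfunDA sfunDC sfun0D sfunND.

Lemma sfun_is_zmod_morphism : {morph (sfun : schwartz_fun -> R -> C) : x y / x - y}.
Proof. by []. Qed.

Lemma sfun_sum (I : Type) (s : seq I) (F : I -> schwartz_fun) t :
  (\sum_(i <- s) F i) t = \sum_(i <- s) F i t.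
Proof. by elim/big_rec2: _ => // i x y _ <-. Qed.

Lemma csums_cvg (I : choiceType) (u : I -> C) (s : C) : csums u s ->
  summability.partial_sum (u : I -> C^o) F @[F --> summability.totally] --> (s : C^o).
Proof.
move=> us; have tF := @filter_filter _ _ (@summability.totally_filter I).
apply/cvgrPdist_lt => -[r i]; rewrite ltcE /= => /andP[/eqP i0 r0].
have [F FP] := us _ r0; exists F => // G /FP.
by rewrite partial_sumE => H; rewrite distrC cabsE ltcE /= i0 eqxx.
Qed.

End SchwartzFunctions.

(** * The module over the smooth crossed product *)

Section SchwartzModule.
Variable R : realType.
Local Notation C := R[i].
Local Notation rc := (real_complex R).
Local Notation schwartz := (@Pilot.Defs.schwartz R).
Variable al : R.
Hypothesis al_gt0 : 0 < al.
Variable B : cstarAlgType R.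
Implicit Types (x y z : B) (f g h : R -> C).
Variables U V W : B.
Hypothesis rel : rel6 (al ^+ 2) U V W.
Variable tau : B -> C.
Hypothesis tauP : canonical_trace U V W tau.
Local Notation act := (smooth_act al U V W tau).
Local Notation smoothG := (smoothG U V W).
Local Notation smooth := (smoothG 1 6).
Hypothesis smoothM : forall x y, smooth x -> smooth y -> smooth (x * y).
Variables d n : nat.
Hypothesis dn : (d * n = 6)%N.
Variables (A : nzRingType) (iota : {rmorphism A -> B}).
Hypothesis AP : is_subring (smoothG d n) iota.
Local Notation coef_map := (coef_map al U V W d n).
Local Notation S := (schwartz_fun R).

Lemma iotaP a : smoothG d n (iota a).
Proof. by case: AP => _ <-; exists a. Qed.

Lemma smooth_iota a : smooth (iota a).
Proof. exact: (smoothG_sub6 rel (iotaP a)). Qed.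

Lemma iota_onto x : smoothG d n x -> exists a, iota a = x.
Proof. by case: AP => _ E; rewrite -E => -[a _ <-]; exists a. Qed.

Lemma smoothGM x y : smoothG d n x -> smoothG d n y -> smoothG d n (x * y).
Proof. by move=> /iota_onto[a <-] /iota_onto[b <-]; rewrite -rmorphM; exact: iotaP. Qed.

Definition sact (a : A^c) (m : S) : S :=
  SchwartzFun (act_schwartz al_gt0 rel tauP (smooth_iota (a : A)) (sfunP m)).

Lemma sactA (a b : A^c) m : sact a (sact b m) = sact (a * b) m.
Proof.
apply: sfun_inj; rewrite /= -(act_mul al_gt0 rel tauP smoothM); last exact: sfunP.
- by rewrite -rmorphM.
- exact: smooth_iota.
- exact: smooth_iota.
Qed.

Lemma sact1 : left_id (1 : A^c) sact.
Proof. by move=> m; apply: sfun_inj; rewrite /= rmorph1 (act1 al_gt0 rel tauP)//;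
  exact: sfunP. Qed.

Lemma sactDr : right_distributive sact +%R.
Proof.
move=> a m m'; apply: sfun_inj.
exact: (act_fD rel tauP (smooth_iota a) (sfunP m) (sfunP m')).
Qed.

Lemma sactDl m : {morph sact^~ m : a b / a + b}.
Proof.
move=> a b; apply: sfun_inj; rewrite /= rmorphD.
exact: (actD rel tauP (smooth_iota a) (smooth_iota b) (sfunP m)).
Qed.

Definition schwartz_mod : lmodType A^c :=
  HB.pack S (GRing.Zmodule_isLmodule.Build A^c S sactA sact1 sactDr sactDl).

Definition sfun_add : {additive schwartz_mod -> (R -> C)} :=
  HB.pack (@sfun R) (GRing.isZmodMorphism.Build schwartz_mod (R -> C) (@sfun R)
    (@sfun_is_zmod_morphism R)).

Lemma sfun_ract (m : schwartz_mod) a : sfun_add (ract m a) = act (iota a) (sfun_add m).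
Proof. by []. Qed.

Lemma act_U f : schwartz f -> act U f = opU al f.
Proof.
move=> Sf; have := act_wel al_gt0 rel tauP (1, 0) Sf; rewrite wel_U upow1 => ->.
apply/funext => t; rewrite /weyl_op /opU /= mulr0 mul0r mulr0z !mulr0 !mul0r subr0 e_0 mul1r.
by rewrite mulr1z mulr1.
Qed.

Lemma act_V f : schwartz f -> act V f = opV al f.
Proof.
move=> Sf; have := act_wel al_gt0 rel tauP (0, 1) Sf; rewrite wel_V upow1 => ->.
apply/funext => t; rewrite /weyl_op /opV /= mul0r mulr0z !mulr0 !mul0r sub0r subr0.
by rewrite mulr1z mulr1.
Qed.

Lemma schwartz_module_sfun : schwartz_module iota sfun_add al U V.
Proof.
split.
- exact: sfun_inj.
- apply/seteqP; split => [_ [m _ <-]|f Sf]; first exact: sfunP.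
  by exists (SchwartzFun Sf).
- by move=> a aU m; rewrite sfun_ract aU act_U//; exact: sfunP.
- by move=> a aV m; rewrite sfun_ract aV act_V//; exact: sfunP.
move=> u uE a b ab m t; apply: csums_cvg.
have Sm : schwartz (sfun_add m) by exact: sfunP.
have Hb := is_series_wseries al ab.
have -> : sfun_add (ract m b) t = weyl_series al (fun p =>
  a p * e_ (- (al ^+ 2 * (p.1 * p.2)%:~R / 2))) (sfun_add m) t.
  by rewrite sfun_ract (act_A al_gt0 rel tauP Hb Sm).
apply: eq_sums (seriesP al Hb.1 t Sm) => p.
rewrite -mulrA; congr (_ * _); rewrite sfun_ract uE (mono_wel al).
rewrite (actZ rel tauP)//; first by rewrite (act_wel al_gt0 rel tauP).
apply: (smoothG_A rel) => //; apply/(smoothA_wseries al); eexists; exact: wseries_wel.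
Qed.

Lemma coef_map_unique x y : smoothG d n x -> smoothG d n y ->
  (forall z, smoothG d n z -> tau (x * z) = tau (y * z)) -> x = y.
Proof.
move=> xG yG H; apply/eqP; rewrite -subr_eq0; apply/eqP.
apply: (smoothG_nondeg rel tauP dn) => [|z zG].
  by apply: (smoothGD al xG); rewrite -scaleN1r; exact: (smoothGZ al).
by rewrite mulrBl (tau_D tauP) (tau_N tauP) H// subrr.
Qed.

Lemma tau_mulDl x y z : tau ((x + y) * z) = tau (x * z) + tau (y * z).
Proof. by rewrite mulrDl (tau_D tauP). Qed.

Lemma coef_mapD h f g : schwartz h -> schwartz f -> schwartz g ->
  coef_map h (fun t => f t + g t) = coef_map h f + coef_map h g.
Proof.
move=> Sh Sf Sg; have Sfg := schwartzD Sf Sg.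
have H k (Sk : schwartz k) := smoothG_coef_map al_gt0 rel dn Sh Sk.
have T k (Sk : schwartz k) z (zG : smoothG d n z) := tau_coef_map al_gt0 rel tauP dn Sh Sk zG.
apply: (coef_map_unique (H _ Sfg) (smoothGD al (H _ Sf) (H _ Sg))) => z zG.
have zS := smoothG_sub6 rel zG.
have dec k : schwartz k -> decaying (fun t => h t * act z k t).
  by move=> Sk; exact/schwartz_decaying/schwartzM/(act_schwartz al_gt0 rel tauP zS).
refine (etrans (T _ Sfg _ zG) (etrans _ (esym (tau_mulDl _ _ _)))).
refine (etrans _ (esym (congr2 +%R (T _ Sf _ zG) (T _ Sg _ zG)))).
rewrite -mulrDr -(cintD (dec _ Sf) (dec _ Sg)).
congr (_ * _); apply: eq_cint => t.
by rewrite (act_fD rel tauP zS Sf Sg) mulrDr.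
Qed.

(** Paired with z, both sides give al / n times the integral of h (f . (a z)), by associativity of
    the action. *)
Lemma coef_map_act h f a : schwartz h -> schwartz f ->
  coef_map h (act (iota a) f) = coef_map h f * iota a.
Proof.
move=> Sh Sf; have Sa := act_schwartz al_gt0 rel tauP (smooth_iota a) Sf.
have H k (Sk : schwartz k) := smoothG_coef_map al_gt0 rel dn Sh Sk.
have T k (Sk : schwartz k) z (zG : smoothG d n z) := tau_coef_map al_gt0 rel tauP dn Sh Sk zG.
apply: (coef_map_unique (H _ Sa) (smoothGM (H _ Sf) (iotaP a))) => z zG.
refine (etrans (T _ Sa _ zG) (etrans _ (congr1 tau (mulrA _ _ _)))).
refine (etrans _ (esym (T _ Sf _ (smoothGM (iotaP a) zG)))).
apply: (congr1 ( *%R (rc al / n%:R))); apply: eq_cint => t; apply: (congr1 ( *%R (h t))).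
by rewrite (act_mul al_gt0 rel tauP smoothM (smooth_iota a) (smoothG_sub6 rel zG) Sf).
Qed.

Lemma schwartz_module_dual_basis :
  [/\ finitely_generated schwartz_mod, projective schwartz_mod &
      K0trace (tau \o iota) (K0class schwartz_mod) = rc (al ^+ 2 / n%:R)].
Proof.
have [N [g [h [Sg Sh rep tr]]]] := weyl_frame al_gt0.
have cG i (m : schwartz_mod) : smoothG d n (coef_map (h i) (sfun m)).
  exact: (smoothG_coef_map al_gt0 rel dn (Sh i) (sfunP m)).
have [c cE] := choice (fun im : 'I_N * schwartz_mod => iota_onto (cG im.1 im.2)).
pose c' i m := c (i, m); pose g' i : schwartz_mod := SchwartzFun (Sg i).
have c'E i m : iota (c' i m) = coef_map (h i) (sfun m) by exact: cE.
have iota_inj : injective iota by case: AP.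
have cD i m m' : c' i (m + m') = c' i m + c' i m'.
  by apply: iota_inj; rewrite rmorphD !c'E; exact: (coef_mapD (Sh i) (sfunP m) (sfunP m')).
have cM i m a : c' i (ract m a) = c' i m * a.
  by apply: iota_inj; rewrite rmorphM !c'E; exact: (coef_map_act a (Sh i) (sfunP m)).
have gc m : \sum_i ract (g' i) (c' i m) = m.
  apply: sfun_inj; apply/funext => t; rewrite sfun_sum.
  rewrite -(reproducing al_gt0 rel tauP dn t Sg Sh rep (sfunP m)).
  by apply: eq_bigr => i _; rewrite -c'E.
split.
- exact: dual_basis_fg gc.
- exact: dual_basis_projective cD cM gc.
rewrite (dual_basis_trace cD cM gc) => [|a b|a b] /=; last first.
- by rewrite !rmorphM (tauC tauP).
- by rewrite rmorphD (tau_D tauP).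
have one : smoothG d n 1.
  by apply: (smoothG_A rel) => //; apply/(smoothA_wseries al); eexists; exact: (wseries1 al).
(* The diagonal entries have the traces given by [tau_coef_map] at z = 1, where the action is
   trivial. *)
transitivity (\sum_i rc (n%:R^-1) * (rc al * cintegral (fun t => h i t * g i t))).
  apply: eq_bigr => i _; rewrite c'E -[coef_map _ _]mulr1 (tau_coef_map al_gt0 rel tauP dn (Sh
    i) (Sg i) one).
  rewrite (act1 al_gt0 rel tauP)// mulrA; congr (_ * _).
  by rewrite mulrC fmorphV rmorph_nat.
by rewrite -mulr_sumr tr -rmorphM mulrC.
Qed.

End SchwartzModule.

Lemma smooth6E (R : realType) (B : cstarAlgType R) (U V W : B) :
  smoothG U V W 1 6 = smooth6 U V W.
Proof.
apply/funext => x; apply/propext; split=> -[y yA ->]; exists y => //; apply: eq_bigr => j _;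
  by rewrite mul1n.
Qed.

Theorem theorem2 (R : realType) (theta : R) (theta_gt0 : 0 < theta)
    (B : cstarAlgType R) (U V W : B) (univB : universal6 theta U V W)
    (tau : B -> R[i]) (tauP : canonical_trace U V W tau)
    (A6 : nzRingType) (iota6 : {rmorphism A6 -> B})
    (A6P : is_subring (smooth6 U V W) iota6)
    (A3 : nzRingType) (iota3 : {rmorphism A3 -> B})
    (A3P : is_subring (smooth3 U V W) iota3) :
  (forall f : R -> R[i], schwartz f -> opW (opW f) = opW2 f) /\
  exists (M6 : lmodType A6^c) (phi6 : {additive M6 -> (R -> R[i])})
         (M3 : lmodType A3^c) (phi3 : {additive M3 -> (R -> R[i])}),
    [/\ [/\ schwartz_module iota6 phi6 (Num.sqrt theta) U V,
            acts_as iota6 phi6 W (@opW R),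
            finitely_generated M6 &
            projective M6],
        [/\ schwartz_module iota3 phi3 (Num.sqrt theta) U V,
            acts_as iota3 phi3 (W ^+ 2) (@opW2 R),
            finitely_generated M3 &
            projective M3] &
        K0trace (tau \o iota6) (K0class M6) = ((theta / 6)%:C)%C /\
        K0trace (tau \o iota3) (K0class M3) = ((theta / 3)%:C)%C].
Proof.
split; first exact: opW_opW.
pose al := Num.sqrt theta; have al0 : 0 < al by rewrite sqrtr_gt0.
have al2 : al ^+ 2 = theta by rewrite sqr_sqrtr// ltW.
have rel : rel6 (al ^+ 2) U V W by rewrite al2; case: univB.
rewrite -smooth6E in A6P.
(* The smooth elements are the image of a ring, hence closed under products; this also serves
   3_theta, whose action is computed inside 6_theta. *)
have sM x y : smoothG U V W 1 6 x -> smoothG U V W 1 6 y -> smoothG U V W 1 6 (x * y).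
  exact: (smoothGM A6P).
have [fg6 pr6 tr6] := schwartz_module_dual_basis al0 rel tauP sM (erefl : (1 * 6 = 6)%N) A6P.
have [fg3 pr3 tr3] := schwartz_module_dual_basis al0 rel tauP sM (erefl : (2 * 3 = 6)%N) A3P.
exists (schwartz_mod al0 rel tauP sM A6P), (sfun_add al0 rel tauP sM A6P).
exists (schwartz_mod al0 rel tauP sM A3P), (sfun_add al0 rel tauP sM A3P).
split; [split => //|split => //|by rewrite -al2; split].
- exact: schwartz_module_sfun.
- move=> a aW m; rewrite sfun_ract aW; apply: (act_W al0 rel tauP); exact: sfunP.
- exact: schwartz_module_sfun.
- move=> a aW m; rewrite sfun_ract aW.
  have Sm : Defs.schwartz (sfun m) := sfunP m.
  have S1 : smoothG U V W 1 6 1.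
    by apply: (smoothG_A rel) => //; apply/(smoothA_wseries al); eexists; exact: wseries1.
  (* W^2 acts as W applied twice, which [opW_opW] identifies with [opW2]. *)
  by rewrite -[W ^+ 2]mul1r (act_mulWX al0 rel tauP 2 S1 Sm) (act1 al0 rel tauP Sm) -opW_opW.
Qed.
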